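(* Let $n\ge1$. The images in $R_n=\mathit{QSym}_n/\mathcal{E}_n$ of the quasisymmetric Schur polynomials $\{\mathcal{S}_\beta : \beta\in\mathsf{B}_n\}$ form a basis of the $\mathit{Sym}_n$-module $R_n$. (Since the positive-degree symmetric polynomials act by zero on $R_n$, this means they form a basis of $R_n$ as a $\mathbb{Q}$-vector space.)
   Context: Let $\mathbf{x}=\{x_1,\dots,x_n\}$. A composition is a finite sequence $\alpha=(\alpha_1,\dots,\alpha_k)$ of positive integers; $\bm{l}(\alpha)=k$ is its length; the empty composition (written $0$) is allowed. A polynomial $f\in\mathbb{Q}[\mathbf{x}]$ is quasisymmetric if for every composition $(\alpha_1,\dots,\alpha_k)$ with $k\le n$, the coefficient of $x_1^{\alpha_1}\cdots x_k^{\alpha_k}$ equals that of $x_{i_1}^{\alpha_1}\cdots x_{i_k}^{\alpha_k}$ for all $1\le i_1<\dots<i_k\le n$. $\mathit{QSym}_n$ is the ring of quasisymmetric polynomials in $\mathbf{x}$, $\mathit{Sym}_n$ the ring of symmetric polynomials, $\mathcal{E}_n$ the ideal of $\mathit{QSym}_n$ generated by the symmetric polynomials with zero constant term, and $R_n=\mathit{QSym}_n/\mathcal{E}_n$. The diagram of a composition $\alpha$ has $\alpha_i$ cells in row $i$ (rows numbered from the top, cells $(i,j)$ in matrix notation). A composition tableau of shape $\alpha$ is a filling $T$ of the cells with positive integers such that: (CT1) entries weakly decrease left to right along each row; (CT2) entries of the leftmost column strictly increase from top to bottom; (CT3, triple rule) for any two cells $(i,k)$, $(j,k)$ of the diagram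 with $i<j$: if $\alpha_i\ge\alpha_j$ (and $k\ge2$) then $T(j,k)<T(i,k)$ or $T(i,k-1)<T(j,k)$; if $\alpha_i<\alpha_j$ then $T(j,k)<T(i,k)$ or $T(i,k)<T(j,k+1)$. The weight of $T$ is $x^T=\prod_i x_i^{a_i}$ where $a_i$ is the number of entries equal to $i$. The quasisymmetric Schur polynomial is $\mathcal{S}_\alpha(x_1,\dots,x_n)=\sum_T x^T$ over composition tableaux of shape $\alpha$ with entries in $\{1,\dots,n\}$ ($\mathcal{S}_0=1$). A composition $\alpha$ is inverting if for each integer $i$ with $1<i\le\max_j\alpha_j$ there exist $s<t$ with $\alpha_s=i$, $\alpha_t=i-1$. Every composition factors uniquely as $\alpha=\gamma\,k^{i_k}\cdots2^{i_2}1^{i_1}$ ($i_j\ge1$) with $\gamma$ containing none of the values $1,\dots,k$ and $k\ge0$ maximal; $\alpha$ is pure if $k$ is even. $\mathsf{B}_n$ is the set of pure and inverting compositions of length at most $n$ (including the empty composition). *)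

(* Defs.v *)
From HB Require Import structures.
From mathcomp Require Import all_boot all_algebra.
From mathcomp Require Import mpoly.

Set Implicit Arguments.
Unset Strict Implicit.
Unset Printing Implicit Defensive.

Import GRing.Theory.
Local Open Scope ring_scope.

(* Variables x_1..x_n are 'X_0 .. 'X_(n-1) (0-indexed). Compositions are seq nat. *)

Definition is_composition (a : seq nat) : bool := all (fun x => (0 < x)%N) a.

(* The monomial x_{i_1}^{a_1} ... x_{i_k}^{a_k}, given 0-indexed positions i. *)
Definition qmono (n : nat) (a i : seq nat) : 'X_{1..n} :=
  [multinom nth 0%N a (index (nat_of_ord j) i) | j < n].

Definition qsym (n : nat) (p : {mpoly rat[n]}) : Prop :=
  forall (a i : seq nat), is_composition a -> (size a <= n)%N ->
    sorted ltn i -> all (fun t => (t < n)%N) i -> size i = size a ->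
    p@_(qmono n a i) = p@_(qmono n a (iota 0 (size a))).

Definition in_En (n : nat) (f : {mpoly rat[n]}) : Prop :=
  exists l : seq ({mpoly rat[n]} * {mpoly rat[n]}),
    (forall pr, pr \in l ->
       [/\ qsym pr.1, pr.2 \is symmetric & pr.2@_0%MM = 0]) /\
    f = \sum_(pr <- l) pr.1 * pr.2.

Fixpoint tuples_in (s : seq nat) (k : nat) : seq (seq nat) :=
  match k with
  | 0 => [:: [::]]
  | k'.+1 => [seq x :: t | x <- s, t <- tuples_in s k']
  end.

Fixpoint fillings (n : nat) (a : seq nat) : seq (seq (seq nat)) :=
  match a with
  | [::] => [:: [::]]
  | r :: a' => [seq x :: T | x <- tuples_in (iota 1 n) r, T <- fillings n a']
  end.

Definition entry (T : seq (seq nat)) (i k : nat) : nat := nth 0%N (nth [::] T i) k.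

Definition is_comp_tableau (a : seq nat) (T : seq (seq nat)) : bool :=
  [&& all (fun r => sorted geq r) T,
      sorted ltn [seq head 0%N r | r <- T] &
      all (fun i => all (fun j => all (fun k =>
         if (nth 0%N a j <= nth 0%N a i)%N then
           (k == 0%N) ||
           (entry T j k < entry T i k)%N || (entry T i k.-1 < entry T j k)%N
         else
           (entry T j k < entry T i k)%N || (entry T i k < entry T j k.+1)%N)
        (iota 0 (minn (nth 0%N a i) (nth 0%N a j))))
        (iota i.+1 (size a - i.+1))) (iota 0 (size a))].

Definition tab_weight (n : nat) (T : seq (seq nat)) : 'X_{1..n} :=
  [multinom count (pred1 (nat_of_ord j).+1) (flatten T) | j < n].

Definition qschur (n : nat) (a : seq nat) : {mpoly rat[n]} :=
  \sum_(T <- fillings n a | is_comp_tableau a T) 'X_[tab_weight n T].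

Definition inverting (a : seq nat) : Prop :=
  forall i : nat, (1 < i)%N -> (i <= \max_(x <- a) x)%N ->
    exists s t : nat, [/\ (s < t)%N, (t < size a)%N,
                          nth 0%N a s = i & nth 0%N a t = i.-1].

(* a = gamma k^{i_k} ... 2^{i_2} 1^{i_1}, i_j >= 1, gamma has no value in 1..k;
   exps lists (i_1, ..., i_k). *)
Definition factors_with (a : seq nat) (k : nat) : Prop :=
  exists (gamma exps : seq nat),
    [/\ size exps = k, all (fun e => (0 < e)%N) exps,
        all (fun x => (x < 1)%N || (k < x)%N) gamma &
        a = gamma ++ flatten [seq nseq (nth 0%N exps j.-1) j | j <- rev (iota 1 k)]].

Definition pure (a : seq nat) : Prop :=
  exists k : nat, [/\ factors_with a k,
                      (forall k', factors_with a k' -> (k' <= k)%N) & ~~ odd k].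

Definition inB (n : nat) (b : seq nat) : Prop :=
  [/\ is_composition b, (size b <= n)%N, inverting b & pure b].

(* Main.v *)
Require Import Defs.
From HB Require Import structures.
From mathcomp Require Import all_boot all_algebra.
From mathcomp Require Import mpoly.
From mathcomp Require Import zify.
From Stdlib Require Import ClassicalEpsilon.

(** Write [M_a] for the monomial quasisymmetric polynomials and [S_b] for the quasisymmetric
    Schur polynomials. The core is that a linear map [phi], defined on compositions of [d], is 0
    if it kills all [e_k M_w] with [k >= 1] and all [S_b] with [b] pure and inverting. This goes
    by induction on the sum of squares of a composition. Up to compositions with a smaller sum of
    squares, [e_k M_w] is the sum over all ways of turning a given number of the letters [t] of a
    word into [t + 1], or of shuffling letters 1 into a word; and [S_b] is [M_b], because an
    entry occurs at most once in each column of a tableau. So [phi] restricts to a function on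
    the words of fixed content whose sums over all redistributions of two consecutive letters,
    and over all positions of the letters 1, are 0. Such a function vanishes as soon as it
    vanishes on the pure inverting words.

    By induction on the degree, the [S_b] generate [QSym_n] as a [Sym_n]-module. Pairs of a
    partition with parts at most [n] and an element of [B_n] inject into the compositions of
    length at most [n], so in each degree the generating products [e_lambda S_b] are not more
    than the dimension: they are linearly independent, and the coefficient of [e_0 S_b] is a
    well-defined functional that vanishes on [E_n]. *)

Set Implicit Arguments.
Unset Strict Implicit.
Unset Printing Implicit Defensive.
Import GRing.Theory.
Local Open Scope ring_scope.

(** * Sums over bit patterns *)

(** Single words are too rigid for the vanishing argument, because a redistribution of two letters
    relates many words at once. The statements that carry the induction therefore concern sums in
    which some copies of each letter are shuffled into a prefix and the others stay fixed behind it
    ([Gv]). Adding up a relation over all placements inside a prefix gives a relation between such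
    sums ([merged_sum]). For a suitable choice all of its terms but one have more larger letters
    before the last copy of the smaller letter, so descending induction on that number applies; this
    yields vanishing from the inverting words alone. Purity concerns only the words whose letters 1
    form a final block, since all other inverting words are pure. For these the letters 1 and 2 are
    removed together, which preserves parity. The sums over all positions of the letters 1 enter
    here: they show that it does not matter how many letters 2 are fixed directly before the final
    block of letters 1, so that the case with all of them fixed, governed by purity, can be compared
    with the case with none fixed, governed by the relations. *)

Section BitSums.
Variable V : zmodType.
Implicit Types (F G : bitseq -> V) (a b d e : bitseq).

Fixpoint sumb (N i : nat) F : V :=
  match N with
  | 0 => if i is 0 then F [::] else 0
  | N'.+1 => (if i is i'.+1 then sumb N' i' (fun b => F (true :: b)) else 0)
             + sumb N' i (fun b => F (false :: b))
  end.

(** Indexed by the two letter counts, so that it reads as a sum over the shuffles of [i] copies of a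
    letter into [L] larger letters. *)
Definition sch (i L : nat) F : V := sumb (i + L) i F.
Arguments sch : simpl never.

Lemma eq_sumb N i F G :
  (forall b, size b = N -> count id b = i -> F b = G b) -> sumb N i F = sumb N i G.
Proof.
elim: N i F G => [|N IH] [|i] F G H //=.
- exact: H.
- by congr (_ + _); apply: IH => b sb cb; apply: H => //=; rewrite sb.
- by congr (_ + _); apply: IH => b sb cb; apply: H => //=; rewrite ?sb ?cb.
Qed.

Lemma sumb_const0 N i : sumb N i (fun=> 0) = 0.
Proof. by elim: N i => [|N IH] [|i] //=; rewrite !IH ?addr0. Qed.

Lemma sumb_eq0 N i F :
  (forall b, size b = N -> count id b = i -> F b = 0) -> sumb N i F = 0.
Proof. by move=> H; rewrite -(sumb_const0 N i); apply: eq_sumb. Qed.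

Lemma sumbD N i F G : sumb N i (fun b => F b + G b) = sumb N i F + sumb N i G.
Proof.
elim: N i F G => [|N IH] [|i] F G //=; rewrite ?addr0 ?IH ?addr0 ?add0r //.
by rewrite addrACA.
Qed.

Lemma sumbN N i F : sumb N i (fun b => - F b) = - sumb N i F.
Proof. by elim: N i F => [|N IH] [|i] F //=; rewrite ?oppr0 // !IH opprD ?oppr0. Qed.

Lemma sumb_sum (I : Type) (r : seq I) (P : pred I) N i (F : I -> bitseq -> V) :
  sumb N i (fun b => \sum_(j <- r | P j) F j b) = \sum_(j <- r | P j) sumb N i (F j).
Proof.
elim: r => [|x r IH]; first by under eq_sumb do rewrite big_nil; rewrite sumb_const0 big_nil.
under eq_sumb do rewrite big_cons; rewrite big_cons; case: (P x) => //.
by rewrite sumbD IH.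
Qed.

Lemma sumb_exch N i M j (F : bitseq -> bitseq -> V) :
  sumb N i (fun a => sumb M j (F a)) = sumb M j (fun b => sumb N i (fun a => F a b)).
Proof.
elim: N i F => [|N IH] [|i] F //=; rewrite ?sumb_const0 // ?IH ?sumbD ?sumb_const0 //.
Qed.

Lemma sumb_gt N i F : (N < i)%N -> sumb N i F = 0.
Proof. by elim: N i F => [|N IH] [|i] F //= Hi; rewrite !IH ?addr0 //; lia. Qed.

Lemma sumb_all0 N F : sumb N 0 F = F (nseq N false).
Proof. by elim: N F => [|N IH] F //=; rewrite add0r IH. Qed.

Lemma sumb_full N F : sumb N N F = F (nseq N true).
Proof. by elim: N F => [|N IH] F //=; rewrite IH sumb_gt ?addr0 //; lia. Qed.

Lemma sumb_cat N1 N2 k F :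
  sumb (N1 + N2) k F =
  \sum_(i < k.+1) sumb N1 i (fun a => sumb N2 (k - i) (fun b => F (a ++ b))).
Proof.
elim: N1 k F => [|N1 IH] k F /=.
  rewrite big_ord_recl /= subn0 big1 ?addr0 //.
rewrite IH; case: k => [|k].
  by rewrite !big_ord1.
rewrite IH [in RHS]big_ord_recl /= add0r.
rewrite [X in _ + X]big_ord_recl /= addrCA; congr (_ + _).
rewrite -big_split /=; apply: eq_bigr => i _ /=.
by rewrite /bump /= add1n subSS.
Qed.

Lemma sumb_one a F :
  sumb (size a) (count id a) F =
  F a + sumb (size a) (count id a) (fun b => if b == a then 0 else F b).
Proof.
elim: a F => [|x a IH] F /=; first by rewrite addr0.
case: x => /=; rewrite ?add1n ?add0n.
- by rewrite IH -addrA; congr (_ + (_ + _)).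
- rewrite [X in _ + X]IH addrCA; congr (_ + (_ + _)).
Qed.

Lemma sch00 F : sch 0 0 F = F [::]. Proof. by []. Qed.
Lemma sch0 L F : sch 0 L F = F (nseq L false). Proof. exact: sumb_all0. Qed.
Lemma schn0 i F : sch i 0 F = F (nseq i true). Proof. by rewrite /sch addn0 sumb_full. Qed.
Lemma schSS i L F :
  sch i.+1 L.+1 F = sch i L.+1 (fun b => F (true :: b)) + sch i.+1 L (fun b => F (false :: b)).
Proof. by rewrite /sch /= addnS. Qed.
Lemma sch0S L F : sch 0 L.+1 F = sch 0 L (fun b => F (false :: b)).
Proof. by rewrite !sch0. Qed.
Lemma schS0 i F : sch i.+1 0 F = sch i 0 (fun b => F (true :: b)).
Proof. by rewrite !schn0. Qed.

Lemma eq_sch i L F G :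
  (forall b, size b = i + L -> count id b = i -> count negb b = L -> F b = G b) ->
  sch i L F = sch i L G.
Proof.
move=> H; apply: eq_sumb => b sb cb; apply: H => //.
by have := count_predC id b; rewrite sb cb => /addnI <-; apply: eq_count.
Qed.

Lemma sch_eq0 i L F :
  (forall b, size b = i + L -> count id b = i -> count negb b = L -> F b = 0) ->
  sch i L F = 0.
Proof. by move=> H; rewrite (eq_sch (G := fun=> 0)) // /sch sumb_const0. Qed.

(* The merged pattern [d] marks the positions of two consecutive letters, and [e] tells
   which of them are the smaller one. *)
Fixpoint fill1 d e : bitseq :=
  match d, e with
  | true :: d', x :: e' => x :: fill1 d' e'
  | false :: d', _ => false :: fill1 d' e
  | _, _ => [::]
  end.

Fixpoint fill2 d e : bitseq :=
  match d, e with
  | true :: d', x :: e' => if x then fill2 d' e' else true :: fill2 d' e'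
  | false :: d', _ => false :: fill2 d' e
  | _, _ => [::]
  end.

Lemma fill1_cat d1 d2 e1 e2 : count id d1 = size e1 ->
  fill1 (d1 ++ d2) (e1 ++ e2) = fill1 d1 e1 ++ fill1 d2 e2.
Proof.
elim: d1 e1 => [|[] d1 IH] e1 /=.
- by case: e1.
- by case: e1 => [|x e1] //= [/IH->].
- by rewrite add0n => H; rewrite IH //; case: e1 H.
Qed.

Lemma fill2_cat d1 d2 e1 e2 : count id d1 = size e1 ->
  fill2 (d1 ++ d2) (e1 ++ e2) = fill2 d1 e1 ++ fill2 d2 e2.
Proof.
elim: d1 e1 => [|[] d1 IH] e1 /=.
- by case: e1.
- by case: e1 => [|[] e1] //= [/IH->].
- by rewrite add0n => H; rewrite IH //; case: e1 H.
Qed.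

Lemma size_fill1 d e : count id d = size e -> size (fill1 d e) = size d.
Proof.
elim: d e => [|[] d IH] e //=; first by case: e => [|x e] //= [/IH->].
by rewrite add0n => /IH H; rewrite -H; case: e {H}.
Qed.

Lemma count_fill1 d e : count id d = size e -> count id (fill1 d e) = count id e.
Proof.
elim: d e => [|[] d IH] e //=; first by case: e.
- by case: e => [|x e] //= [/IH->].
- by rewrite add0n => /IH <-.
Qed.

Lemma size_fill2 d e : count id d = size e -> size (fill2 d e) = count negb d + count negb e.
Proof.
elim: d e => [|[] d IH] e //=; first by case: e.
- by case: e => [|[] e] //= [/IH->]; lia.
- by rewrite add0n => /IH ->; lia.
Qed.

Lemma count_fill2 d e : count id d = size e -> count id (fill2 d e) = count negb e.
Proof.
elim: d e => [|[] d IH] e //=; first by case: e.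
- by case: e => [|[] e] //= [/IH->]; lia.
- by rewrite add0n => /IH <-.
Qed.

Lemma schE i L F : (0 < i + L)%N ->
  sch i L F = (if i is i'.+1 then sch i' L (fun b => F (true :: b)) else 0) +
              (if L is L'.+1 then sch i L' (fun b => F (false :: b)) else 0).
Proof.
case: i L => [|i] [|L]; first by rewrite addn0.
- by rewrite sch0S add0r.
- by rewrite schS0 addr0.
- by rewrite schSS.
Qed.

Lemma schD i L F G : sch i L (fun b => F b + G b) = sch i L F + sch i L G.
Proof. exact: sumbD. Qed.

(** Both sides run over the words with [p] smallest, [q] middle and [s] largest letters. The left
    side chooses the places of the two smaller letters and then separates them; the right side
    inserts one letter after the other. The sums [A], [B], [C] sort the words by their first
    letter. *)
Lemma sch_fill p q s (F : bitseq -> bitseq -> V) :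
  sch (p + q) s (fun d => sch p q (fun e => F (fill1 d e) (fill2 d e))) =
  sch q s (fun b2 => sch p (q + s) (fun b1 => F b1 b2)).
Proof.
have [n] := ubnP (p + q + s); elim: n p q s F => // n IH p q s F lt.
have [/eqP|pos] := posnP (p + q + s).
  by rewrite !addn_eq0 => /andP[/andP[/eqP-> /eqP->] /eqP->].
have ipqs : forall q' s', (q' + s' = q + s)%N -> (0 < p + (q' + s'))%N by lia.
pose A := if p is p'.+1 then
   sch q s (fun b2 => sch p' (q + s) (fun b1 => F (true :: b1) b2)) else 0.
pose B := if q is q'.+1 then
   sch q' s (fun b2 => sch p (q' + s) (fun b1 => F (false :: b1) (true :: b2))) else 0.
pose C := if s is s'.+1 then
   sch q s' (fun b2 => sch p (q + s') (fun b1 => F (false :: b1) (false :: b2))) else 0.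
transitivity (A + B + C).
- rewrite schE //; congr (_ + _); last first.
    by rewrite /C; case: s lt {pos ipqs A B C} => [|s] lt //=;
      rewrite (IH p q s (fun x y => F (false :: x) (false :: y))) //; lia.
  case: p lt pos @A @B {ipqs C} => [|p] lt pos; case: q lt pos => [|q] lt pos A B;
    rewrite /A /B ?addr0 ?add0r //=.
  + under eq_sch do rewrite sch0S /=.
    by rewrite -[q in sch q]add0n (IH 0 q s (fun x y => F (false :: x) (true :: y))) //; lia.
  + rewrite addn0; under eq_sch do rewrite schS0 /=.
    by rewrite -{1}[p]addn0 (IH p 0 s (fun x y => F (true :: x) y)) //; lia.
  + under eq_sch do rewrite schSS /=.
    rewrite schD (IH p q.+1 s (fun x y => F (true :: x) y)); last lia.
    rewrite addnS -addSn (IH p.+1 q s (fun x y => F (false :: x) (true :: y))) //; lia.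
- have -> : sch q s (fun b2 => sch p (q + s) (fun b1 => F b1 b2)) =
    sch q s (fun b2 => (if p is p'.+1 then sch p' (q + s) (fun b1 => F (true :: b1) b2) else 0) +
      (if (q + s)%N is t.+1 then sch p t (fun b1 => F (false :: b1) b2) else 0)).
    by apply: eq_sch => b _ _ _; apply: schE; lia.
  rewrite schD -addrA; congr (_ + _).
    by rewrite /A; case: p {lt pos ipqs A B C} => // ; rewrite /sch sumb_const0.
  rewrite /B /C; case: q {lt pos ipqs A B C} => [|q]; case: s => [|s] /=.
  + by rewrite addr0.
  + by rewrite add0r sch0S.
  + by rewrite addr0 schS0 addn0.
  + by rewrite schSS addnS.
Qed.
End BitSums.

Arguments sch : simpl never.

(** * Functions on words *)

Section Codes.
Variable V : zmodType.
Implicit Types (f g : seq bitseq -> V) (c : seq nat) (b d e : bitseq) (x v : seq bitseq).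

(* A word with [c_j] letters [j], for all [j], is coded by patterns [b_1 :: b_2 :: ...]: [b_j]
   marks the letters [j] among the letters that are at least [j]. *)
Fixpoint vcode c x : bool :=
  match c, x with
  | [::], [::] => true
  | m :: c', b :: x' => [&& count id b == m, size b == m + sumn c' & vcode c' x']
  | _, _ => false
  end%N.

(* For all consecutive letters [j] and [j + 1], the sum of [f] over all ways to redistribute
   them over the positions that they occupy is 0. *)
Fixpoint Rel c f : Prop :=
  match c with
  | [::] => True
  | m :: c' =>
    (if c' is p :: c'' then
       forall d v, size d = (m + p + sumn c'')%N -> count id d = (m + p)%N -> vcode c'' v ->
         sch m p (fun e => f (fill1 d e :: fill2 d e :: v)) = 0
     else True) /\
    (forall b, count id b = m -> size b = (m + sumn c')%N -> Rel c' (fun x => f (b :: x)))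
  end.

Lemma count_negb b : count negb b = (size b - count id b)%N.
Proof. by rewrite -(count_predC id b) addKn; apply: eq_count. Qed.

Lemma vcode_fill m p c'' d e v :
  size d = (m + p + sumn c'')%N -> count id d = (m + p)%N -> vcode c'' v ->
  size e = (m + p)%N -> count id e = m ->
  vcode (m :: p :: c'') (fill1 d e :: fill2 d e :: v).
Proof.
move=> sd cd vv se ce; have cde : count id d = size e by rewrite cd se.
rewrite /= count_fill1 // count_fill2 // size_fill1 // size_fill2 // !count_negb.
by rewrite vv sd cd se ce; lia.
Qed.

Lemma Rel0 c : Rel c (fun=> 0).
Proof.
elim: c => [|m c IH] //=; split=> [|b _ _ //].
by case: c {IH} => // p c d v _ _ _; apply: sch_eq0.
Qed.

Lemma RelD c f g : Rel c f -> Rel c g -> Rel c (fun x => f x + g x).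
Proof.
elim: c f g => [|m c IH] f g //= [F1 F2] [G1 G2]; split.
  case: c {IH F2 G2} F1 G1 => [|p c] F1 G1 // d v sd cd vv.
  by rewrite schD F1 // G1 // addr0.
by move=> b cb sb; apply: IH; [apply: F2|apply: G2].
Qed.

Lemma RelN c f : Rel c f -> Rel c (fun x => - f x).
Proof.
elim: c f => [|m c IH] f //= [F1 F2]; split.
  case: c {IH F2} F1 => [|p c] F1 // d v sd cd vv.
  by rewrite /sch sumbN -/(sch _ _ _) F1 // oppr0.
by move=> b cb sb; apply: IH; apply: F2.
Qed.

Lemma RelB c f g : Rel c f -> Rel c g -> Rel c (fun x => f x - g x).
Proof. by move=> Hf Hg; apply: RelD => //; apply: RelN. Qed.

Lemma Rel_sumb c N i (F : bitseq -> seq bitseq -> V) :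
  (forall b, size b = N -> count id b = i -> Rel c (F b)) ->
  Rel c (fun x => sumb N i (fun b => F b x)).
Proof.
elim: N i F => [|N IH] [|i] F H //=.
- exact: H.
- exact: Rel0.
- by apply: RelD; [exact: Rel0|apply: IH => b sb cb; apply: H; rewrite /= ?sb].
- by apply: RelD; apply: IH => b sb cb; apply: H; rewrite /= ?sb ?cb.
Qed.

Definition tailok m c i L b :=
  [&& i <= m, L <= sumn c, count id b == m - i & size b == m - i + (sumn c - L)]%N.

(* Of the copies of the smallest letter, [i] are shuffled into the first [L] larger letters; the
   other ones stand behind these, at the places given by [b]. *)
Definition Tz i L b f : seq bitseq -> V := fun x => sch i L (fun b1 => f ((b1 ++ b) :: x)).

Lemma tail_vcode m c i L b b1 x : tailok m c i L b -> size b1 = (i + L)%N ->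
  count id b1 = i -> vcode c x -> vcode (m :: c) ((b1 ++ b) :: x).
Proof.
case/and4P=> im Lc /eqP cb /eqP sb s1 c1 vx.
by rewrite /= vx count_cat size_cat cb sb c1 s1; lia.
Qed.

Lemma Rel_Tz m c i L b f : Rel (m :: c) f -> tailok m c i L b -> Rel c (Tz i L b f).
Proof.
case=> _ H /and4P[im Lc /eqP cb /eqP sb]; apply: Rel_sumb => b1 s1 c1.
by apply: H; rewrite ?count_cat ?size_cat ?cb ?sb ?c1 ?s1; lia.
Qed.

(* [Gv c k L f] says that [f] vanishes on all sums of words obtained as follows: letters are
   added from the largest to the smallest one; of the copies of each letter, some are shuffled
   in all possible ways into the prefix built so far, which contains all previously shuffled
   copies, and the other copies are put at fixed places behind that prefix. In all [k] copies
   are shuffled, and the final prefix has length [L]. *)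
Fixpoint Gv c k L f : Prop :=
  match c with
  | [::] => k = 0%N -> L = 0%N -> f [::] = 0
  | m :: c' => forall i L' L0 b, (i <= k)%N -> (L' + i)%N = L -> (L0 <= L')%N ->
      tailok m c' i L' b -> Gv c' (k - i)%N L0 (Tz i L' b f)
  end.

Lemma eq_Tz m c i L b f g x : (forall x, vcode (m :: c) x -> f x = g x) ->
  tailok m c i L b -> vcode c x -> Tz i L b f x = Tz i L b g x.
Proof.
by move=> E ok vx; rewrite /Tz; apply: eq_sch => b1 s1 c1 _; apply: E; exact: tail_vcode ok s1 c1 vx.
Qed.

Lemma Gv_ext c k L f g : (forall x, vcode c x -> f x = g x) -> Gv c k L f -> Gv c k L g.
Proof.
elim: c k L f g => [|m c IH] k L f g E /=; first by rewrite E.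
move=> H i L' L0 b ik Li L0L ok; apply: IH (H i L' L0 b ik Li L0L ok) => x vx.
exact: eq_Tz E ok vx.
Qed.

Lemma Gv0 c k L : Gv c k L (fun=> 0).
Proof.
elim: c k L => [|m c IH] k L //= i L' L0 b ik Li L0L ok.
by apply: Gv_ext (IH _ _) => x vx; rewrite /Tz sch_eq0.
Qed.

Lemma GvD c k L f g : Gv c k L f -> Gv c k L g -> Gv c k L (fun x => f x + g x).
Proof.
elim: c k L f g => [|m c IH] k L f g /= Hf Hg; first by move=> k0 L0; rewrite Hf // Hg // addr0.
move=> i L' L0 b ik Li L0L ok.
by apply: Gv_ext (IH _ _ _ _ (Hf _ _ _ _ ik Li L0L ok) (Hg _ _ _ _ ik Li L0L ok)) => x vx;
  rewrite /Tz schD.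
Qed.

Lemma GvN c k L f : Gv c k L f -> Gv c k L (fun x => - f x).
Proof.
elim: c k L f => [|m c IH] k L f /= Hf; first by move=> k0 L0; rewrite Hf // oppr0.
move=> i L' L0 b ik Li L0L ok.
by apply: Gv_ext (IH _ _ _ (Hf _ _ _ _ ik Li L0L ok)) => x vx; rewrite /Tz /sch sumbN.
Qed.

Lemma GvB c k L f g : Gv c k L f -> Gv c k L g -> Gv c k L (fun x => f x - g x).
Proof. by move=> Hf Hg; apply: GvD => //; apply: GvN. Qed.

Lemma Gv_sumb c k L N i (F : bitseq -> seq bitseq -> V) :
  (forall b, size b = N -> count id b = i -> Gv c k L (F b)) ->
  Gv c k L (fun x => sumb N i (fun b => F b x)).
Proof.
elim: N i F => [|N IH] [|i] F H //=.
- exact: H.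
- exact: Gv0.
- by apply: GvD; [exact: Gv0|apply: IH => b sb cb; apply: H; rewrite /= ?sb].
- by apply: GvD; apply: IH => b sb cb; apply: H; rewrite /= ?sb ?cb.
Qed.

Lemma Gv_sum c k L (I : Type) (r : seq I) (P : pred I) (F : I -> seq bitseq -> V) :
  (forall i, P i -> Gv c k L (F i)) -> Gv c k L (fun x => \sum_(i <- r | P i) F i x).
Proof.
move=> H; elim: r => [|i r IH].
  by apply: Gv_ext (Gv0 c k L) => x _; rewrite big_nil.
have [Pi|Pi] := boolP (P i).
  by apply: Gv_ext (GvD (H i Pi) IH) => x _; rewrite big_cons Pi.
by apply: Gv_ext IH => x _; rewrite big_cons (negbTE Pi).
Qed.

(** All [k] shuffled copies lie in the final prefix, so no sum has a prefix shorter than [k]. *)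
Lemma Gv_big c k L f : (L < k)%N -> Gv c k L f.
Proof.
elim: c k L f => [|m c IH] k L f lt /=; first by lia.
by move=> i L' L0 b ik Li L0L ok; apply: IH; lia.
Qed.

Lemma Gv_word c f : Gv c 0 0 f -> forall x, vcode c x -> f x = 0.
Proof.
elim: c f => [|m c IH] f /= H [|b x] //; first by rewrite H.
case/and3P=> /eqP cb /eqP sb vx.
have ok : tailok m c 0 0 b by rewrite /tailok cb sb !subn0 !eqxx.
by have := IH _ (H 0%N 0%N 0%N b (leqnn _) erefl (leqnn _) ok) x vx; rewrite /Tz sch00.
Qed.

(** A prefix of length 1 made of one shuffled letter is the first letter of the word, so every sum
    is a single word. This form is for functions whose sums are controlled only for [0 < k], as in
    [Gv_g]. *)
Lemma Gv_word1 c f : (0 < sumn c)%N -> Gv c 1 1 f -> forall x, vcode c x -> f x = 0.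
Proof.
elim: c f => [|m c IH] f // pos /= H [|b x] //.
case/and3P=> /eqP cb /eqP sb vx.
case: b cb sb => [|[] b] /= cb sb; first by move: pos; rewrite /= -sb.
- have ok : tailok m c 1 0 b by rewrite /tailok; lia.
  have := Gv_word (H 1%N 0%N 0%N b (leqnn _) erefl (leqnn _) ok) vx.
  by rewrite /Tz schn0.
- have ok : tailok m c 0 1 b by rewrite /tailok; have := count_size id b; lia.
  have := IH _ _ (H 0%N 1%N 1%N b isT erefl (leqnn _) ok) x vx.
  by rewrite /Tz sch0 /=; apply; have := count_size id b; lia.
Qed.

Lemma tail_fill1 m p c'' i n L d2 e :
  (i <= m)%N -> (i <= n)%N -> (n <= m + p)%N -> count id d2 = (m + p - n)%N ->
  (L + count negb d2)%N = sumn c'' -> size e = (m + p - n)%N -> count id e = (m - i)%N ->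
  tailok m (p :: c'') i (n - i + L) (fill1 d2 e).
Proof.
move=> im inn nmp cd sd se ce; have cde : count id d2 = size e by rewrite cd se.
rewrite /tailok count_fill1 // size_fill1 //= ce.
have := count_size id e; have := count_size id d2; rewrite count_negb in sd.
by lia.
Qed.

Lemma tail_fill2 m p c'' i n L d2 e :
  (i <= m)%N -> (i <= n)%N -> (n <= m + p)%N -> count id d2 = (m + p - n)%N ->
  (L + count negb d2)%N = sumn c'' -> size e = (m + p - n)%N -> count id e = (m - i)%N ->
  tailok p c'' (n - i) L (fill2 d2 e).
Proof.
move=> im inn nmp cd sd se ce; have cde : count id d2 = size e by rewrite cd se.
rewrite /tailok count_fill2 // size_fill2 // [count negb e]count_negb ce.
have := count_size id e; have := count_size id d2.
by lia.
Qed.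

(** Let [d1] range over the prefixes with [n] merged places and [L] other letters, in front of the
    fixed [d2], and add up the relations for [d1 ++ d2]. Sorting the terms by the number [i] of
    smaller letters in the prefix and by the pattern [e] behind it leaves free shuffles of both
    letters into the prefix. *)
Lemma merged_sum m p c'' f n L d2 v :
  Rel (m :: p :: c'') f -> (n <= m + p)%N -> count id d2 = (m + p - n)%N ->
  (L + count negb d2)%N = sumn c'' -> vcode c'' v ->
  \sum_(i < m.+1) (if (i <= n)%N then
     sumb (m + p - n) (m - i) (fun e =>
       Tz (n - i) L (fill2 d2 e) (Tz i (n - i + L) (fill1 d2 e) f) v) else 0) = 0.
Proof.
case=> R _ nmp cd2 sd2 vv.
transitivity (sch n L (fun d1 => sch m p (fun e => f (fill1 (d1 ++ d2) e :: fill2 (d1 ++ d2) e :: v)))).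
  transitivity (sch n L (fun d1 => \sum_(i < m.+1)
    sumb n i (fun e1 => sumb (m + p - n) (m - i) (fun e2 =>
      f ((fill1 d1 e1 ++ fill1 d2 e2) :: (fill2 d1 e1 ++ fill2 d2 e2) :: v))))).
    rewrite [in RHS]/sch sumb_sum; apply: eq_bigr => i _.
    have [le|gt] := leqP i n; last first.
      by symmetry; apply: sumb_eq0 => d1 _ _; rewrite sumb_gt.
    symmetry; under eq_sumb do rewrite sumb_exch.
    rewrite sumb_exch; apply: eq_sumb => e2 se2 ce2.
    rewrite -/(sch _ _ _); have En : (n = i + (n - i))%N by lia.
    rewrite [in LHS]En -{2}En.
    transitivity (sch (i + (n - i)) L (fun d1 => sch i (n - i) (fun e1 =>
      f ((fill1 d1 e1 ++ fill1 d2 e2) :: (fill2 d1 e1 ++ fill2 d2 e2) :: v)))).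
      by rewrite /sch -En.
    exact: (sch_fill i (n - i) L (fun b1 b2 => f ((b1 ++ fill1 d2 e2) :: (b2 ++ fill2 d2 e2) :: v))).
  apply: eq_sch => d1 s1 c1 n1; rewrite [in RHS]/sch.
  rewrite -[X in sumb X m](subnKC nmp) sumb_cat; apply: eq_bigr => i _.
  apply: eq_sumb => e1 se1 ce1; apply: eq_sumb => e2 se2 ce2.
  by rewrite fill1_cat ?fill2_cat // c1 se1.
apply: sch_eq0 => d1 s1 c1 n1; apply: R => //; rewrite ?size_cat ?count_cat.
  by rewrite s1 -sd2 -(count_predC id d2) cd2 (eq_count (a2 := negb)) //; lia.
by rewrite c1 cd2; lia.
Qed.

Lemma Gv_lead m p c'' f n L d2 k L0 i0 e0 :
  Rel (m :: p :: c'') f -> (n <= m + p)%N -> count id d2 = (m + p - n)%N ->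
  (L + count negb d2)%N = sumn c'' ->
  (i0 <= m)%N -> (i0 <= n)%N -> size e0 = (m + p - n)%N -> count id e0 = (m - i0)%N ->
  (forall i e, (i <= m)%N -> (i <= n)%N -> size e = (m + p - n)%N ->
     count id e = (m - i)%N -> ~~ ((i == i0) && (e == e0)) ->
     Gv c'' k L0 (Tz (n - i) L (fill2 d2 e) (Tz i (n - i + L) (fill1 d2 e) f))) ->
  Gv c'' k L0 (Tz (n - i0) L (fill2 d2 e0) (Tz i0 (n - i0 + L) (fill1 d2 e0) f)).
Proof.
move=> R nmp cd2 sd2 im0 in0 se0 ce0 H.
pose Phi i e := Tz (n - i) L (fill2 d2 e) (Tz i (n - i + L) (fill1 d2 e) f).
pose Psi v := \sum_(i < m.+1) (if (i <= n)%N then sumb (m + p - n) (m - i)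
  (fun e => if (nat_of_ord i == i0) && (e == e0) then 0 else Phi i e v) else 0).
suff HP : Gv c'' k L0 Psi.
  apply: Gv_ext (GvN HP) => v vv; apply/esym/eqP; rewrite -addr_eq0 -/(Phi i0 e0) /Psi.
  apply/eqP; rewrite -[RHS](merged_sum R nmp cd2 sd2 vv).
  have im0' : (i0 < m.+1)%N by [].
  rewrite (bigD1 (Ordinal im0')) //= in0 eqxx /=.
  rewrite [RHS](bigD1 (Ordinal im0')) //= in0 addrA; congr (_ + _).
    by rewrite -se0 -ce0 -sumb_one.
  apply: eq_bigr => i /negbTE ne; case: ifP => // _; apply: eq_sumb => e _ _.
  by move: ne; rewrite -val_eqE /= => ->.
apply: Gv_sum => i _; have [le|_] := leqP i n; last exact: Gv0.
apply: Gv_sumb => e se ce.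
have [_|ne] := boolP ((nat_of_ord i == i0) && (e == e0)); first exact: Gv0.
by apply: H => //; rewrite -ltnS.
Qed.

End Codes.

(** * How far the last copy of a letter reaches, and the effect of a redistribution on it *)

Section Gam.
Implicit Types (a b d e : bitseq).

(* The number of [false]s before the last [true]. *)
Fixpoint gam b : nat :=
  if b is x :: b' then (if has id b then ~~ x + gam b' else 0)%N else 0%N.

Lemma has_count_id b : has id b = (0 < count id b)%N.
Proof. exact: has_count. Qed.

Lemma gam0 b : ~~ has id b -> gam b = 0%N.
Proof. by case: b => //= x b /negbTE ->. Qed.

Lemma gam_cat b1 b2 : has id b2 -> gam (b1 ++ b2) = (count negb b1 + gam b2)%N.
Proof.
move=> h2; elim: b1 => //= x b1 IH.
by rewrite has_cat h2 !orbT IH addnA.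
Qed.

Lemma gam_catF b k : gam (b ++ nseq k false) = gam b.
Proof.
have hF : has id (nseq k false) = false by rewrite has_nseq andbF.
elim: b => [|x b IH] /=; first by rewrite gam0 ?hF.
by rewrite has_cat hF orbF IH.
Qed.

Lemma gam_le b : (gam b <= count negb b)%N.
Proof. by elim: b => //= x b IH; case: ifP => // _; rewrite leq_add2l. Qed.

Lemma count_id_full e : count id e = size e -> e = nseq (size e) true.
Proof.
elim: e => //= -[] e IH /=; first by rewrite add1n => -[/IH <-].
by rewrite add0n => H; have := count_size id e; rewrite H ltnn.
Qed.

Lemma count_id_none e : count id e = 0%N -> e = nseq (size e) false.
Proof. by elim: e => //= -[] e IH //=; rewrite add0n => /IH <-. Qed.

Lemma gam_split b : exists a k,
  [/\ b = a ++ nseq k false, count negb a = gam b & has id b -> last false a].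
Proof.
elim: b => [|x b [a [k [E Ea la]]]]; first by exists [::], 0%N.
have [h|h] := boolP (has id b).
  by exists (x :: a), k; rewrite /= -E Ea h orbT; split => // _; move: (la h); case: (a).
have bF : b = nseq (size b) false.
  by apply: count_id_none; move: h; rewrite has_count_id; lia.
case: x; last first.
  exists [::], (size b).+1; rewrite /= -bF (negbTE h) /=; split=> //.
by exists [:: true], (size b); rewrite /= -bF gam0.
Qed.

Lemma fill1_true a : fill1 a (nseq (count id a) true) = a.
Proof. by elim: a => //= -[] a IH /=; rewrite ?add1n ?add0n /= ?IH //; case: (nseq _ _). Qed.

Lemma fill2_true a : fill2 a (nseq (count id a) true) = nseq (count negb a) false.
Proof. by elim: a => //= -[] a IH /=; rewrite ?add1n ?add0n /= ?IH //; case: (nseq _ _). Qed.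

Lemma fill1_false a : fill1 a (nseq (count id a) false) = nseq (size a) false.
Proof. by elim: a => //= -[] a IH /=; rewrite ?add1n ?add0n /= ?IH //; case: (nseq _ _). Qed.

Lemma fill2_false a : fill2 a (nseq (count id a) false) = a.
Proof. by elim: a => //= -[] a IH /=; rewrite ?add1n ?add0n /= ?IH //; case: (nseq _ _). Qed.

(** Unless the smaller letters fill exactly the merged places of [a], one of them stands in [d].
    Then [gam] counts every letter of [a] that is not a smaller one, including the merged places of
    [a] that went to the larger letter. With the surplus [count id e - s] this exceeds
    [count negb a] by at least the number of smaller letters in [d]. *)
Lemma gam_fill_lt a d e s q : count id a = s -> count id d = q -> size e = (s + q)%N ->
  (s <= count id e)%N -> e != nseq s true ++ nseq q false ->
  (count negb a < count id e - s + gam (fill1 (a ++ d) e))%N.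
Proof.
move=> ca cd se le ne.
pose ea := take s e; pose eb := drop s e.
have sea : size ea = s by rewrite size_takel // se leq_addr.
have seb : size eb = q by rewrite size_drop se addKn.
have E : e = ea ++ eb by rewrite cat_take_drop.
have ce : count id e = (count id ea + count id eb)%N by rewrite E count_cat.
have cea : (count id ea <= s)%N by rewrite -sea count_size.
have ca' : count id a = size ea by rewrite ca.
rewrite {2}E fill1_cat //.
have [h|h] := boolP (has id eb).
  have hd : has id (fill1 d eb) by rewrite has_count_id count_fill1 ?cd ?seb // -has_count_id.
  rewrite gam_cat // [count negb (fill1 _ _)]count_negb size_fill1 // count_fill1 //.
  move: h; rewrite has_count_id count_negb; have := count_size id a; lia.
case/negP: ne; rewrite has_count_id -leqNgt leqn0 in h.
move/eqP in h; rewrite {1}E.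
rewrite (count_id_none h) (@count_id_full ea) ?sea ?seb //; lia.
Qed.

End Gam.

(** * Vanishing on all words from vanishing on the inverting words *)

Section SR.
Variable V : zmodType.
Implicit Types (f F : seq bitseq -> V) (c : seq nat) (b d e : bitseq) (x v : seq bitseq).

(* In [hasin (gam b) x] and [inv]: before the last letter [j] there is a letter [j + 1]. *)
Definition hasin g x := if x is b :: _ then true \in take g b else true.

Fixpoint inv x : bool := if x is b :: x' then hasin (gam b) x' && inv x' else true.

(** Covers the words whose smallest letter avoids the first [g] places. There [hasin g] fails, so a
    hypothesis on inverting words that satisfy [hasin g] says nothing about them. *)
Definition Nv c k L g f : Prop :=
  if c is m :: c' then
    forall L0 b, (L0 <= L)%N -> (g <= sumn c')%N -> count id b = m ->
      size b = (m + (sumn c' - g))%N ->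
      Gv c' k L0 (fun x => f ((nseq g false ++ b) :: x))
  else True.

(** When the letters of size [p] come after all letters counted by [L + gam b], the pattern [e0],
    which gives the first merged places to the smaller letter, reproduces [b]. By [gam_fill_lt]
    every other redistribution puts more larger letters before the last smaller one, and these terms
    vanish by hypothesis. *)
Lemma Nv_pattern m p c'' f k i L b L0 :
  Rel (m :: p :: c'') f -> (i < m)%N -> (i <= k)%N -> tailok m (p :: c'') i L b -> (L0 <= L)%N ->
  (forall i1 b', (i1 <= i)%N -> tailok m (p :: c'') i1 (i - i1 + L) b' ->
     (L + gam b < i - i1 + L + gam b')%N ->
     Gv (p :: c'') (k - i1) (i - i1 + L) (Tz i1 (i - i1 + L) b' f)) ->
  Nv (p :: c'') (k - i) L0 (L + gam b) (Tz i L b f).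
Proof.
move=> R im ik ok L0L H L1 b3 L1L0 gc cb3 sb3.
case/and4P: (ok) => _ Lc /eqP cb /eqP sb.
have [a [q [Eb Ea _]]] := gam_split b.
have ca : count id a = (m - i)%N.
  by rewrite -cb Eb count_cat count_nseq mul0n addn0.
have nmp : (i <= m + p)%N by lia.
have cd2 : count id (a ++ b3) = (m + p - i)%N by rewrite count_cat ca cb3; lia.
have nb3 : count negb b3 = (sumn c'' - (L + gam b))%N by rewrite count_negb sb3 cb3; lia.
have sd2 : (L + count negb (a ++ b3))%N = sumn c'' by rewrite count_cat Ea nb3; lia.
pose e0 := nseq (m - i) true ++ nseq p false.
have se0 : size e0 = (m + p - i)%N by rewrite size_cat !size_nseq; lia.
have ce0 : count id e0 = (m - i)%N by rewrite count_cat !count_nseq /= mul1n mul0n addn0.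
have := @Gv_lead V m p c'' f i L (a ++ b3) (k - i) L1 i e0 R nmp cd2 sd2 (ltnW im) (leqnn _) se0 ce0.
rewrite subnn add0n.
have F1 : fill1 (a ++ b3) e0 = b.
  rewrite fill1_cat ?size_nseq // -ca -cb3 fill1_true fill1_false [in RHS]Eb; congr (_ ++ nseq _ _).
  have : size b = (size a + q)%N by rewrite [in LHS]Eb size_cat size_nseq.
  have := count_negb a; have := count_size id a; move: Lc; rewrite /= sb Ea ca sb3 /=; lia.
have F2 : fill2 (a ++ b3) e0 = nseq (gam b) false ++ b3.
  by rewrite fill2_cat ?size_nseq // -ca -cb3 fill2_true fill2_false Ea.
rewrite F1 F2 => G; apply: Gv_ext (G _) => [v vv|i1 e im1 ii1 se ce ne].
  by rewrite {1}/Tz sch0 catA -nseqD.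
have ok1 := tail_fill1 im1 ii1 nmp cd2 sd2 se ce.
have ok2 := tail_fill2 im1 ii1 nmp cd2 sd2 se ce.
have lt : (L + gam b < i - i1 + L + gam (fill1 (a ++ b3) e))%N.
  have ne' : e != e0.
    apply: contra ne => /eqP Ee; rewrite Ee eqxx andbT; apply/eqP.
    by move: ce; rewrite Ee ce0; lia.
  have := gam_fill_lt ca cb3 _ _ ne'; rewrite se ce Ea.
  by move=> /(_ ltac:(lia) ltac:(lia)); lia.
have := H i1 _ ii1 ok1 lt => /=.
move=> /(_ (i - i1)%N L L1 (fill2 (a ++ b3) e)).
rewrite (_ : (k - i1 - (i - i1) = k - i)%N); last by lia.
by apply; [lia|lia|exact: leq_trans L1L0 L0L|].
Qed.

Lemma Nv_pattern_cons m c f k i L b L0 :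
  Rel (m :: c) f -> (i < m)%N -> (i <= k)%N -> tailok m c i L b -> (L0 <= L)%N ->
  (forall i1 b', (i1 <= i)%N -> tailok m c i1 (i - i1 + L) b' ->
     (L + gam b < i - i1 + L + gam b')%N ->
     Gv c (k - i1) (i - i1 + L) (Tz i1 (i - i1 + L) b' f)) ->
  Nv c (k - i) L0 (L + gam b) (Tz i L b f).
Proof. by case: c => // p c R im ik ok L0L; apply: Nv_pattern. Qed.

(* [bounded_vanish c] and [insert_vanish c] are proved together by induction on [c]; the two
   statements for [m :: c] follow from those for [c]. *)
Definition bounded_vanish c := forall f k L g, Rel c f -> (L <= g)%N ->
  (forall x, vcode c x -> inv x -> hasin g x -> f x = 0) ->
  Nv c k L g f -> Gv c k L f.

Definition insert_vanish c := forall l F k L L', (0 < l)%N -> Rel (l :: c) F -> (L <= L')%N ->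
  (L' <= sumn c)%N ->
  (forall b x, vcode (l :: c) (b :: x) -> inv (b :: x) -> true \notin drop (L' + l) b ->
     F (b :: x) = 0) ->
  (forall i L1 b, (i < l)%N -> (L1 + i <= L' + l)%N -> (i <= k + l)%N -> tailok l c i L1 b ->
     Gv c (k + l - i) L1 (Tz i L1 b F)) ->
  Gv c k L (Tz l L' (nseq (sumn c - L') false) F).

Lemma bounded_vanish_nil : bounded_vanish [::].
Proof. by move=> f k L g _ _ H _ /= _ _; apply: H. Qed.

Lemma insert_vanish_nil : insert_vanish [::].
Proof.
move=> l F k L L' l0 R LL L0 U _ /= _ _.
have -> : L' = 0%N by move: L0 => /=; lia.
rewrite /Tz schn0 /= cats0; apply: U => //=.
  by rewrite count_nseq size_nseq mul1n addn0 !eqxx.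
by rewrite drop_oversize // size_nseq leq_addl.
Qed.

Lemma mem_true b : (true \in b) = has id b.
Proof. by rewrite -has_pred1; apply: eq_has => -[]. Qed.

Lemma notin_nseq b : true \notin b -> b = nseq (size b) false.
Proof. by rewrite mem_true has_count_id -leqNgt leqn0 => /eqP; apply: count_id_none. Qed.

Lemma mem_take_cat n b1 b2 : (size b1 <= n)%N -> true \in b1 -> true \in take n (b1 ++ b2).
Proof.
move=> le h; rewrite take_cat; case: ltnP => [lt|_]; first by lia.
by rewrite mem_cat h.
Qed.

Lemma mem_take_leq n n' b : (n <= n')%N -> true \in take n b -> true \in take n' b.
Proof. by move=> le; rewrite -{1}(take_takel b le) => /mem_take. Qed.

Lemma TzB i L b f F x : Tz i L b (fun x => f x - F x) x = Tz i L b f x - Tz i L b F x.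
Proof. by rewrite /Tz /sch sumbD sumbN. Qed.

Lemma tail_gam m c i L b : tailok m c i L b -> (L + gam b <= sumn c)%N.
Proof.
case/and4P=> _ Lc /eqP cb /eqP sb; have := gam_le b; rewrite count_negb sb cb; lia.
Qed.

(** Descending induction on [L + gam b], the number of larger letters before the last copy of the
    smallest letter. *)
Lemma bounded_vanish_tails m c f k Lm g : (0 < m)%N -> bounded_vanish c -> Rel (m :: c) f -> (Lm <= g)%N ->
  (forall x, vcode (m :: c) x -> inv x -> hasin g x -> f x = 0) -> Nv (m :: c) k Lm g f ->
  forall n i L b L0, (sumn c - (L + gam b) < n)%N -> (i < m)%N -> (i <= k)%N ->
    (L + i <= Lm)%N -> (L0 <= L)%N -> tailok m c i L b -> Gv c (k - i) L0 (Tz i L b f).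
Proof.
move=> m0 SPc R Lmg U N; elim=> // n IH i L b L0 lt im ik LiL L0L ok.
case/and4P: (ok) => _ Lc /eqP cb /eqP sb.
have hb : has id b by rewrite has_count_id cb; lia.
have [|P] := boolP ((i == 0%N) && (true \notin take g (nseq L false ++ b))).
  (* No copy of the smallest letter is in the first [g] places: the case reserved for [Nv]. *)
  case/andP=> /eqP i0; subst i => nt.
  pose w := nseq L false ++ b.
  have sw : size w = (m + sumn c)%N by rewrite size_cat size_nseq sb; lia.
  have cw : count id w = m by rewrite count_cat count_nseq cb; lia.
  have tw := notin_nseq nt; rewrite size_take sw in tw.
  have gc : (g <= sumn c)%N.
    have : count id w = count id (drop g w).
      by rewrite -{1}(cat_take_drop g w) count_cat {1}/w tw count_nseq mul0n.
    rewrite cw => cdw; have := count_size id (drop g w); rewrite -cdw size_drop sw.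
    by move: m0; lia.
  have E : w = nseq g false ++ drop g w.
    by rewrite -{1}(cat_take_drop g w) {1}/w tw; case: ltnP => //; lia.
  have H1 : (L0 <= Lm)%N by lia.
  have H2 : count id (drop g w) = m.
    by rewrite -cw {2}E count_cat count_nseq mul0n.
  have H3 : size (drop g w) = (m + (sumn c - g))%N by rewrite size_drop sw; lia.
  rewrite subn0; apply: Gv_ext (N L0 (drop g w) H1 gc H2 H3) => x vx.
  by rewrite /Tz sch0 -E.
(* The bound [L + gam b] is chosen so that an inverting word of content [c] satisfying [hasin] for
   it stays inverting when the smallest letter is added. *)
apply: (SPc _ _ _ (L + gam b)%N (Rel_Tz R ok)); first by lia.
- move=> x vx ix hx; apply: sch_eq0 => b1 s1 c1 n1; apply: U.
  + exact: tail_vcode ok s1 c1 vx.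
  + by rewrite /= gam_cat // n1 hx.
  + rewrite /hasin; move: P; rewrite negb_and negbK.
    have [i0|i0 _] := posnP i.
      rewrite i0 in c1 s1; rewrite /= => P0.
      by rewrite (count_id_none c1) s1.
    by apply: mem_take_cat; [lia|rewrite mem_true has_count_id c1].
- case: c SPc R U N IH lt ok Lc sb => [|p c] SPc R U N IH lt ok Lc sb //.
  apply: (Nv_pattern R im ik ok L0L) => i1 b' i1i ok' lt'.
  have := tail_gam ok'; move=> g'; apply: (IH _ _ _ _ _ _ _ _ _ ok'); lia.
Qed.

(** As long as a copy of the smallest letter stays behind the prefix, its position can be used for
    induction. If all [m] copies are shuffled, the sum is of the kind treated by [insert_vanish]. *)
Lemma bounded_vanish_cons m c : (0 < m)%N -> bounded_vanish c -> insert_vanish c -> bounded_vanish (m :: c).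
Proof.
move=> m0 SPc RPc f k L g R Lg U N i L' L0 b ik LiL L0L ok.
have F := bounded_vanish_tails m0 SPc R Lg U N.
case/and4P: (ok) => im Lc /eqP cb /eqP sb.
have [im'|im'] := ltnP i m; first by apply: F ok => //; lia.
have Em : i = m by apply/eqP; rewrite eqn_leq im.
subst i; have -> : b = nseq (sumn c - L') false.
  by rewrite (@count_id_none b) ?cb ?subnn // sb; congr nseq; lia.
apply: RPc => //.
- move=> b' x vx ix nt; apply: U => //=.
  case/and3P: vx => /eqP cb' _ _.
  have : true \in b' by rewrite mem_true has_count_id cb'.
  rewrite -{1}(cat_take_drop (L' + m) b') mem_cat (negbTE nt) orbF.
  by apply: mem_take_leq; lia.
- move=> i L1 b' il Li ik' ok'; rewrite subnK in ik' *; last by [].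
  by apply: F ok' => //; lia.
Qed.

(** A pattern with at most [a] entries [false] before its last [true] ends with [K - a] entries
    [false], so what remains is a shuffle into the first [a] letters. *)
Lemma sch_trunc (F : bitseq -> V) l K a : (a <= K)%N ->
  (forall b, size b = (l + K)%N -> count id b = l -> (a < gam b)%N -> F b = 0) ->
  sch l K F = sch l a (fun b => F (b ++ nseq (K - a) false)).
Proof.
move=> aK H; rewrite /sch -{1}(subnKC aK) addnA sumb_cat big_ord_recr /= big1 ?add0r => [|[i /= il] _].
  by apply: eq_sumb => b _ _; rewrite subnn sumb_all0.
apply: sumb_eq0 => b1 s1 c1; apply: sumb_eq0 => b2 s2 c2; apply: H.
- by rewrite size_cat s1 s2; lia.
- by rewrite count_cat c1 c2; lia.
- rewrite gam_cat ?has_count_id ?c2; last by lia.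
  by rewrite count_negb s1 c1; lia.
Qed.

Section RStep.
Variables (m : nat) (c : seq nat) (l : nat) (F : seq bitseq -> V) (k L' : nat).
Hypotheses (m0 : (0 < m)%N) (l0 : (0 < l)%N) (SPc : bounded_vanish c).
Hypothesis R : Rel (l :: m :: c) F.
Hypothesis Lmc : (L' <= m + sumn c)%N.
Hypothesis U : forall b x, vcode (l :: m :: c) (b :: x) -> inv (b :: x) ->
  true \notin drop (L' + l) b -> F (b :: x) = 0.
Hypothesis Fx : forall i L1 b, (i < l)%N -> (L1 + i <= L' + l)%N -> (i <= k + l)%N ->
  tailok l (m :: c) i L1 b -> Gv (m :: c) (k + l - i) L1 (Tz i L1 b F).

(** The [l] copies of a new smallest letter are shuffled into the first [K] letters. Inverting words
    with all these copies in the first [L' + l] places vanish by [U]; sums in which some copy stands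
    behind the prefix are left to [Fx]. *)
Let TT K := Tz l K (nseq (m + sumn c - K) false) F.

Lemma insert_tailok K : (K <= m + sumn c)%N -> tailok l (m :: c) l K (nseq (m + sumn c - K) false).
Proof. by move=> le; rewrite /tailok /= le leqnn count_nseq size_nseq; lia. Qed.

Lemma Rel_insert K : (K <= m + sumn c)%N -> Rel (m :: c) (TT K).
Proof. by move=> le; apply: Rel_Tz R (insert_tailok le). Qed.

(** The [l] new letters and the [i] shuffled copies of the next letter share one prefix, so this is
    the term of a merged relation with [n = i + l] in which all new letters are in the prefix. In
    every other term one of them stands behind it, and [Fx] applies. *)
Lemma insert_vanish_noncrossing i L b L0 : (i <= m)%N -> (i <= k)%N -> (L + i <= L')%N -> (L0 <= L)%N ->
  tailok m c i L b -> Gv c (k - i) L0 (Tz i L b (TT (L + i))).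
Proof.
move=> im ik LiL L0L /and4P[_ Lc /eqP cb /eqP sb].
have nlm : (i + l <= l + m)%N by lia.
have cd : count id b = (l + m - (i + l))%N by rewrite cb; lia.
have sd : (L + count negb b)%N = sumn c by rewrite count_negb sb cb; lia.
have se0 : size (nseq (count id b) false) = (l + m - (i + l))%N by rewrite size_nseq.
have ce0 : count id (nseq (count id b) false) = (l - l)%N by rewrite count_nseq subnn.
have := @Gv_lead V l m c F (i + l) L b (k - i) L0 l _ R nlm cd sd (leqnn _) (leq_addl i l) se0 ce0.
rewrite addnK fill1_false fill2_false.
move=> H; apply: Gv_ext (H _) => [x vx|].
  by rewrite /TT [(i + L)%N]addnC (_ : (m + sumn c - (L + i))%N = size b) // sb; lia.
move=> i1 e i1l i1il se ce ne.
have i1l' : (i1 < l)%N.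
  rewrite ltn_neqAle i1l andbT; apply: contra ne => /eqP E; rewrite E eqxx /=.
  by rewrite E subnn in ce; rewrite (count_id_none ce) se -cd.
have ok1 := tail_fill1 i1l i1il nlm cd sd se ce.
have ok2 := tail_fill2 i1l i1il nlm cd sd se ce.
have := Fx i1l' _ _ ok1 => /=.
move=> /(_ ltac:(lia) ltac:(lia) (i + l - i1)%N L L0 (fill2 b e)).
rewrite (_ : (k + l - i1 - (i + l - i1) = k - i)%N); last by lia.
by apply => //; lia.
Qed.

(** If more than [a] letters stand before the last new letter, the next letter is among them, so the
    word is inverting and vanishes by [U]. *)
Lemma insert_trunc K a x : (a <= K)%N -> (K <= L')%N -> vcode (m :: c) x -> inv x ->
  ((a < K)%N -> hasin a.+1 x) -> TT K x = TT a x.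
Proof.
move=> aK KL vx ix hx.
rewrite /TT /Tz (sch_trunc aK) => [|b0 s0 c0 gb0].
  have -> : (m + sumn c - a = K - a + (m + sumn c - K))%N by lia.
  by apply: eq_sch => b _ _ _; rewrite -catA -nseqD.
have gK : (gam b0 <= K)%N by apply: leq_trans (gam_le _) _; rewrite count_negb s0 c0; lia.
have lt : (a < K)%N by lia.
apply: U.
- exact: tail_vcode (insert_tailok (leq_trans KL Lmc)) s0 c0 vx.
- rewrite /= gam_catF ix andbT; move: (hx lt); case: x {vx ix hx} => //= b x.
  by apply: mem_take_leq.
- rewrite drop_cat s0; case: ltnP => [|_]; first by lia.
  by rewrite drop_nseq mem_nseq andbF.
Qed.

(** The range of the new letters is cut from [K] down to an [a] for which
    [insert_vanish_noncrossing] applies. By [insert_trunc] the difference [D] of the two sums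
    vanishes on the inverting words concerned, and the statement for [c] takes over. *)
Lemma insert_vanish_tails n K i L b L0 : (sumn c - (L + gam b) < n)%N -> (K <= L')%N -> (i < m)%N ->
  (i <= k)%N -> (L + i <= K)%N -> (L0 <= L)%N -> tailok m c i L b ->
  Gv c (k - i) L0 (Tz i L b (TT K)).
Proof.
elim: n K i L b L0 => // n IH K i L b L0 lt KL im ik LiK L0L ok.
case/and4P: (ok) => _ Lc /eqP cb /eqP sb.
have hb : has id b by rewrite has_count_id cb; lia.
have [a [aL aK G0 Ga]] : exists a, [/\ (L + i <= a)%N, (a <= K)%N,
    Gv c (k - i) L0 (Tz i L b (TT a)) &
    (a < K)%N -> forall b1, size b1 = (i + L)%N -> count id b1 = i -> true \in take a.+1 (b1 ++ b)].
  have [i0|i0] := posnP i; last first.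
    exists (L + i)%N; split=> //; first by apply: insert_vanish_noncrossing => //; lia.
    by move=> _ b1 s1 c1; apply: mem_take_cat; [lia|rewrite mem_true has_count_id c1].
  (* With no shuffled copy the fixed prefix may be lengthened, up to the first copy in [b] but not
     beyond [K]. *)
  subst i; pose t := minn (K - L) (find id b).
  have tb : take t b = nseq t false.
    have st : size (take t b) = t.
      rewrite size_takel //; apply: leq_trans (geq_minr _ _) _; exact: find_size.
    rewrite -{2}st; apply: notin_nseq; rewrite mem_true.
    have := geq_minr (K - L) (find id b); rewrite -/t => tf.
    by rewrite has_take // -leqNgt.
  have Eb : b = nseq t false ++ drop t b by rewrite -tb cat_take_drop.
  have cd : count id (drop t b) = m by move: cb; rewrite {1}Eb count_cat count_nseq mul0n subn0.
  have sd : size b = (t + size (drop t b))%N by rewrite {1}Eb size_cat size_nseq.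
  have tK := geq_minl (K - L) (find id b).
  rewrite -/t in tK; exists (L + t)%N; rewrite addn0 in LiK *.
  have okd : tailok m c 0 (L + t) (drop t b).
    by rewrite /tailok; have := count_size id (drop t b); lia.
  have le1 : (L + t + 0 <= L')%N by lia.
  have le2 : (L0 <= L + t)%N by lia.
  split; [by lia|by lia| |].
  - have H := @insert_vanish_noncrossing 0 (L + t) (drop t b) L0 (leq0n _) (leq0n _) le1 le2 okd.
    rewrite addn0 in H; apply: Gv_ext H => x vx.
    by rewrite /Tz !sch0 {2}Eb catA -nseqD.
  - move=> ltK b1 s1 c1; rewrite (count_id_none c1) s1 add0n.
    have -> : t = find id b by rewrite /t; apply/minn_idPr; move: ltK; rewrite /t; lia.
    rewrite take_cat size_nseq; case: ltnP => [|_]; first by lia.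
    rewrite mem_cat; apply/orP; right.
    rewrite (_ : ((L + find id b).+1 - L = (find id b).+1)%N); last by lia.
    rewrite (take_nth false) -?has_find // mem_rcons inE.
    by rewrite [nth _ _ _](nth_find false hb).
have KM : (K <= m + sumn c)%N by apply: leq_trans KL Lmc.
have aM : (a <= m + sumn c)%N by apply: leq_trans aK KM.
pose D x := TT K x - TT a x.
have RD : Rel (m :: c) D by apply: RelB; apply: Rel_insert.
suff GD : Gv c (k - i) L0 (Tz i L b D).
  by apply: Gv_ext (GvD GD G0) => x vx; rewrite TzB subrK.
apply: (SPc (g := (L + gam b)%N) (Rel_Tz RD ok)); first by lia.
- move=> x vx ix hx; apply: sch_eq0 => b1 s1 c1 n1; rewrite /D.
  rewrite (@insert_trunc K a) ?subrr //.
  + exact: tail_vcode ok s1 c1 vx.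
  + by rewrite /= gam_cat // n1 hx.
  + by move=> ltK; apply: Ga.
- apply: (Nv_pattern_cons RD im ik ok L0L) => i1 b' i1i ok' lt'.
  have g' := tail_gam ok'.
  have GK : Gv c (k - i1) (i - i1 + L) (Tz i1 (i - i1 + L) b' (TT K)).
    by apply: IH => //; lia.
  have Ga' : Gv c (k - i1) (i - i1 + L) (Tz i1 (i - i1 + L) b' (TT a)).
    by apply: IH => //; lia.
  by apply: Gv_ext (GvB GK Ga') => x vx; rewrite TzB.
Qed.
End RStep.

Lemma insert_vanish_cons m c : (0 < m)%N -> bounded_vanish c -> insert_vanish c -> insert_vanish (m :: c).
Proof.
move=> m0 SPc RPc l F k L L' l0 R LL' Lmc U Fx i Lam L0 b ik Li L0L ok.
case/and4P: (ok) => im Lc /eqP cb /eqP sb.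
have [im'|im'] := ltnP i m.
  by apply: (insert_vanish_tails m0 l0 SPc R Lmc U Fx (n := (sumn c - (Lam + gam b)).+1)) => //; lia.
have Em : i = m by apply/eqP; rewrite eqn_leq im.
subst i; have Eb : b = nseq (sumn c - Lam) false.
  by rewrite (@count_id_none b) ?cb ?subnn // sb; congr nseq; lia.
pose TT K := Tz l K (nseq (m + sumn c - K) false) F.
have LM : (L <= m + sumn c)%N by apply: leq_trans LL' Lmc.
have RTT K : (K <= m + sumn c)%N -> Rel (m :: c) (TT K) by move=> KM; exact: (Rel_insert m0 l0 R Lmc).
pose D x := TT L' x - TT L x.
have RD : Rel (m :: c) D by apply: RelB; apply: RTT.
have NC : Gv c (k - m) L0 (Tz m Lam b (TT L)).
  by rewrite -Li; apply: (insert_vanish_noncrossing m0 l0 R Lmc Fx) => //; lia.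
suff GD : Gv c (k - m) L0 (Tz m Lam b D).
  by apply: Gv_ext (GvD GD NC) => x vx; rewrite TzB subrK.
rewrite Eb; apply: RPc => //.
- move=> b' x vx ix nt; apply/eqP; rewrite subr_eq0; apply/eqP.
  apply: (insert_trunc m0 l0 Lmc U) => // _; case/and3P: vx => /eqP cb' _ _.
  have : true \in b' by rewrite mem_true has_count_id cb'.
  rewrite -{1}(cat_take_drop (Lam + m) b') mem_cat (negbTE nt) orbF.
  by apply: mem_take_leq; lia.
- move=> i L1 b' im1 L1i ik1 ok1; rewrite subnK //.
  have GK : Gv c (k - i) L1 (Tz i L1 b' (TT L')).
    by apply: (insert_vanish_tails m0 l0 SPc R Lmc U Fx (ltnSn _)) => //; lia.
  have Ga : Gv c (k - i) L1 (Tz i L1 b' (TT L)).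
    by apply: (insert_vanish_tails m0 l0 SPc R Lmc U Fx (ltnSn _)) => //; lia.
  by apply: Gv_ext (GvB GK Ga) => x vx; rewrite TzB.
Qed.

Lemma bounded_insert_vanish c : all (leq 1) c -> bounded_vanish c /\ insert_vanish c.
Proof.
elim: c => [_|m c IH /= /andP[m0 /IH[SPc RPc]]]; first by split; [exact: bounded_vanish_nil|exact: insert_vanish_nil].
by split; [exact: bounded_vanish_cons|exact: insert_vanish_cons].
Qed.
End SR.

(** * Vanishing on all words from vanishing on the pure inverting words *)

Section Pure.
Variable V : zmodType.
Implicit Types (f F : seq bitseq -> V) (c : seq nat) (b d e : bitseq) (x v : seq bitseq).

(* All copies of the letter are at the end of the word; [pure_inv] says that the word is inverting
   and that the number of times that this happens for the letters 1, 2, ... in turn is even. *)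
Definition block_end b := b == nseq (count negb b) false ++ nseq (count id b) true.

Fixpoint pure_inv x : bool := if x is b :: x' then inv x && ~~ (block_end b && pure_inv x') else true.

Lemma pure_inv_inv x : pure_inv x -> inv x.
Proof. by case: x => //= b x /andP[]. Qed.

Lemma gam_last b : last false b -> gam b = count negb b.
Proof.
case/lastP: b => // b x; rewrite last_rcons => ->.
by rewrite -cats1 gam_cat //= count_cat.
Qed.

Lemma last_cat_nseq b (y : bool) j : (0 < j)%N -> last false (b ++ nseq j y) = y.
Proof. by case: j => // j _; rewrite -(addn1 j) nseqD catA last_cat. Qed.

Lemma fill1_nseq e : fill1 (nseq (size e) true) e = e.
Proof. by elim: e => //= y e ->. Qed.

Lemma fill2_nseq e : fill2 (nseq (size e) true) e = nseq (count negb e) true.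
Proof. by elim: e => //= -[] e ->. Qed.

Lemma mem_take_catT n b j : (size b < n)%N -> (0 < j)%N -> true \in take n (b ++ nseq j true).
Proof.
move=> lt; case: j => // j _; rewrite take_cat ltnNge (ltnW lt) /= mem_cat.
by rewrite -(subnSK lt) /= inE eqxx orbT.
Qed.

Lemma hasin_all c v g : all (leq 1) c -> vcode c v -> (sumn c <= g)%N -> hasin g v.
Proof.
case: c v => [|m c] [|b v] //= /andP[m0 _] /and3P[/eqP cb /eqP sb _] le.
by rewrite take_oversize ?sb // mem_true has_count_id cb.
Qed.

(** Since the smallest letter occurs, the bound [g = sumn c] exceeds the number of larger letters,
    and [Nv] holds vacuously. *)
Lemma inverting_eq0 c f : all (leq 1) c -> Rel c f ->
  (forall x, vcode c x -> inv x -> f x = 0) -> forall x, vcode c x -> f x = 0.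
Proof.
move=> c0 R H; apply: Gv_word.
have [SPc _] := bounded_insert_vanish V c0; apply: (SPc f 0 0 (sumn c))%N => //; first by move=> x vx ix _; apply: H.
by case: c c0 {R H SPc} => //= m c /andP[m0 _] L0 b _ le; lia.
Qed.

Section Step.
Variables (m q : nat) (c : seq nat) (f : seq bitseq -> V).
Hypotheses (m0 : (0 < m)%N) (q0 : (0 < q)%N) (c0 : all (leq 1) c).
Hypothesis R : Rel (m :: q :: c) f.
Hypothesis X : forall u, vcode (q :: c) u -> sch m (q + sumn c) (fun b => f (b :: u)) = 0.
Hypothesis P0 : forall x, vcode (m :: q :: c) x -> pure_inv x -> f x = 0.

Let N := (q + sumn c)%N.
(** The only pattern of the letters 1 for which an inverting word can fail to be pure. *)
Let E := nseq N false ++ nseq m true.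
Let g z := f (E :: z).
(** Directly before the final block of letters 1 stand [j] letters 2; the other [q - j] are spread
    freely. The aim is independence of [j]: purity controls [U q], the relations control [U 0]. *)
Let U j v := sch (q - j) (sumn c) (fun b => g ((b ++ nseq j true) :: v)).

Lemma count_E : count id E = m.
Proof. by rewrite count_cat !count_nseq mul0n mul1n. Qed.

Lemma size_E : size E = (m + N)%N.
Proof. by rewrite size_cat !size_nseq addnC. Qed.

Lemma last_E : last false E.
Proof. exact: last_cat_nseq. Qed.

Lemma gam_E : gam E = N.
Proof. by rewrite gam_last ?last_E // count_negb count_E size_E addKn. Qed.

Lemma not_block_eq0 b z : count id b = m -> size b = (m + N)%N -> vcode (q :: c) z -> b != E ->
  hasin (gam b) z -> inv z -> f (b :: z) = 0.
Proof.
move=> cb sb vz bE hz iz; apply: P0; first by move: vz; rewrite /= cb sb !eqxx.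
by rewrite /= hz iz /block_end count_negb cb sb addKn (negbTE bE).
Qed.

(** With all larger letters before the last letter 1, the inverting condition for the letter 1 is
    automatic, so [inverting_eq0] can be applied to the remaining letters. *)
Lemma gam_full_eq0 b z : count id b = m -> size b = (m + N)%N -> (N <= gam b)%N -> b != E ->
  vcode (q :: c) z -> f (b :: z) = 0.
Proof.
move=> cb sb lb bE vz; apply: (inverting_eq0 (f := fun z => f (b :: z)) _ _ _ vz); first by rewrite /= q0.
  by case: R => _; apply.
move=> u vu iu; apply: not_block_eq0 => //; apply: (hasin_all (c := q :: c)) => //; first by rewrite /= q0.
Qed.

Lemma last_true_eq0 b z : count id b = m -> size b = (m + N)%N -> last false b -> b != E ->
  vcode (q :: c) z -> f (b :: z) = 0.
Proof. by move=> cb sb lb; apply: gam_full_eq0 => //; rewrite gam_last // count_negb cb sb addKn. Qed.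

(** Words that end in a letter 1 vanish unless the letters 1 form the pattern [E], so at most one
    shuffle survives. *)
Lemma Tz_tail_true i L b u : tailok m (q :: c) i L b -> last false b -> vcode (q :: c) u ->
  Tz i L b f u = if b == drop (i + L) E then g u else 0.
Proof.
move=> ok lb vu; case/and4P: (ok) => im Lc /eqP cb /eqP sb.
have b0 : b != [::] by apply: contraTneq lb => ->.
have Z b1 : size b1 = (i + L)%N -> count id b1 = i -> b1 ++ b != E -> f ((b1 ++ b) :: u) = 0.
  move=> s1 c1 ne; apply: last_true_eq0 => //.
  - by rewrite count_cat c1 cb; lia.
  - by rewrite size_cat s1 sb /N; move: Lc => /=; lia.
  - by rewrite last_cat; case: b lb b0 {ok cb sb ne}.
case: eqP => [Eb|nb]; last first.
  apply: sch_eq0 => b1 s1 c1 _; apply: Z => //; apply/eqP => EE; apply: nb.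
  by rewrite -EE drop_cat s1 ltnn subnn drop0.
pose a := take (i + L) E.
have aE : a ++ b = E by rewrite Eb cat_take_drop.
have ca : count id a = i by have := count_E; rewrite -aE count_cat cb; lia.
have sa : size a = (i + L)%N.
  by have := size_E; rewrite -aE size_cat sb /N; move: Lc => /=; lia.
rewrite /Tz /sch -sa -[X in sumb _ X]ca sumb_one aE sumb_eq0 ?addr0 // => b1 s1 c1.
case: eqP => // ne; apply: Z; rewrite ?s1 ?c1 //; apply/eqP => EE; apply: ne.
by have /eqP := EE; rewrite -aE eqseq_cat ?s1 // => /andP[/eqP].
Qed.

Lemma Rel_g : Rel (q :: c) g.
Proof. by case: R => _; apply; rewrite ?count_E ?size_E. Qed.

Lemma tail_U j : (j <= q)%N -> tailok q c (q - j) (sumn c) (nseq j true).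
Proof. by move=> jq; rewrite /tailok leq_subr leqnn count_nseq size_nseq; lia. Qed.

Lemma vcode_U j b v : (j <= q)%N -> size b = (q - j + sumn c)%N -> count id b = (q - j)%N ->
  vcode c v -> vcode (q :: c) ((b ++ nseq j true) :: v).
Proof. by move=> jq; apply: tail_vcode (tail_U jq). Qed.

Lemma Rel_U j : (j <= q)%N -> Rel c (U j).
Proof. by move=> jq; apply: Rel_Tz Rel_g (tail_U jq). Qed.

(* Apply the hypothesis [X] to the words counted by [U j v]; the terms with [b != E] that do not
   vanish are rewritten by redistributing the letters 1 and 2, which leaves [U (j - m) v]. *)
Lemma U_step_inv j v : (0 < j)%N -> (j <= q)%N -> vcode c v -> inv v -> U j v = U (j - m) v.
Proof.
move=> j0 jq vv iv.
have n1 : (q - j + m <= m + q)%N by lia.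
have n2 : count id (nseq j true) = (m + q - (q - j + m))%N by rewrite count_nseq; lia.
have n3 : (sumn c + count negb (nseq j true))%N = sumn c by rewrite count_nseq; lia.
pose W := sch (q - j) (sumn c) (fun b2 => sch m (q - j + sumn c)
   (fun b => f ((b ++ nseq j false) :: (b2 ++ nseq j true) :: v))).
(* If the last letter 1 is behind one of the final [j] letters 2, the word is inverting, and it
   vanishes unless its pattern is [E]. Besides [U j v] only the shuffles of the letters 1 in front
   of these letters 2 remain, and they form [W]. *)
have E1 : U j v + W = 0.
  rewrite -schD; apply: sch_eq0 => b2 s2 c2 _.
  have vu := vcode_U jq s2 c2 vv; rewrite -[RHS](X vu).
  set u := _ :: v in vu *.
  have iu : inv u.
    rewrite /= iv andbT; apply: hasin_all c0 vv _.
    rewrite gam_last ?last_cat_nseq //.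
    by rewrite count_cat [count negb b2]count_negb s2 c2; lia.
  have := @sumb_one V E (fun b => f (b :: u)); rewrite count_E size_E -/(sch _ _ _) => ->.
  congr (_ + _); rewrite -/(sch m N _) (sch_trunc (K := N) (a := (q - j + sumn c)%N)); last 2 first.
  - by rewrite /N; lia.
  - move=> b sb cb gb; case: ifP => // /negbT bE; apply: not_block_eq0 => //.
    by rewrite /= mem_take_catT // s2.
  rewrite (_ : (N - (q - j + sumn c))%N = j); last by rewrite /N; lia.
  apply: eq_sch => b sb cb _; case: ifP => // /eqP bE.
  by have := last_E; rewrite -bE last_cat_nseq.
(* In the merged relation with [j] places behind the prefix, the term with all letters 1 in the
   prefix is [W]; of the other terms only the tail [e0] contributes. *)
have E2 : W + U (j - m) v = 0.
  rewrite -[RHS](merged_sum R n1 n2 n3 vv).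
  have mqn : (m + q - (q - j + m) = j)%N by lia.
  rewrite big_ord_recr /= leq_addl mqn subnn sumb_all0 addnK [LHS]addrC; congr (_ + _); last first.
    rewrite (_ : fill1 _ _ = nseq j false); last by rewrite -{1}(size_nseq j false) fill1_nseq.
    rewrite (_ : fill2 _ _ = nseq j true) //.
    by rewrite -{1}(size_nseq j false) fill2_nseq count_nseq mul1n.
  (* The prefix has [N - j + m] letters, so this is the part of [E] behind it. *)
  pose e0 := drop (N - j + m) E.
  have e0E : e0 = nseq (j - m) false ++ nseq (minn m j) true.
    rewrite /e0 /E drop_cat size_nseq; case: ltnP => lt.
      by rewrite drop_nseq; congr (nseq _ _ ++ nseq _ _); move: lt; rewrite /N; lia.
    rewrite (_ : (j - m = 0)%N) /=; last by move: lt; rewrite /N; lia.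
    by rewrite drop_nseq; congr nseq; move: lt; rewrite /N; lia.
  have se0 : size e0 = j by rewrite e0E size_cat !size_nseq; lia.
  have ce0 : count id e0 = minn m j by rewrite e0E count_cat !count_nseq mul0n mul1n.
  have le0 : last false e0 by rewrite e0E last_cat_nseq //; lia.
  transitivity (\sum_(i < m) (if (i <= q - j + m)%N then
     sumb j (m - i) (fun e => if e == e0 then U (j - m) v else 0) else 0)).
    (* The number of letters 1 of [E] inside the prefix; the truncated difference is 0 when
       [m <= j]. *)
    have i0m : (m - j < m)%N by lia.
    rewrite (bigD1 (Ordinal i0m)) //= big1 ?addr0.
      rewrite (_ : (_ <= _)%N); last by lia.
      rewrite (_ : (m - (m - j))%N = minn m j); last by lia.
      have := @sumb_one V e0 (fun e => if e == e0 then U (j - m) v else 0).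
      by rewrite se0 ce0 => ->; rewrite eqxx sumb_eq0 ?addr0 // => b _ _; case: eqP.
    move=> i ne; case: ifP => // _; apply: sumb_eq0 => e se ce; case: eqP => // Ee.
    case/eqP: ne; apply: val_inj => /=; move: ce; rewrite Ee ce0; have := ltn_ord i; lia.
  apply: eq_bigr => i _; case: ifP => // ile; apply: eq_sumb => e se ce.
  have im := ltn_ord i.
  have -> : nseq j true = nseq (size e) true by rewrite se.
  rewrite fill1_nseq fill2_nseq.
  have ne : count negb e = (j - (m - i))%N by rewrite count_negb se ce.
  have jmi : (m - i <= j)%N by rewrite -ce -se count_size.
  have ok1 : tailok m (q :: c) i (q - j + m - i + sumn c) e.
    by rewrite /tailok /= ce se /=; move: im ile jmi; lia.
  have ok2 : tailok q c (q - j + m - i) (sumn c) (nseq (count negb e) true).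
    by rewrite /tailok leqnn count_nseq size_nseq ne; move: im ile jmi; lia.
  have [le|le] := boolP (last false e).
    transitivity (Tz (q - j + m - i) (sumn c) (nseq (count negb e) true)
       (fun u => if e == e0 then g u else 0) v); last first.
      apply: (eq_Tz (m := q) (c := c)) ok2 vv => u vu; rewrite (Tz_tail_true ok1) //.
      by congr (if e == drop _ _ then _ else _); rewrite /N; move: im ile jmi; lia.
    rewrite /Tz; case: eqP => Ee; last by rewrite sch_eq0.
    have ci : (m - i = minn m j)%N by rewrite -ce Ee ce0.
    rewrite /U ne (_ : (j - (m - i) = j - m)%N); last by lia.
    by rewrite (_ : (q - j + m - i = q - (j - m))%N) //; lia.
  rewrite [e == e0](negbTE _); last by apply: contra le => /eqP->.
  apply/esym; apply: sch_eq0 => b2 s2 c2 _; apply: sch_eq0 => b1 s1 c1 d1.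
  have vu := tail_vcode ok2 s2 c2 vv.
  case/and4P: ok1 => _ _ _ /eqP se1; apply: not_block_eq0 => //.
  - by rewrite count_cat c1 ce; lia.
  - by rewrite size_cat s1 se1 /= /N; lia.
  - have e0' : e != [::] by rewrite -size_eq0 se; lia.
    by apply: contra le => /eqP Eb; have := last_E; rewrite -Eb last_cat; case: (e) e0'.
  - rewrite /= mem_take_cat ?mem_true ?has_count_id ?c2 //; last by lia.
    by rewrite s2 gam_cat ?has_count_id ?ce; lia.
  rewrite /= iv andbT; apply: hasin_all c0 vv _.
  rewrite gam_last; last first.
    apply: last_cat_nseq; rewrite count_negb se ce.
    rewrite subn_gt0 ltn_neqAle -{1}ce -{1}se jmi andbT.
    apply: contra le => /eqP/count_id_full ->; rewrite se; exact: (@last_cat_nseq [::]).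
  by rewrite count_cat [count negb b2]count_negb s2 c2; lia.
by apply: (addIr W); rewrite E1 addrC E2.
Qed.

Lemma U_step j v : (0 < j)%N -> (j <= q)%N -> vcode c v -> U j v = U (j - m) v.
Proof.
move=> j0 jq vv; apply/eqP; rewrite -subr_eq0; apply/eqP.
apply: (inverting_eq0 (f := fun v => U j v - U (j - m) v) c0 _ _ vv).
  by apply: RelB; apply: Rel_U; lia.
by move=> u vu iu; apply/eqP; rewrite subr_eq0; apply/eqP; apply: U_step_inv.
Qed.

Lemma U_const j v : (j <= q)%N -> vcode c v -> U j v = U 0 v.
Proof.
elim/ltn_ind: j => j IH jq vv; case: (posnP j) => [->//|j0].
by rewrite U_step // IH //; lia.
Qed.

(** For [j = 0] the letters 2 are spread freely; summing over the positions of the next letter as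
    well gives a sum of redistribution relations for these two letters. It provides the hypothesis
    on shuffles in the induction. *)
Lemma U0_shuffle p c' v : c = p :: c' -> vcode c' v ->
  sch p (sumn c') (fun b => U 0 (b :: v)) = 0.
Proof.
move=> Ec vv; rewrite /U Ec subn0 /=.
have := Rel_g; rewrite Ec => -[Rg _].
transitivity (sch (q + p) (sumn c') (fun d => sch q p (fun e => g (fill1 d e :: fill2 d e :: v)))).
  rewrite (sch_fill q p (sumn c') (fun b1 b2 => g (b1 :: b2 :: v))).
  by apply: eq_sch => b2 _ _ _; apply: eq_sch => b1 _ _ _; rewrite cats0.
by apply: sch_eq0 => d sd cd nd; apply: Rg; rewrite ?sd.
Qed.

(** Adding two final blocks, of letters 2 and of letters 1, does not change the parity that defines
    purity. *)
Lemma U_pure_eq0 v : vcode c v -> pure_inv v -> U q v = 0.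
Proof.
move=> vv Pv; rewrite /U subnn sch0; set b := _ ++ _.
have cb : count id b = q by rewrite count_cat !count_nseq mul0n mul1n.
have sb : size b = (q + sumn c)%N by rewrite size_cat !size_nseq addnC.
have vz : vcode (q :: c) (b :: v) by rewrite /= cb sb !eqxx.
have gb : gam b = sumn c by rewrite gam_last ?last_cat_nseq // count_negb sb cb addKn.
have iz : inv (b :: v) by rewrite /= gb (hasin_all c0 vv) // pure_inv_inv.
apply: P0; first by move: vz; rewrite /= count_E size_E !eqxx.
have PF : pure_inv (b :: v) = false.
  have -> : pure_inv (b :: v) = inv (b :: v) && ~~ (block_end b && pure_inv v) by [].
  by rewrite Pv /block_end count_negb sb cb addKn eqxx andbF.
have -> : pure_inv (E :: b :: v) = inv (E :: b :: v) && ~~ (block_end E && pure_inv (b :: v)) by [].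
rewrite PF andbF andbT -[inv _]/(hasin (gam E) (b :: v) && inv (b :: v)) iz andbT gam_E.
by apply: (hasin_all (c := q :: c)); rewrite //= q0.
Qed.

Hypothesis U0 : forall v, vcode c v -> U 0 v = 0.

(** For [L = N] the prefix is the whole word, so all letters 2 are shuffled and the values of [U 0]
    appear. *)
Lemma Gv_g_N k : Gv (q :: c) k N g.
Proof.
move=> i L L0 b ik Li L0L ok; case/and4P: (ok) => iq Lc /eqP cb /eqP sb.
apply: Gv_ext (Gv0 V c (k - i) L0) => v vv; rewrite -(U0 vv).
have ei : i = q by move: Li iq Lc; rewrite /N; lia.
have eL : L = sumn c by move: Li; rewrite /N; lia.
have -> : b = [::] by apply/eqP; rewrite -size_eq0 sb; lia.
by rewrite ei eL /U subn0.
Qed.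

Lemma count_drop_E j : count id (drop j E) = minn m (m + N - j).
Proof.
rewrite drop_cat size_nseq; case: ltnP => lt.
  by rewrite drop_nseq count_cat !count_nseq mul0n mul1n; lia.
by rewrite drop_nseq count_nseq mul1n; lia.
Qed.

(** A tail that ends in a letter 1 reduces the sum to [g]. Otherwise no shuffle gives [E], and the
    descending induction of [bounded_vanish_tails] works with pure words as well. *)
Lemma Gv_insert k n i L b : (forall L, (L < N)%N -> Gv (q :: c) (k + m) L g) ->
  (N - (L + gam b) < n)%N -> (i < m)%N -> (i <= k + m)%N -> tailok m (q :: c) i L b ->
  Gv (q :: c) (k + m - i) L (Tz i L b f).
Proof.
move=> IHk; elim: n i L b => // n IH i L b lt im ik ok.
case/and4P: (ok) => _ Lc /eqP cb /eqP sb.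
have [lb|lb] := boolP (last false b).
  have H : Gv (q :: c) (k + m - i) L (fun u => if b == drop (i + L) E then g u else 0).
    case: eqP => Eb; last exact: Gv0.
    have [LN|LN] := ltnP L N.
      have -> : i = 0%N by have := count_drop_E (i + L); rewrite -Eb cb; lia.
      by rewrite subn0; apply: IHk.
    have -> : L = N by apply/eqP; rewrite eqn_leq LN andbT.
    exact: Gv_g_N.
  by apply: Gv_ext H => u vu; rewrite (Tz_tail_true ok).
have qc : all (leq 1) (q :: c) by rewrite /= q0.
have [SPq _] := bounded_insert_vanish V qc.
apply: (SPq _ _ _ (L + gam b)%N (Rel_Tz R ok)); first by lia.
- move=> x vx ix hx; apply: sch_eq0 => b1 s1 c1 n1; apply: not_block_eq0 => //.
  + by rewrite count_cat c1 cb; lia.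
  + by rewrite size_cat s1 sb /N; move: Lc => /=; lia.
  + have b0 : b != [::] by rewrite -size_eq0 sb; lia.
    by apply: contra lb => /eqP EE; have := last_E; rewrite -EE last_cat; case: (b) b0.
  + by rewrite gam_cat ?n1 // has_count_id cb; lia.
- apply: (Nv_pattern_cons R im ik ok (leqnn _)) => i1 b' i1i ok' lt'.
  by have := tail_gam ok'; move=> g'; apply: IH ok' => //; rewrite /N; move: g' => /=; lia.
Qed.

(** By [X], the value at [E] is minus the sum over the other patterns. Those ending in a letter 1
    vanish, so the letters 1 are shuffled into all larger letters but the last. *)
Lemma g_truncE z : vcode (q :: c) z -> g z = - Tz m N.-1 [:: false] f z.
Proof.
move=> vz; apply/eqP; rewrite -addr_eq0; apply/eqP; rewrite -[RHS](X vz).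
have := @sumb_one V E (fun b => f (b :: z)); rewrite count_E size_E -/(sch _ _ _) => ->.
have N0 : (0 < N)%N by rewrite /N; lia.
congr (_ + _); rewrite -/(sch m N _) (sch_trunc (K := N) (a := N.-1)); last 2 first.
- by lia.
- move=> b sb cb gb; case: ifP => // /negbT bE; apply: gam_full_eq0 => //; lia.
rewrite (_ : (N - N.-1)%N = 1%N); last by lia.
apply: eq_sch => b sb cb _; case: ifP => // /eqP bE.
by have := last_E; rewrite -bE (@last_cat_nseq _ false 1).
Qed.

(** Descending induction on [k]: by [g_truncE] the sums of [g] are insertions of [m] letters 1,
    which [insert_vanish] reduces to sums with [k + m] shuffled copies; for [L < k] there are no
    sums. *)
Lemma Gv_g n k L : (N - k < n)%N -> (0 < k)%N -> (L < N)%N -> Gv (q :: c) k L g.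
Proof.
elim: n k L => // n IH k L lt k0 LN.
have [Lk|kL] := ltnP L k; first exact: Gv_big.
have qc : all (leq 1) (q :: c) by rewrite /= q0.
have [_ RPq] := bounded_insert_vanish V qc.
have N0 : (0 < N)%N by lia.
have G : Gv (q :: c) k L (Tz m N.-1 (nseq (sumn (q :: c) - N.-1) false) f).
  apply: RPq => //; rewrite -?/N; try by rewrite /=; lia.
  - move=> b x vbx ibx nt; case/and3P: vbx => /eqP cb /eqP sb vx.
    case/andP: ibx => hx ix; apply: not_block_eq0 => //.
    apply: contra nt => /eqP->; rewrite drop_cat size_nseq ifF; last by lia.
    rewrite drop_nseq mem_nseq eqxx andbT; lia.
  - move=> i L1 b im L1i ik ok; apply: (Gv_insert (n := (N - (L1 + gam b)).+1)) ok => // L2 L2N.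
    by apply: IH => //; lia.
apply: Gv_ext (GvN G) => z vz.
rewrite g_truncE // (_ : (sumn (q :: c) - N.-1)%N = 1%N) //; rewrite -/N /=; lia.
Qed.

Lemma f_eq0 : (0 < sumn c)%N -> forall x, vcode (m :: q :: c) x -> f x = 0.
Proof.
move=> c1; apply: inverting_eq0 => //; first by rewrite /= m0 q0.
move=> [|b z] // /and3P[/eqP cb /eqP sb vz] /andP[hz iz].
have [->|bE] := eqVneq b E; last exact: not_block_eq0.
(* Here [L = 1] is below [N] because [q] and [sumn c] are both positive. *)
apply: (Gv_word1 _ (Gv_g (ltnSn _) _ _) vz) => //=; rewrite /N; lia.
Qed.
End Step.

(** Induction that removes two letters at a time: [U q], which equals [U 0], satisfies the
    hypotheses for the remaining letters. *)
Lemma pure_inverting_eq0 c f : all (leq 1) c -> Rel c f ->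
  (if c is m :: c' then forall u, vcode c' u -> sch m (sumn c') (fun b => f (b :: u)) = 0 else True) ->
  (forall x, vcode c x -> pure_inv x -> f x = 0) -> forall x, vcode c x -> f x = 0.
Proof.
have [n] := ubnP (size c); elim: n c f => // n IH [|m [|q c]] f /= lt c0 R X P0.
- by case=> // _; apply: P0.
(* With one letter there is a single word, and it is the only term of the sum in [X]. *)
- case=> [|b [|? ?]] //=; last by rewrite !andbF.
  case/and3P=> /eqP cb /eqP sb _.
  rewrite -(X [::]) // schn0 (count_id_full (e := b)) ?size_nseq ?cb ?sb ?addn0 //.
case/and3P: c0 => m0 q0 c0.
have Uc := U_const m0 q0 c0 R X P0.
have U0 : forall v, vcode c v -> sch (q - 0) (sumn c) (fun b =>
  f ((nseq (q + sumn c) false ++ nseq m true) :: (b ++ nseq 0 true) :: v)) = 0.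
  move=> v vv; rewrite -(Uc q v) //; move: v vv; apply: IH => //; first by lia.
  - exact: (Rel_U m0 q0 c0 R (leqnn q)).
  - case Ec: c => [//|p c'] u vu.
    rewrite -[RHS](U0_shuffle R Ec vu); apply: eq_sch => b sb cb _.
    have := Uc q (b :: u) (leqnn q).
    by rewrite Ec /= cb sb vu !eqxx => /(_ isT).
  - by move=> v vv Pv; apply: (U_pure_eq0 m0 q0 c0 P0 vv Pv).
(* With exactly two letters, the word in which both form final blocks is pure, which settles the
   pattern [E]. *)
have [c1|c1] := posnP (sumn c); last exact: (f_eq0 m0 q0 c0 R X P0 U0 c1).
case: c c0 c1 {lt IH Uc U0} R X P0 => [|p c]; last by move=> /= /andP[p0 _]; lia.
move=> _ _ R X P0; refine (inverting_eq0 (c := [:: m; q]) (f := f) _ R _); first by rewrite /= m0 q0.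
move=> [|b z] // vbz /andP[hz iz]; case/and3P: (vbz) => /eqP cb /eqP sb vz.
have [bE|bE] := eqVneq b (nseq (q + 0) false ++ nseq m true); last first.
  refine (not_block_eq0 (c := [::]) P0 cb sb vz bE hz iz).
have := U_pure_eq0 (c := [::]) m0 q0 isT P0 (v := [::]) isT isT.
rewrite subnn sch0 /= bE; case: z vz {hz iz vbz} => [|b' [|? ?]] //=; last by rewrite !andbF.
case/and3P=> /eqP cb' /eqP sb' _.
by rewrite (count_id_full (e := b')) ?sb' ?cb' ?addn0.
Qed.
End Pure.

(** * Compositions and their products with elementary symmetric polynomials *)

Section Words.

Fixpoint weave (b : bitseq) (w : seq nat) : seq nat :=
  match b, w with
  | true :: b', _ => 1%N :: weave b' w
  | false :: b', v :: w' => v :: weave b' w'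
  | _, _ => [::]
  end.

Fixpoint word (x : seq bitseq) : seq nat :=
  if x is b :: x' then weave b (map S (word x')) else [::].

(* Letters above [t] are increased by 1, and so are the letters [t] at the places where [e] is
   [false]. *)
Fixpoint fillw t (w : seq nat) (e : bitseq) : seq nat :=
  if w is v :: w' then
    if (v < t)%N then v :: fillw t w' e
    else if (t < v)%N then v.+1 :: fillw t w' e
    else if e is y :: e' then (if y then t else t.+1) :: fillw t w' e' else [::]
  else [::].

Lemma size_weave b w : count negb b = size w -> size (weave b w) = size b.
Proof. by elim: b w => [|[] b IH] [|v w] //= H; rewrite IH //=; lia. Qed.

Lemma count_weave j b w : count negb b = size w ->
  count_mem j (weave b w) = ((j == 1) * count id b + count_mem j w)%N.
Proof.
elim: b w => [|[] b IH] [|v w] //= H; rewrite ?muln0 ?IH //=; lia.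
Qed.

Lemma count_mapS j w : count_mem j.+1 (map S w) = count_mem j w.
Proof. by rewrite count_map; apply: eq_count => v. Qed.

Lemma count0_mapS w : count_mem 0%N (map S w) = 0%N.
Proof. by rewrite count_map; elim: w. Qed.

(* Copies of the letter 1 are followed by those of 2, etc. *)
Definition content (c w : seq nat) : Prop := forall j, count_mem j w = nth 0%N (0%N :: c) j.

Lemma content_weave m c b w : count id b = m -> count negb b = size w -> content c w ->
  content (m :: c) (weave b (map S w)).
Proof.
move=> cb nb cw [|j]; rewrite count_weave ?size_map //.
  by rewrite count0_mapS.
rewrite count_mapS cw; case: j => [|j]; rewrite /= ?mul1n ?cb ?addn0 //.
Qed.

Lemma size_word c x : vcode c x -> size (word x) = sumn c.
Proof.
elim: c x => [|m c IH] [|b x] //= /and3P[/eqP cb /eqP sb vx].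
by rewrite size_weave ?sb // size_map (IH _ vx) count_negb sb cb addKn.
Qed.

Lemma content_word c x : vcode c x -> content c (word x).
Proof.
elim: c x => [|m c IH] [|b x] //=; first by move=> _ [|[|j]].
case/and3P=> /eqP cb /eqP sb vx; apply: content_weave => //; last exact: IH.
by rewrite (size_word vx) count_negb sb cb addKn.
Qed.

Lemma weave_decode w : 0%N \notin w ->
  w = weave (map (pred1 1%N) w) (map S (map predn (filter (predC (pred1 1%N)) w))).
Proof.
elim: w => //= v w IH; rewrite inE negb_or => /andP[v0 /IH {1}->].
by case: eqP => [->|] //=; case: v v0.
Qed.

Lemma content_code c w : content c w -> exists2 x, vcode c x & word x = w.
Proof.
elim: c w => [|m c IH] w cw.
  exists [::] => //; case: w cw => // v w /(_ v) /=; rewrite eqxx; by case: v => [|[]].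
have w0 : 0%N \notin w by rewrite -has_pred1 has_count (cw 0%N).
set b := map (pred1 1%N) w; set u := map predn (filter (predC (pred1 1%N)) w).
have wE : w = weave b (map S u) by exact: weave_decode.
have nb : count negb b = size u by rewrite !size_map size_filter count_map.
have cb : count id b = m by rewrite count_map -[m]/(nth 0%N (0%N :: m :: c) 1) -cw.
have cu : content c u.
  move=> [|j]; last first.
    by rewrite -[RHS]/(nth 0%N (0%N :: m :: c) j.+2) -cw wE count_weave ?count_mapS // [RHS]size_map.
  rewrite /= count_map; apply/eqP; rewrite eqn0Ngt -has_count -all_predC.
  by apply/allP => v; rewrite mem_filter /=; case: v w0 => [/negP|[|v]].
have [x vx xu] := IH _ cu; exists (b :: x); last by rewrite /= xu -wE.
rewrite /= cb eqxx vx andbT /= -cb -(size_word vx) xu -nb.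
by rewrite -(count_predC id b).
Qed.

(** The letters 1 on the left are the letters 1 and 2 of the result merged together, and [e]
    separates them again. *)
Lemma fillw_weave1 d e w : count id d = size e -> count negb d = size w -> 0%N \notin w ->
  fillw 1 (weave d (map S w)) e = weave (fill1 d e) (map S (weave (fill2 d e) (map S w))).
Proof.
elim: d e w => [|[] d IH] e w /=; first by case: e.
  by case: e => [|[] e] //= [/IH {}IH] /IH {}IH /IH ->.
case: w => [|[|v] w] //= cd [nd]; rewrite inE /= => w0.
by rewrite (IH e) //; case: e {cd}.
Qed.

Lemma fillw_weave t b w e : (0 < t)%N -> count negb b = size w ->
  count_mem t w = size e ->
  fillw t.+1 (weave b (map S w)) e = weave b (map S (fillw t w e)).
Proof.
move=> t0; elim: b w e => [|[] b IH] w e //=.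
  by move=> nb ce; rewrite ltnS t0 IH.
case: w => [|v w] //= [nb]; rewrite !ltnS.
case: ltngtP => vt; rewrite ?add0n => ce.
- by rewrite IH.
- by rewrite IH.
- by case: e ce => // y e [ce]; rewrite IH //; case: y.
Qed.

End Words.

(** * The terms of [e_k M_w] with the largest sum of squares *)

Section Increments.

(* The compositions obtained from [w] by inserting zeros and then adding 1 to [k] entries,
   including all the zeros; they index the terms of [e_k M_w]. *)
Fixpoint incs (k : nat) (w : seq nat) : seq (seq nat) :=
  if w is v :: w' then
    (fix F k := if k is k'.+1 then
       map (cons 1%N) (F k') ++ map (cons v.+1) (incs k' w') ++ map (cons v) (incs k w')
     else map (cons v) (incs 0 w')) k
  else [:: nseq k 1%N].

Lemma incsS k v w : incs k.+1 (v :: w) =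
  map (cons 1%N) (incs k (v :: w)) ++ map (cons v.+1) (incs k w) ++ map (cons v) (incs k.+1 w).
Proof. by []. Qed.

Definition sumsq (w : seq nat) := sumn (map (fun v => v ^ 2)%N w).

(* An increased entry [v] contributes [2 v + 1] to the sum of squares, so [topsq t k w] is the value
   obtained when exactly the entries above [t], and some entries equal to [t], are increased;
   it bounds the sum of squares of all elements of [incs k w]. *)
Definition topsq t k (w : seq nat) :=
  (sumsq w + k * (2 * t + 1) + 2 * sumn (map (fun v => v - t) w))%N.

Lemma sumsq_cons v w : sumsq (v :: w) = (v ^ 2 + sumsq w)%N. Proof. by []. Qed.

Lemma topsq_cons t k v w : topsq t k (v :: w) = (v ^ 2 + 2 * (v - t) + topsq t k w)%N.
Proof. by rewrite /topsq sumsq_cons /=; lia. Qed.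

Lemma topsqS t k w : topsq t k.+1 w = (2 * t + 1 + topsq t k w)%N.
Proof. by rewrite /topsq mulSn; lia. Qed.

Lemma sqS v : (v.+1 ^ 2 = v ^ 2 + 2 * v + 1)%N.
Proof. by rewrite -!mulnn; lia. Qed.

(** Raising [v], where [v = 0] for a new entry, adds [2v + 1], which is at most [2t + 1] plus twice
    the truncated difference [v - t]. *)
Lemma sumsq_incs_le t k w a : a \in incs k w -> (sumsq a <= topsq t k w)%N.
Proof.
elim: w k a => [|v w IH] k a.
  rewrite inE => /eqP->; rewrite /topsq /sumsq map_nseq exp1n sumn_nseq /=; lia.
elim: k a => [|k IHk] a.
  by case/mapP => u /IH le ->; rewrite sumsq_cons topsq_cons; lia.
rewrite incsS !mem_cat => /or3P[] /mapP[u Hu ->]; rewrite sumsq_cons.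
- by have := IHk _ Hu; rewrite topsqS; lia.
- by have := IH _ _ Hu; rewrite topsq_cons topsqS sqS; lia.
- by have := IH _ _ Hu; rewrite topsq_cons; lia.
Qed.

Lemma sumn_incs k w a : a \in incs k w -> sumn a = (k + sumn w)%N.
Proof.
elim: w k a => [|v w IH] k a.
  by rewrite inE => /eqP->; rewrite sumn_nseq /=; lia.
elim: k a => [|k IHk] a.
  by case/mapP => u /IH /= E ->; rewrite /= E.
rewrite incsS !mem_cat => /or3P[] /mapP[u Hu ->] /=.
- by rewrite (IHk _ Hu) /=; lia.
- by rewrite (IH _ _ Hu); lia.
- by rewrite (IH _ _ Hu); lia.
Qed.

Lemma incs_pos k w a : 0%N \notin w -> a \in incs k w -> 0%N \notin a.
Proof.
elim: w k a => [|v w IH] k a.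
  by move=> _; rewrite inE => /eqP->; rewrite mem_nseq andbF.
rewrite inE negb_or => /andP[v0 w0]; elim: k a => [|k IHk] a.
  by case/mapP => u /(IH _ _ w0) u0 ->; rewrite inE negb_or v0.
by rewrite incsS !mem_cat => /or3P[] /mapP[u Hu ->]; rewrite inE negb_or /= ?v0 ?(IHk _ Hu) ?(IH _ _ w0 Hu).
Qed.

Lemma count_leq_ltn t w : count (leq t) w = (count (ltn t) w + count_mem t w)%N.
Proof. by elim: w => //= v w ->; case: ltngtP; lia. Qed.

(** With more raised entries than entries that are at least [t], some raised entry, possibly a new
    0, is below [t] and contributes less than [2t + 1]. *)
Lemma sumsq_incs_lt t k w a : (0 < t)%N -> (count (leq t) w < k)%N -> a \in incs k w ->
  (sumsq a < topsq t k w)%N.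
Proof.
move=> t0; elim: w k a => [|v w IH] k a.
  by rewrite inE => /= k0 /eqP->; rewrite /topsq /sumsq map_nseq exp1n sumn_nseq /=; lia.
elim: k a => [|k IHk] a //= lt.
rewrite -/(incs k (v :: w)) !mem_cat => /or3P[] /mapP[u Hu ->]; rewrite sumsq_cons.
- by have := sumsq_incs_le t Hu; rewrite topsqS; lia.
- have [tv|vt] := leqP t v.
    by have := IH k u _ Hu; rewrite tv in lt; move=> /(_ lt); rewrite topsq_cons topsqS sqS; lia.
  by have := sumsq_incs_le t Hu; rewrite topsq_cons topsqS sqS; lia.
- by have := IH _ _ _ Hu; move=> /(_ ltac:(lia)); rewrite topsq_cons; lia.
Qed.

Variable V : zmodType.
Implicit Types (psi : seq nat -> V).

Lemma sum_incs0 v w psi :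
  \sum_(a <- incs 0 (v :: w)) psi a = \sum_(a <- incs 0 w) psi (v :: a).
Proof. by rewrite big_map. Qed.

Lemma sum_incsS k v w psi :
  \sum_(a <- incs k.+1 (v :: w)) psi a =
  \sum_(a <- incs k (v :: w)) psi (1%N :: a) + \sum_(a <- incs k w) psi (v.+1 :: a) +
  \sum_(a <- incs k.+1 w) psi (v :: a).
Proof. by rewrite incsS !big_cat !big_map /= addrA. Qed.

Lemma sum_incs_eq0 k w (psi : seq nat -> V) :
  (forall a : seq nat, a \in incs k w -> psi a = 0) -> \sum_(a <- incs k w) psi a = 0.
Proof. by move=> H; rewrite big_seq big1. Qed.

Lemma sum_incs_low t k w Q (psi : seq nat -> V) : (topsq t k w < Q)%N ->
  (forall a, a \in incs k w -> (sumsq a < Q)%N -> psi a = 0) ->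
  \sum_(a <- incs k w) psi a = 0.
Proof.
move=> lt H; apply: sum_incs_eq0 => a Ha; apply: H => //.
by apply: leq_ltn_trans lt; apply: sumsq_incs_le.
Qed.

(* The terms of [e_k M_w] with the largest sum of squares: for [0 < t] and [k] large enough,
   but not too large, all entries above [t] and some entries equal to [t] are increased. *)
Lemma sum_incs_fillw t k (w : seq nat) i psi : (0 < t)%N ->
  (k + i = count (ltn t) w + count_mem t w)%N ->
  (forall a, a \in incs k w -> (sumsq a < topsq t k w)%N -> psi a = 0) ->
  \sum_(a <- incs k w) psi a = sumb (count_mem t w) i (fun e => psi (fillw t w e)).
Proof.
move=> t0; elim: w k i psi => [|v w IH] k i psi.
  move=> /= /eqP; rewrite addn_eq0 => /andP[/eqP-> /eqP->] _.
  by rewrite big_seq1.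
have low y l (H : forall a, a \in incs k (v :: w) ->
    (sumsq a < topsq t k (v :: w))%N -> psi a = 0) :
    (forall a, a \in incs l w -> y :: a \in incs k (v :: w)) ->
    (y ^ 2 + topsq t l w = topsq t k (v :: w))%N ->
    forall a, a \in incs l w -> (sumsq a < topsq t l w)%N -> psi (y :: a) = 0.
  by move=> Hin E a Ha lt; apply: H; rewrite ?Hin // sumsq_cons -E ltn_add2l.
case: k low => [|k] low E H.
  rewrite sum_incs0.
  have in0 a : a \in incs 0 w -> v :: a \in incs 0 (v :: w).
    by move=> Ha; apply: (map_f (cons v)).
  move: E => /=; case: (ltngtP t v) => vt E.
  - rewrite sumb_gt; last by lia.
    apply: (sum_incs_low (t := t) (Q := (topsq t 0 (v :: w) - v ^ 2)%N)) => [|a Ha lt].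
      by rewrite topsq_cons; lia.
    by apply: H; [exact: in0|rewrite sumsq_cons; lia].
  - by rewrite (IH 0%N i) //=; apply: low => //; rewrite topsq_cons; lia.
  - subst v; case: i E => [|i] E; first by lia.
    rewrite (IH 0%N i) //=; last 2 first.
    + by lia.
    + by apply: low => //; rewrite topsq_cons; lia.
    by rewrite [X in _ + X]sumb_gt ?addr0 //; lia.
have in1 a : a \in incs k w -> v.+1 :: a \in incs k.+1 (v :: w).
  by move=> Ha; rewrite incsS !mem_cat (map_f (cons v.+1)) ?orbT.
have in2 a : a \in incs k.+1 w -> v :: a \in incs k.+1 (v :: w).
  by move=> Ha; rewrite incsS !mem_cat (map_f (cons v)) ?orbT.
rewrite sum_incsS (_ : \sum_(a <- incs k (v :: w)) _ = 0) ?add0r; last first.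
  apply: (sum_incs_low (t := t) (Q := (topsq t k.+1 (v :: w) - 1)%N)) => [|a Ha lt].
    by rewrite topsqS; lia.
  apply: H; last by rewrite sumsq_cons; lia.
  by rewrite incsS mem_cat (map_f (cons 1%N)).
move: E => /=; case: (ltngtP t v) => vt E.
- rewrite (IH k i) //=; last 2 first.
  + by lia.
  + by apply: low => //; rewrite topsq_cons topsqS sqS; lia.
  rewrite [X in _ + X](_ : _ = 0) ?addr0; last first.
    apply: (sum_incs_low (t := t) (Q := (topsq t k.+1 (v :: w) - v ^ 2)%N)) => [|a Ha lt].
      by rewrite topsq_cons; lia.
    by apply: H; [exact: in2|rewrite sumsq_cons; lia].
  by rewrite add0n.
- rewrite [X in X + _](_ : _ = 0) ?add0r; last first.
    apply: (sum_incs_low (t := t) (Q := (topsq t k.+1 (v :: w) - v.+1 ^ 2)%N)) => [|a Ha lt].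
      by rewrite topsq_cons topsqS sqS; lia.
    by apply: H; [exact: in1|rewrite sumsq_cons; lia].
  by rewrite (IH k.+1 i) //=; apply: low => //; rewrite topsq_cons; lia.
subst v; rewrite (IH k i) //=; last 2 first.
+ by lia.
+ by apply: low => //; rewrite topsq_cons topsqS sqS; lia.
rewrite addrC; congr (_ + _); case: i E => [|i] E.
  apply: sum_incs_eq0 => a Ha; apply: H; first exact: in2.
  have := sumsq_incs_lt t0 _ Ha; rewrite sumsq_cons topsq_cons subnn muln0 addn0 ltn_add2l; apply.
  by rewrite count_leq_ltn; move: E; rewrite addn0 add0n add1n addnS => -[->].
by rewrite (IH k.+1 i) //=; [lia|apply: low => //; rewrite topsq_cons; lia].
Qed.

Lemma sumsq_incs_lt0 k (w a : seq nat) : 0%N \notin w -> (k < size w)%N -> a \in incs k w ->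
  (sumsq a < topsq 0 k w)%N.
Proof.
elim: w k a => [|v w IH] k a //.
rewrite inE negb_or eq_sym -lt0n => /andP[v0 w0].
elim: k a => [|k IHk] a lt.
  case/mapP => u /(sumsq_incs_le 0) le ->; rewrite sumsq_cons topsq_cons; lia.
rewrite incsS !mem_cat => /or3P[] /mapP[u Hu ->]; rewrite sumsq_cons.
- by have := IHk _ (ltnW lt) Hu; rewrite topsqS; lia.
- by have := IH _ _ w0 lt Hu; rewrite topsq_cons topsqS sqS; lia.
- by have := sumsq_incs_le 0 Hu; rewrite topsq_cons; lia.
Qed.

(** The case [t = 0]: in the top terms all entries of [w] are raised and [m] letters 1 are new. *)
Lemma sum_incs_weave m (w : seq nat) psi : 0%N \notin w ->
  (forall a, a \in incs (m + size w) w -> (sumsq a < topsq 0 (m + size w) w)%N -> psi a = 0) ->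
  \sum_(a <- incs (m + size w) w) psi a = sch m (size w) (fun b => psi (weave b (map S w))).
Proof.
elim: w m psi => [|v w IHw] m psi.
  rewrite addn0 big_seq1 schn0 /= => _ _; congr psi.
  by elim: m => //= m ->.
rewrite inE negb_or eq_sym -lt0n => /andP[v0 w0]; rewrite [size _]/= addnS.
elim: m psi => [|m IHm] psi H; rewrite sum_incsS.
  rewrite [X in X + _ + _](_ : _ = 0) ?add0r; last first.
    apply: sum_incs_eq0 => a Ha; apply: H; first by rewrite incsS mem_cat map_f.
    have lt : (size w < size (v :: w))%N by [].
    have vw0 : 0%N \notin v :: w by rewrite inE negb_or eq_sym -lt0n v0.
    by have := sumsq_incs_lt0 vw0 lt Ha; rewrite sumsq_cons topsqS add0n; lia.
  rewrite [X in _ + X](_ : _ = 0) ?addr0; last first.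
    apply: sum_incs_eq0 => a Ha; apply: H.
      by rewrite incsS !mem_cat (map_f (cons v)) ?orbT.
    by have := sumsq_incs_le 0 Ha; rewrite sumsq_cons topsq_cons; lia.
  rewrite sch0S -(IHw 0%N (fun a => psi (v.+1 :: a))) // => a Ha lt; apply: H.
    by rewrite incsS !mem_cat (map_f (cons v.+1)) ?orbT.
  by rewrite sumsq_cons topsq_cons topsqS sqS; lia.
rewrite [X in _ + X](_ : _ = 0) ?addr0; last first.
  apply: sum_incs_eq0 => a Ha; apply: H.
    by rewrite incsS !mem_cat (map_f (cons v)) ?orbT.
  by have := sumsq_incs_le 0 Ha; rewrite sumsq_cons topsq_cons; lia.
rewrite schSS; congr (_ + _).
  rewrite addSn (IHm (fun a => psi (1%N :: a))) // => a Ha lt; apply: H.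
    by rewrite incsS mem_cat map_f.
  by rewrite sumsq_cons addSn topsqS; lia.
rewrite (IHw m.+1 (fun a => psi (v.+1 :: a))) // => a Ha lt; apply: H.
  by rewrite incsS !mem_cat (map_f (cons v.+1)) ?orbT.
by rewrite sumsq_cons topsq_cons topsqS sqS; lia.
Qed.
End Increments.

Section Patterns.

Lemma content_perm c (a a' : seq nat) : content c a -> content c a' -> perm_eq a a'.
Proof. by move=> ca ca'; apply/allP => j _ /=; rewrite ca ca'. Qed.

Lemma content_notin0 c a : content c a -> 0%N \notin a.
Proof. by move=> /(_ 0%N) c0; rewrite -has_pred1 has_count c0. Qed.

Lemma content_size c (a : seq nat) : content c a -> size a = sumn c.
Proof. by case/content_code => x vx <-; apply: size_word. Qed.

Lemma size_fillw t (w : seq nat) e : count_mem t w = size e -> size (fillw t w e) = size w.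
Proof.
elim: w e => //= v w IH e; case: ltngtP => /= vt; rewrite ?add0n => ce.
- by rewrite IH.
- by rewrite IH.
- by case: e ce => //= y e [ce]; rewrite IH.
Qed.

Lemma sumn_fillw (t k : nat) (w : seq nat) (e : bitseq) : count_mem t w = size e ->
  (k + count id e = count (ltn t) w + count_mem t w)%N -> sumn (fillw t w e) = (k + sumn w)%N.
Proof.
elim: w k e => [|v w IH] k e /=.
  by case: e => //= _; rewrite addn0 => ->.
case: ltngtP => /= vt; rewrite ?add0n => ce ke.
- case: k ke => [|k] ke; first by have := count_size id e; rewrite -ce; lia.
  by rewrite (IH k) //=; lia.
- by rewrite (IH k) //=; lia.
- subst v; case: e ce ke => //= -[] e [ce] /= ke.
    by rewrite (IH k) //=; lia.
  case: k ke => [|k] ke; first by have := count_size id e; rewrite -ce; lia.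
  by rewrite (IH k) //=; lia.
Qed.

Lemma sumsq_fillw (t k : nat) (w : seq nat) (e : bitseq) : count_mem t w = size e ->
  (k + count id e = count (ltn t) w + count_mem t w)%N -> sumsq (fillw t w e) = topsq t k w.
Proof.
elim: w k e => [|v w IH] k e /=.
  by case: e => //= _; rewrite addn0 => ->.
rewrite topsq_cons; case: ltngtP => /= vt; rewrite ?add0n => ce ke; rewrite ?sumsq_cons.
- case: k ke => [|k] ke; first by have := count_size id e; rewrite -ce; lia.
  by rewrite (IH k) //=; [rewrite topsqS sqS; lia|lia].
- by rewrite (IH k) //=; lia.
- subst v; case: e ce ke => //= -[] e [ce] /= ke; rewrite ?sumsq_cons.
    by rewrite (IH k) //=; lia.
  case: k ke => [|k] ke; first by have := count_size id e; rewrite -ce; lia.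
  by rewrite (IH k) //=; [rewrite topsqS sqS; lia|lia].
Qed.

Lemma sumn_weave m b (w : seq nat) : count id b = m -> count negb b = size w ->
  sumn (weave b (map S w)) = (m + size w + sumn w)%N.
Proof.
move=> <- {m}; elim: b w => [|[] b IH] [|v w] //= nb; try lia.
- by rewrite (IH [::]) //= !addn0 add1n.
- by rewrite (IH (v :: w)) //= !addnA.
- by rewrite IH; lia.
Qed.

Lemma sumsq_weave m b (w : seq nat) : count id b = m -> count negb b = size w ->
  sumsq (weave b (map S w)) = topsq 0 (m + size w) w.
Proof.
move=> <- {m}; elim: b w => [|[] b IH] [|v w] //= nb; try lia; rewrite sumsq_cons.
- by rewrite (IH [::]) // add1n addSn topsqS.
- by rewrite (IH (v :: w)) // add1n addSn topsqS.
- by rewrite IH; [rewrite add0n addnS topsq_cons topsqS sqS; lia|lia].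
Qed.

Variable V : zmodType.
Implicit Types psi : seq nat -> V.

Definition fill_rel c psi := forall t (w : seq nat) i, (0 < t)%N -> (i < count_mem t w)%N ->
  0%N \notin w ->
  (forall e, size e = count_mem t w -> count id e = i -> content c (fillw t w e)) ->
  sumb (count_mem t w) i (fun e => psi (fillw t w e)) = 0.

Lemma pattern_exists N i : (i <= N)%N -> exists2 e, size e = N & count id e = i.
Proof.
move=> iN; exists (nseq i true ++ nseq (N - i) false); first by rewrite size_cat !size_nseq subnKC.
by rewrite count_cat !count_nseq mul1n mul0n addn0.
Qed.

(** The relation for the letters [j] and [j + 1] comes from [fill_rel] with [t = j]; weaving in the
    fixed pattern of a smaller letter raises [t] by 1. *)
Lemma fill_rel_Rel c psi : all (leq 1) c -> fill_rel c psi -> Rel c (fun x => psi (word x)).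
Proof.
elim: c psi => [|m c IH] psi //= /andP[m0 c0] H; split.
  case: c c0 {IH} H => // p c /andP[p0 _] H d v sd cd vv.
  have w0 := content_notin0 (content_word vv).
  have nd : count negb d = size (word v) by rewrite count_negb sd cd (size_word vv) addKn.
  have cw : count_mem 1%N (weave d (map S (word v))) = (m + p)%N.
    by rewrite count_weave ?size_map // count_mapS cd (content_word vv 0%N) eqxx mul1n addn0.
  have fE e : size e = (m + p)%N ->
      fillw 1 (weave d (map S (word v))) e = word (fill1 d e :: fill2 d e :: v).
    by move=> se; rewrite fillw_weave1 // cd se.
  have := H 1%N (weave d (map S (word v))) m isT; rewrite cw /sch => {}H.
  rewrite -[RHS]H.
  - by apply: eq_sumb => e se _; rewrite fE.
  - by rewrite -{1}[m]addn0 ltn_add2l.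
  - by rewrite -has_pred1 has_count count_weave ?size_map // count0_mapS.
  - by move=> e se ce; rewrite fE //; apply/content_word/vcode_fill.
move=> b cb sb; apply: (IH (fun w => psi (weave b (map S w)))) => // t w i t0 iN w0 C.
have [e0 se0 ce0] := pattern_exists (ltnW iN).
have nb : count negb b = size w.
  rewrite -(size_fillw (t := t) (e := e0)) // (content_size (C _ se0 ce0)).
  by rewrite count_negb sb cb addKn.
have cw : count_mem t.+1 (weave b (map S w)) = count_mem t w.
  by rewrite count_weave ?size_map // count_mapS; case: t t0 {iN C se0}.
have fE e : size e = count_mem t w ->
    fillw t.+1 (weave b (map S w)) e = weave b (map S (fillw t w e)).
  by move=> se; rewrite fillw_weave.
have := H t.+1 (weave b (map S w)) i isT; rewrite cw => {}H.
rewrite -[RHS]H //.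
- by apply: eq_sumb => e se _; rewrite fE.
- by rewrite -has_pred1 has_count count_weave ?size_map // count0_mapS.
- move=> e se ce; rewrite fE //; apply: content_weave => //; last exact: C.
  by rewrite size_fillw.
Qed.
End Patterns.

(** * Codes of pure inverting words and the elements of [inB] *)

Section PureInverting.

Lemma subseq_weave b (u : seq nat) : count negb b = size u -> subseq u (weave b u).
Proof.
elim: b u => [|[] b IH] [|v u] //= nb; last by rewrite eqxx IH //; lia.
by case: eqP => _; [apply: subseq_trans (subseq_cons _ _) (IH (v :: u) nb)|exact: (IH (v :: u))].
Qed.

Lemma mem1_weave b u : count negb b = size u -> has id b -> 1%N \in weave b u.
Proof.
elim: b u => [|[] b IH] [|v u] //= nb h; rewrite inE ?eqxx //.
by rewrite IH ?orbT //; lia.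
Qed.

Lemma mem1_take_weave g b u : count negb b = size u -> true \in take g b ->
  1%N \in take g (weave b u).
Proof.
elim: b u g => [|[] b IH] [|v u] [|g] //= nb; rewrite !inE ?eqxx //=.
by move/IH => ->; rewrite ?orbT //; lia.
Qed.

Lemma subseq_weave1 y b (u : seq nat) : count negb b = size u -> y \in take (gam b) u ->
  subseq [:: y; 1%N] (weave b u).
Proof.
elim: b u => [|[] b IH] u /=; rewrite ?add0n ?add1n => nb; first by rewrite take0.
  have [h|h] := boolP (has id b); last by rewrite gam0 ?take0.
  move=> yt; have := IH u nb yt; case: eqP => [->|_] // sub.
  exact: subseq_trans sub.
case: u nb => [|v u] //= [nb]; have [h|//] := boolP (has id b).
rewrite /= inE => /orP[/eqP ->|yt].
  by rewrite eqxx sub1seq mem1_weave.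
case: eqP => [_|_]; last exact: IH.
by rewrite sub1seq mem1_weave.
Qed.

Lemma subseq2_nth (i j : nat) a : subseq [:: i; j] a ->
  exists s t, [/\ (s < t)%N, (t < size a)%N, nth 0%N a s = i & nth 0%N a t = j].
Proof.
elim: a => //= v a IH; case: eqP => [->|_].
  rewrite sub1seq => ja; exists 0%N, (index j a).+1; split=> //=; first by rewrite ltnS index_mem.
  exact: nth_index.
by case/IH => s [t [st ta <- <-]]; exists s.+1, t.+1.
Qed.

Lemma inv_subseq c x i : all (leq 1) c -> vcode c x -> inv x -> (1 < i <= size c)%N ->
  subseq [:: i; i.-1] (word x).
Proof.
elim: c x i => [|m c IH] [|b x] [|[|i]] // /andP[m0 c0] vx /andP[hx ix] /andP[_ ic].
case/and3P: (vx) => /eqP cb /eqP sb vx'.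
have nb : count negb b = size (word x) by rewrite (size_word vx') count_negb sb cb addKn.
have nb' : count negb b = size (map S (word x)) by rewrite size_map.
case: i ic => [|i] ic /=; last first.
  apply: subseq_trans (subseq_weave nb').
  by have := IH x i.+2 c0 vx' ix ic; move/(map_subseq S).
apply: subseq_weave1 => //; rewrite -map_take.
case: c c0 vx' ic {IH vx sb} => // p c c0 vx' _; case: x vx' hx {ix nb nb'} => // b' x vx' hx.
case/and3P: vx' => /eqP cb' /eqP sb' vx''; apply: (map_f S); apply: mem1_take_weave => //.
by rewrite size_map (size_word vx'') count_negb sb' cb' addKn.
Qed.

Lemma content_le c a v : content c a -> v \in a -> (v <= size c)%N.
Proof.
move=> ca; rewrite -has_pred1 has_count ca; case: (leqP v (size c)) => // le.
by rewrite [nth _ _ _]nth_default.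
Qed.

Lemma inv_inverting c x : all (leq 1) c -> vcode c x -> inv x -> inverting (word x).
Proof.
move=> c0 vx ix i i1 imax; apply: subseq2_nth; apply: (inv_subseq c0 vx ix); rewrite i1 /=.
apply: leq_trans imax _; apply/bigmax_leqP_seq => v va _.
exact: content_le (content_word vx) va.
Qed.

(** The maximal [k] in the factorization that defines [pure], as [run_factors] and [factors_run]
    show. *)
Fixpoint run (x : seq bitseq) : nat :=
  if x is b :: x' then if block_end b then (run x').+1 else 0%N else 0%N.

Lemma pure_inv_run x : pure_inv x = inv x && ~~ odd (run x).
Proof.
elim: x => //= b x ->; case: (block_end b); rewrite /= ?andbT //.
by case: (inv x); rewrite ?andbF //= negbK.
Qed.

Definition final_runs (exps : seq nat) k :=
  flatten [seq nseq (nth 0%N exps j.-1) j | j <- rev (iota 1 k)].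

Lemma final_runsS m exps k :
  final_runs (m :: exps) k.+1 = map S (final_runs exps k) ++ nseq m 1%N.
Proof.
rewrite /final_runs [iota 1 k.+1]/= rev_cons map_rcons flatten_rcons; congr (_ ++ _).
rewrite -[2%N]/(1 + 1)%N iotaDl -map_rev -map_comp map_flatten -map_comp; congr flatten.
apply/eq_in_map => -[|j] /=; first by rewrite mem_rev mem_iota.
by rewrite map_nseq.
Qed.

Lemma weave_endb b w : count negb b = size w -> block_end b -> weave b w = w ++ nseq (count id b) 1%N.
Proof.
move=> nb /eqP {1}->; rewrite nb.
elim: w {nb} => [|v w IH] /=; last by rewrite IH.
by elim: (count id b) => //= m ->.
Qed.

Lemma weave_encode b w : count negb b = size w -> 0%N \notin w ->
  map (pred1 1%N) (weave b (map S w)) = b /\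
  map predn (filter (predC (pred1 1%N)) (weave b (map S w))) = w.
Proof.
elim: b w => [|[] b IH] [|v w] //= nb; rewrite ?inE ?negb_or.
- by move=> w0; have [|-> ->] := IH [::] _ w0.
- by rewrite -negb_or -in_cons => w0; have [|-> ->] := IH (v :: w) _ w0.
- case/andP; case: v => // v _ w0; have [|E1 E2] := IH w _ w0; first by case: nb.
  by rewrite /= E1 E2.
Qed.

Lemma factors_withS (a : seq nat) k : 0%N \notin a -> factors_with a k.+1 ->
  exists w m, [/\ (0 < m)%N, 0%N \notin w, a = map S w ++ nseq m 1%N & factors_with w k].
Proof.
move=> a0 [g [[|m exps]]] [] // [se] /andP[m0 e0] g0.
rewrite -/(final_runs _ _) final_runsS catA => E.
move: a0; rewrite E mem_cat negb_or mem_cat negb_or => /andP[/andP[g1 _] _].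
pose g' := map predn g.
have gE : g = map S g'.
  rewrite -map_comp -[LHS]map_id; apply/eq_in_map => v vg /=.
  by case: v vg => // vg; case/negP: g1.
have g'k : all (fun v => k < v)%N g'.
  rewrite all_map; apply/allP => v vg /=; have := allP g0 _ vg; case: v vg => [vg|v _ /=].
    by case/negP: g1.
  by rewrite ltnS.
exists (g' ++ final_runs exps k), m; split=> //; last first.
- by exists g', exps; split=> //; apply: sub_all g'k => v kv; rewrite kv orbT.
- by rewrite map_cat -gE.
rewrite mem_cat negb_or; apply/andP; split.
  by apply/negP => /(allP g'k).
apply/negP => /flattenP[u /mapP[j]]; rewrite mem_rev mem_iota => /andP[j0 _] ->.
by rewrite mem_nseq; case: j j0 => // j _; rewrite andbF.
Qed.

Lemma factors_with_shift (w : seq nat) m k : (0 < m)%N -> 0%N \notin w ->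
  factors_with w k -> factors_with (map S w ++ nseq m 1%N) k.+1.
Proof.
move=> m0 w0 [g [exps [se e0 g0 E]]].
exists (map S g), (m :: exps); split; first by rewrite /= se.
- by rewrite /= m0.
- rewrite all_map; apply/allP => -[|v] vg /=; last by have := allP g0 _ vg.
  by move: w0; rewrite E mem_cat vg.
by rewrite -/(final_runs _ _) final_runsS catA -map_cat [final_runs _ _]/final_runs -E.
Qed.

Lemma shift_inj (w w' : seq nat) m m' : 0%N \notin w -> 0%N \notin w' ->
  map S w ++ nseq m 1%N = map S w' ++ nseq m' 1%N -> w = w'.
Proof.
have F u l : 0%N \notin u -> map predn (filter (predC (pred1 1%N)) (map S u ++ nseq l 1%N)) = u.
  move=> u0; rewrite filter_cat map_cat [X in _ ++ X](_ : _ = [::]) ?cats0; last by elim: l.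
  rewrite (all_filterP _) -?map_comp ?map_id //.
  by apply/allP => _ /mapP[[|v] vu ->] //; case/negP: u0.
by move=> w0 w0' E; rewrite -(F w m) // E F.
Qed.

Lemma run_factors c x : vcode c x -> all (leq 1) c -> factors_with (word x) (run x).
Proof.
elim: c x => [|m c IH] [|b x] // vx.
  by move=> _; exists [::], [::].
case/andP=> m0 c0; case/and3P: (vx) => /eqP cb /eqP sb vx'.
have nb : count negb b = size (word x) by rewrite (size_word vx') count_negb sb cb addKn.
rewrite [run _]/=; case: ifP => [eb|_]; last first.
  exists (word (b :: x)), [::]; split=> //; last by rewrite cats0.
  by apply/allP => -[].
rewrite /= weave_endb ?size_map // cb; apply: factors_with_shift => //; last exact: IH.
exact: content_notin0 (content_word vx').
Qed.

(** In a factorization with a positive number of blocks the letters 1 form the last block. A word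
    determines its code, so the first pattern of [x] is a final block, and induction applies to the
    word without its letters 1, shifted down. *)
Lemma factors_run c x k : vcode c x -> factors_with (word x) k -> (k <= run x)%N.
Proof.
elim: k c x => // k IH c x vx /(factors_withS (content_notin0 (content_word vx))).
case=> w [m [m0 w0 E Fw]].
case: c x vx E => [|p c] [|b x] // vx E.
  by move/(congr1 size): E; rewrite size_cat size_nseq /=; lia.
case/and3P: (vx) => /eqP cb /eqP sb vx'.
have nb : count negb b = size (word x) by rewrite (size_word vx') count_negb sb cb addKn.
have [E1 E2] := weave_encode nb (content_notin0 (content_word vx')).
pose d := nseq (size w) false ++ nseq m true.
have N0 : count negb d = size w by rewrite count_cat !count_nseq; lia.
have [E3 E4] := weave_encode N0 w0.
have Ed : block_end d by rewrite /block_end N0 count_cat !count_nseq mul0n mul1n.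
have Ew : weave b (map S (word x)) = weave d (map S w).
  by rewrite (weave_endb _ Ed) ?size_map // count_cat !count_nseq mul0n mul1n.
move: E1 E2; rewrite Ew E3 E4 => Eb Ewx.
by rewrite [run _]/= -Eb Ed ltnS; apply: IH vx' _; rewrite -Ewx.
Qed.

Lemma pure_inv_inB n c x : all (leq 1) c -> vcode c x -> (size (word x) <= n)%N -> pure_inv x ->
  inB n (word x).
Proof.
move=> c0 vx sn; rewrite pure_inv_run => /andP[ix rx]; split=> //.
- apply/allP => -[|v] //; have := content_notin0 (content_word vx); by move=> /negP.
- exact: inv_inverting c0 vx ix.
- exists (run x); split=> //; first exact: run_factors vx c0.
  by move=> k; apply: factors_run vx.
Qed.
End PureInverting.

(** * Functionals on compositions of a fixed degree *)

Section Vanishing.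
Variables (V : zmodType) (n d : nat) (phi : seq nat -> V).
Hypothesis H1 : forall k (w : seq nat), (0 < k)%N -> 0%N \notin w -> (k + sumn w)%N = d ->
  \sum_(a <- incs k w) phi a = 0.
Hypothesis H2 : forall w, inB n w -> sumn w = d ->
  (forall a : seq nat, 0%N \notin a -> sumn a = d -> (sumsq a < sumsq w)%N -> phi a = 0) -> phi w = 0.
Hypothesis H3 : forall a, (n < size a)%N -> phi a = 0.

Section Step.
Variable Q : nat.
Hypothesis IH : forall a : seq nat, 0%N \notin a -> sumn a = d -> (sumsq a < Q)%N -> phi a = 0.

(** All words in the sum have the same degree and sum of squares, so the condition on one pattern
    [e0] settles all of them. *)
Lemma fills_vanish t (w : seq nat) i e0 : (0 < t)%N -> 0%N \notin w ->
  (0 < count (ltn t) w + count_mem t w - i)%N -> (i <= count_mem t w)%N ->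
  size e0 = count_mem t w -> count id e0 = i ->
  sumn (fillw t w e0) = d -> sumsq (fillw t w e0) = Q ->
  sumb (count_mem t w) i (fun e => phi (fillw t w e)) = 0.
Proof.
move=> t0 w0; set k := (_ - i)%N => k0 iN se ce sd sq.
have ki : (k + i = count (ltn t) w + count_mem t w)%N.
  by rewrite /k subnK // (leq_trans iN) // leq_addl.
have kd : (k + sumn w)%N = d by rewrite -sd (sumn_fillw (k := k)) ?se // ce.
have kq : topsq t k w = Q by rewrite -sq (sumsq_fillw (k := k)) ?se // ce.
rewrite -(sum_incs_fillw (k := k)) //; first exact: H1.
move=> a Ha; rewrite kq => lt; apply: IH => //; first exact: incs_pos Ha.
by rewrite (sumn_incs Ha).
Qed.

Lemma weaves_vanish m (w : seq nat) b0 : (0 < m + size w)%N -> 0%N \notin w ->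
  count id b0 = m -> count negb b0 = size w ->
  sumn (weave b0 (map S w)) = d -> sumsq (weave b0 (map S w)) = Q ->
  sch m (size w) (fun b => phi (weave b (map S w))) = 0.
Proof.
move=> k0 w0 cb nb sd sq.
rewrite (sumn_weave cb nb) in sd; rewrite (sumsq_weave cb nb) in sq.
rewrite -sum_incs_weave //; first exact: H1.
move=> a Ha; rewrite sq => lt; apply: IH => //; first exact: incs_pos Ha.
by rewrite (sumn_incs Ha).
Qed.

(** If a value is skipped, lowering all larger entries by 1 gives a [w] such that [a] is the only
    top term of some [e_k M_w]. *)
Lemma missing_vanish t (a : seq nat) : 0%N \notin a -> sumn a = d -> sumsq a = Q ->
  t.+1 \notin a -> has (ltn t.+1) a -> phi a = 0.
Proof.
move=> a0 sd sq ta ha; case: t ta ha => [|t] ta ha.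
  pose w := map predn a.
  have aE : map S w = a.
    rewrite -map_comp -[RHS]map_id; apply/eq_in_map => -[|v] //= va.
    by case/negP: a0.
  have w0 : 0%N \notin w.
    apply: contra ta => /mapP[[|[|v]] va] // _.
    by case/negP: a0.
  have wE : weave (nseq (size w) false) (map S w) = a.
    by rewrite weave_endb ?count_nseq ?mul0n ?mul1n ?size_map ?cats0 // /block_end !count_nseq mul0n mul1n cats0.
  have := @weaves_vanish 0 w (nseq (size w) false).
  rewrite sch0 wE; apply=> //; rewrite ?count_nseq ?mul1n ?mul0n //.
  by rewrite size_map; case: (a) ha.
pose w := map (fun v => if (t.+2 < v)%N then v.-1 else v) a.
pose N := count_mem t.+1 w.
have fE : fillw t.+1 w (nseq N true) = a.
  rewrite /N /w; elim: a ta {a0 sd sq ha w N} => //= v a IHa; rewrite inE negb_or => /andP[tv ta].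
  case: (ltnP t.+2 v) => lt.
    rewrite ltnNge; have -> : (t.+1 <= v.-1)%N by lia.
    have -> : (t.+1 < v.-1)%N by lia.
    rewrite (_ : (v.-1 == t.+1) = false) ?add0n ?IHa //; last by lia.
    by congr cons; lia.
  case: (ltngtP v t.+1) => vt; rewrite ?add0n ?add1n /= ?IHa ?vt //.
  by move: tv lt vt; lia.
have sN : size (nseq N true) = N by rewrite size_nseq.
have cN : count id (nseq N true) = N by rewrite count_nseq mul1n.
have w0 : 0%N \notin w.
  by apply/negP => /mapP[[|v] va]; [case/negP: a0|case: ifP => // lt; case: (v) lt].
have gt0 : (0 < count (ltn t.+1) w + count_mem t.+1 w - N)%N.
  rewrite addnK -has_count; case/hasP: ha => v va tv; apply/hasP; exists v.-1; last by move: tv => /=; lia.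
  by apply/mapP; exists v; rewrite //= ifT.
have := fills_vanish (i := N) (e0 := nseq N true) (ltn0Sn t) w0 gt0 (leqnn N) sN cN.
by rewrite fE sumb_full fE; apply.
Qed.

Lemma complete_vanish c a : all (leq 1) c -> content c a -> sumn a = d -> sumsq a = Q -> phi a = 0.
Proof.
move=> c0 ca sd sq; have [x vx <-] := content_code ca.
have cs w : content c w -> sumn w = d /\ sumsq w = Q.
  move=> cw; have pw := content_perm cw ca.
  by rewrite -sd -sq /sumsq !sumnE !big_map (perm_big _ pw) (perm_big a pw).
apply: (pure_inverting_eq0 c0 (f := fun x => phi (word x))) vx.
- apply: fill_rel_Rel => // t w i t0 iN w0 C.
  have [e0 se0 ce0] := pattern_exists (ltnW iN).
  have [sd0 sq0] := cs _ (C _ se0 ce0).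
  apply: (fills_vanish (e0 := e0)) => //; last exact: ltnW.
  by rewrite subn_gt0 (leq_trans iN) // leq_addl.
- case: c c0 ca cs => // m c /andP[m0 c0] ca cs u vu.
  have [b0 sb0 cb0] := pattern_exists (leq_addr (sumn c) m).
  have nb0 : count negb b0 = size (word u) by rewrite count_negb sb0 cb0 addKn (size_word vu).
  have [sd0 sq0] := cs _ (content_weave cb0 nb0 (content_word vu)).
  rewrite -(size_word vu); apply: weaves_vanish cb0 nb0 sd0 sq0; last exact: content_notin0 (content_word vu).
  by rewrite addn_gt0 m0.
- move=> y vy Py; have [sn|sn] := leqP (size (word y)) n; last exact: H3.
  have [sdy sqy] := cs _ (content_word vy).
  apply: H2 => //; first exact: pure_inv_inB c0 vy sn Py.
  by rewrite sqy.
Qed.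
End Step.

Lemma compositions_vanish (a : seq nat) : 0%N \notin a -> sumn a = d -> phi a = 0.
Proof.
have [m] := ubnP (sumsq a); elim: m a => // m IHm a lt a0 sd.
have IH (a' : seq nat) : 0%N \notin a' -> sumn a' = d -> (sumsq a' < sumsq a)%N -> phi a' = 0.
  by move=> a0' sd' lt'; apply: IHm => //; lia.
pose M := \max_(v <- a) v.
have aM v : v \in a -> (v <= M)%N by move=> va; exact: (leq_bigmax_seq (F := id) v va isT).
pose c := mkseq (fun j => count_mem j.+1 a) M.
have [ac|] := boolP (all (leq 1) c).
  apply: (complete_vanish IH ac) => // j; case: j => [|j].
    by apply/eqP; rewrite eqn0Ngt -has_count has_pred1.
  rewrite /=; have [jM|Mj] := ltnP j M; first by rewrite nth_mkseq.
  rewrite nth_default ?size_mkseq //; apply/eqP; rewrite eqn0Ngt -has_count has_pred1.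
  by apply/negP => /aM; lia.
rewrite -has_predC => /hasP[x /mapP[t]]; rewrite mem_iota => /andP[_ tM] -> /=.
rewrite -eqn0Ngt eqn0Ngt -has_count has_pred1 => ta.
apply: (missing_vanish IH a0 sd erefl ta).
apply: contraTT tM => /hasPn h; rewrite -leqNgt add0n; apply/bigmax_leqP_seq => v va _.
rewrite leqNgt; apply/negP => tv; have := h v va; rewrite /= -leqNgt leq_eqVlt ltnS (leqNgt v) tv orbF.
by move/eqP => vE; rewrite -vE va in ta.
Qed.
End Vanishing.

(** * Composition tableaux *)

Section Tableaux.
Implicit Types (T : seq (seq nat)) (a b i r : seq nat).

Lemma mem_tuples_in s k t : (t \in tuples_in s k) = (size t == k) && all (mem s) t.
Proof.
elim: k t => [|k IH] [|x t] //=.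
  by apply/allpairsP => -[] [? ?] [].
apply/allpairsP/idP => [[[y u] /= [ys us [-> ->]]]|].
  by move: us; rewrite IH ys eqSS => /andP[-> ->].
by rewrite eqSS => /and3P[st xs ts]; exists (x, t); rewrite /= IH st ts.
Qed.

Lemma uniq_tuples_in (s : seq nat) k : uniq s -> uniq (tuples_in s k).
Proof.
move=> us; elim: k => //= k IH; apply: allpairs_uniq => //.
by move=> [x t] [y u] _ _ /= [-> ->].
Qed.

Lemma mem_fillings n a T : (T \in fillings n a) =
  (map size T == a) && all (all (fun x => 0 < x <= n)%N) T.
Proof.
elim: a T => [|r a IH] [|t T] //=.
  by apply/allpairsP => -[] [? ?] [].
have M u : (u \in tuples_in (iota 1 n) r) = (size u == r) && all (fun x => 0 < x <= n)%N u.
  by rewrite mem_tuples_in; congr (_ && _); apply: eq_all => x /=; rewrite mem_iota add1n ltnS.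
rewrite eqseq_cons; apply/allpairsP/idP => [[[u U] /= [ut UT [-> ->]]]|].
  by move: ut UT; rewrite M IH => /andP[-> ->] /andP[-> ->].
by move=> /andP[/andP[st sT] /andP[at_ aT]]; exists (t, T); rewrite /= M IH st sT at_ aT.
Qed.

Lemma uniq_fillings n a : uniq (fillings n a).
Proof.
elim: a => //= r a IH; apply: allpairs_uniq => //; first exact/uniq_tuples_in/iota_uniq.
by move=> [x t] [y u] _ _ /= [-> ->].
Qed.

Definition tableaux n b (m : 'X_{1..n}) :=
  [seq T <- fillings n b | is_comp_tableau b T & tab_weight n T == m].

Lemma mcoeff_qschur n b m : (qschur n b)@_m = (size (tableaux b m))%:R.
Proof.
rewrite raddf_sum /= (eq_bigr (fun T => if tab_weight n T == m then 1 else 0)); last first.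
  by move=> T _; rewrite mcoeffX; case: eqP.
by rewrite -big_mkcondr -big_filter big_const_seq count_predT iter_addr_0.
Qed.

(* Entries are numbered from 1 and the positions in [i] from 0; 0 stands for an absent cell. *)
Definition relabel i i' x := if x is x'.+1 then (nth 0%N i' (index x' i)).+1 else 0%N.

Definition legal i x := (x == 0%N) || (x.-1 \in i).

Lemma relabel_legal i i' x : size i = size i' -> legal i x -> legal i' (relabel i i' x).
Proof.
move=> si; case: x => [|x] //= xi; apply/orP; right.
by apply: mem_nth; rewrite -si index_mem.
Qed.

Lemma relabelK i i' x : uniq i' -> size i = size i' -> legal i x ->
  relabel i' i (relabel i i' x) = x.
Proof.
move=> ui si; case: x => [|x] //= xi.
by rewrite index_uniq ?nth_index // -si index_mem.
Qed.

Lemma relabel_mono i i' : sorted ltn i -> sorted ltn i' -> size i = size i' ->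
  {in legal i &, {homo relabel i i' : x y / (x < y)%N}}.
Proof.
move=> so so' si [|x] [|y] // lx ly; rewrite !ltnS => lt.
have ix : (index x i < size i)%N by rewrite index_mem.
have iy : (index y i < size i)%N by rewrite index_mem.
have [lti|lti|eqi] := ltngtP (index x i) (index y i).
- by rewrite (sorted_ltn_nth ltn_trans 0%N so') // inE -si.
- by have := sorted_ltn_index ltn_trans so _ _ ly lx lti; rewrite ltnNge (ltnW lt).
- by move: (congr1 (nth 0%N i) eqi) lt; rewrite !nth_index // => ->; rewrite ltnn.
Qed.

Definition relabel_tab i i' T := map (map (relabel i i')) T.

Lemma entry_relabel i i' T p q :
  entry (relabel_tab i i' T) p q = relabel i i' (entry T p q).
Proof.
rewrite /entry; have [ps|ps] := ltnP p (size T); last first.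
  by rewrite !(nth_default [::]) ?size_map //= !nth_nil.
rewrite (nth_map [::]) //; have [qs|qs] := ltnP q (size (nth [::] T p)).
  by rewrite (nth_map 0%N).
by rewrite !(nth_default 0%N) ?size_map //.
Qed.

Lemma legal_entry i T p q : all (all (legal i)) T -> legal i (entry T p q).
Proof.
move=> lT; rewrite /entry; have [ps|ps] := ltnP p (size T); last first.
  by rewrite (nth_default [::]) // nth_nil.
have [qs|qs] := ltnP q (size (nth [::] T p)); last by rewrite nth_default.
exact: (allP (allP lT _ (mem_nth _ ps)) _ (mem_nth _ qs)).
Qed.

(** The tableau conditions only compare entries, so a strictly increasing relabelling preserves
    them. *)
Lemma relabel_comp_tableau i i' b T : sorted ltn i -> sorted ltn i' -> size i = size i' ->
  all (all (legal i)) T -> is_comp_tableau b T -> is_comp_tableau b (relabel_tab i i' T).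
Proof.
move=> so so' si lT /and3P[c1 c2 c3].
have mono x y : legal i x -> legal i y -> (x < y)%N -> (relabel i i' x < relabel i i' y)%N.
  by move=> lx ly; apply: relabel_mono.
apply/and3P; split.
- apply/allP => r /mapP[r0 r0T ->].
  have := allP c1 _ r0T; apply: (homo_sorted_in (P := legal i)); last exact: (allP lT).
  move=> x y lx ly /=; rewrite leq_eqVlt => /orP[/eqP->//|lt].
  by rewrite ltnW // relabel_mono.
- rewrite -map_comp.
  rewrite (_ : map _ _ = map (relabel i i') (map (head 0%N) T)); last first.
    by rewrite -map_comp; apply/eq_map => -[|x r].
  move: c2; apply: (homo_sorted_in (P := legal i)); first exact: relabel_mono.
  apply/allP => x /mapP[r rT ->]; have := allP lT _ rT; case: r {rT} => [|y r] //= /andP[lx _]; exact: lx.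
- apply/allP => p Hp; apply/allP => q Hq; apply/allP => k Hk.
  have := allP (allP (allP c3 _ Hp) _ Hq) _ Hk.
  rewrite !entry_relabel; case: ifP => _.
    have mono' p1 q1 p2 q2 := mono _ _ (legal_entry p1 q1 lT) (legal_entry p2 q2 lT).
    by case/orP => [/orP[->//|/mono' ->]|/mono' ->]; rewrite ?orbT.
  by case/orP => lt; apply/orP; [left|right]; apply: mono => //; apply: legal_entry.
Qed.
Section Relabel.
Variables (n : nat) (a b i i' : seq nat).
Hypotheses (so : sorted ltn i) (so' : sorted ltn i').
Hypotheses (sa : size i = size a) (sa' : size i' = size a).
Hypotheses (ni : all (fun t => t < n)%N i) (ni' : all (fun t => t < n)%N i').

Let si : size i = size i'. Proof. by rewrite sa. Qed.

Lemma mem_tableaux m T : (T \in tableaux b m) =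
  [&& is_comp_tableau b T, tab_weight n T == m & T \in fillings n b].
Proof. by rewrite mem_filter andbA. Qed.

Lemma tableaux_entry (m : 'X_{1..n}) T x : T \in tableaux b m -> x \in flatten T -> (0 < x <= n)%N.
Proof.
rewrite mem_tableaux mem_fillings => /and3P[_ _ /andP[_ /allP aT]] /flattenP[r rT xr].
exact: (allP (aT _ rT)).
Qed.

Lemma count_tableaux (m : 'X_{1..n}) T (j : 'I_n) : T \in tableaux b m -> count_mem j.+1 (flatten T) = m j.
Proof. by rewrite mem_tableaux => /and3P[_ /eqP <- _]; rewrite mnmE. Qed.

Lemma tableaux_legal T : T \in tableaux b (qmono n a i) -> all (all (legal i)) T.
Proof.
move=> TT; apply/allP => r rT; apply/allP => x xr.
have xT : x \in flatten T by apply/flattenP; exists r.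
have := tableaux_entry TT xT; case: x xT {xr} => // x xT /andP[_ xn].
have := count_tableaux (Ordinal xn) TT; rewrite mnmE /= => cx.
rewrite /legal /= -index_mem sa; apply/negPn; rewrite -leqNgt; apply/negP => le.
by move: xT; rewrite -has_pred1 has_count cx nth_default.
Qed.

Lemma relabel_tableaux T : T \in tableaux b (qmono n a i) ->
  relabel_tab i i' T \in tableaux b (qmono n a i').
Proof.
move=> TT; have lT := tableaux_legal TT.
have ui : uniq i by have := so; rewrite ltn_sorted_uniq_leq => /andP[].
have ui' : uniq i' by have := so'; rewrite ltn_sorted_uniq_leq => /andP[].
have lx x : x \in flatten T -> legal i x.
  by case/flattenP => r rT xr; exact: (allP (allP lT _ rT)).
have fE : flatten (relabel_tab i i' T) = map (relabel i i') (flatten T) by rewrite map_flatten.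
have := TT; rewrite !mem_tableaux !mem_fillings => /and3P[cT wT /andP[sT aT]].
apply/and3P; split; first exact: relabel_comp_tableau.
  apply/eqP/mnmP => j; rewrite !mnmE fE count_map.
  have [ji|ji] := boolP (nat_of_ord j \in i'); last first.
    rewrite nth_default; last by rewrite -sa' leqNgt index_mem.
    apply/eqP; rewrite eqn0Ngt -has_count; apply/hasPn => x xT /=.
    have := relabel_legal si (lx x xT); case: (relabel i i' x) => // y /orP[//|/= yi].
    by rewrite eqSS; apply: contra ji => /eqP <-.
  have lj : legal i' j.+1 by rewrite /legal /= ji.
  have jx : (index (nat_of_ord j) i' < size i)%N by rewrite si index_mem.
  have xn : (nth 0%N i (index (nat_of_ord j) i') < n)%N by apply: (allP ni); rewrite mem_nth.
  transitivity (count_mem (Ordinal xn).+1 (flatten T)).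
    apply: eq_in_count => x xT /=; apply/eqP/eqP => [E|->].
      by rewrite -(relabelK ui' si (lx x xT)) E.
    by rewrite (relabelK ui (esym si) lj).
  by rewrite (count_tableaux _ TT) mnmE /= index_uniq.
apply/andP; split.
  rewrite -map_comp -(eqP sT); apply/eqP/eq_map => r /=; exact: size_map.
apply/allP => r /mapP[r0 r0T ->]; apply/allP => x /mapP[y yr ->].
have yT : y \in flatten T by apply/flattenP; exists r0.
have := tableaux_entry TT yT; have := lx y yT.
case: y {yr yT} => // y ly _ /=; apply: (allP ni'); apply: mem_nth.
by rewrite -si index_mem.
Qed.
End Relabel.

Lemma size_tableaux_le n a b i i' : sorted ltn i -> sorted ltn i' ->
  size i = size a -> size i' = size a ->
  all (fun t => t < n)%N i -> all (fun t => t < n)%N i' ->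
  (size (tableaux b (qmono n a i)) <= size (tableaux b (qmono n a i')))%N.
Proof.
move=> so so' sa sa' ni ni'; rewrite -(size_map (relabel_tab i i')); apply: uniq_leq_size.
  rewrite map_inj_in_uniq ?filter_uniq ?uniq_fillings // => T T' TT TT' E.
  have K U : U \in tableaux b (qmono n a i) -> relabel_tab i' i (relabel_tab i i' U) = U.
    move=> /(tableaux_legal sa) lU.
    rewrite /relabel_tab -map_comp -[RHS]map_id; apply/eq_in_map => r rU /=.
    rewrite -map_comp -[RHS]map_id; apply/eq_in_map => x xr /=.
    apply: relabelK; last exact: (allP (allP lU _ rU)).
      by move: so'; rewrite ltn_sorted_uniq_leq => /andP[].
    by rewrite sa.
  by rewrite -(K T TT) E K.
by move=> U /mapP[T TT ->]; apply: relabel_tableaux.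
Qed.

Lemma qsym_qschur n b : qsym (qschur n b).
Proof.
move=> a i ca an so ni si; rewrite !mcoeff_qschur; congr (_%:R).
have so0 : sorted ltn (iota 0 (size a)) by exact: iota_ltn_sorted.
have s0 : size (iota 0 (size a)) = size a by rewrite size_iota.
have n0 : all (fun t => t < n)%N (iota 0 (size a)).
  by apply/allP => t; rewrite mem_iota add0n => /andP[_ ta]; apply: leq_trans an.
by apply/eqP; rewrite eqn_leq !size_tableaux_le.
Qed.

Lemma mcoeff_qschur_neq0 n b m : (qschur n b)@_m != 0 -> exists T, T \in tableaux b m.
Proof.
rewrite mcoeff_qschur; case: (tableaux b m) => [/eqP[] //|T s _].
by exists T; rewrite mem_head.
Qed.

Lemma mdeg_tableaux n b (m : 'X_{1..n}) T : T \in tableaux b m -> mdeg m = sumn b.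
Proof.
move=> TT; have := TT; rewrite mem_tableaux mem_fillings => /and3P[_ _ /andP[/eqP <- _]].
rewrite -size_flatten mdegE (eq_bigr (fun j : 'I_n => count_mem j.+1 (flatten T))); last first.
  by move=> j _; rewrite (count_tableaux _ TT).
have : {subset flatten T <= iota 1 n}.
  by move=> x /(tableaux_entry TT); rewrite mem_iota add1n ltnS.
elim: (flatten T) => [|x s IH] sub; first by rewrite big1.
rewrite /= big_split /= IH; last by move=> y ys; apply: sub; rewrite inE ys orbT.
have := sub x; rewrite mem_head mem_iota add1n ltnS => /(_ isT) /andP[x0 xn].
rewrite -add1n; congr addn; case: x x0 xn {sub} => // x _ xn.
by rewrite (bigD1 (Ordinal xn)) //= eqxx big1 ?addn0 // => j /negbTE; rewrite -val_eqE /= eqSS eq_sym => ->.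
Qed.
End Tableaux.

Section SquareCount.
Variable f : nat -> bool.
Local Notation W N := (\sum_(0 <= k < N) f k)%N.
Local Notation S N := (\sum_(0 <= k < N) f k * (2 * k + 1))%N.

Lemma sum_bool_le N : (W N <= N)%N.
Proof. by elim: N => [|N IH]; [rewrite big_nil|rewrite big_nat_recr //=; case: (f N); lia]. Qed.

Lemma sum_bool_full N k : W N = N -> (k < N)%N -> f k.
Proof.
elim: N => // N IH; rewrite big_nat_recr //= => E; rewrite ltnS leq_eqVlt => /orP[/eqP->|].
  by move: (sum_bool_le N) E; case: (f N) => //=; lia.
by apply: IH; move: (sum_bool_le N) E; case: (f N) => /=; lia.
Qed.

(** [W N ^ 2] is the sum of the first [W N] odd numbers, the least possible for that many distinct
    odd numbers. *)
Lemma sq_sum_bool_le N : (W N ^ 2 <= S N)%N.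
Proof.
elim: N => [|N IH]; first by rewrite !big_nil.
by rewrite !big_nat_recr //= -mulnn; move: IH (sum_bool_le N); rewrite -mulnn; case: (f N) => /=; lia.
Qed.

(* If [f k] marks the columns that contain a given entry, equality means that these are the
   first columns. *)
Lemma sq_sum_bool_eq N k : (W N ^ 2 = S N)%N -> (k.+1 < N)%N -> f k.+1 -> f k.
Proof.
elim: N => // N IH; rewrite !big_nat_recr //= -mulnn ltnS => E; rewrite leq_eqVlt => /orP[/eqP kN|].
  rewrite kN; move: E (sum_bool_le N) (sq_sum_bool_le N); rewrite -mulnn; case: (f N) => //= E le1 le2 _.
  by apply: (@sum_bool_full N); [nia|rewrite -kN].
apply: IH; move: E (sum_bool_le N) (sq_sum_bool_le N); rewrite -mulnn; case: (f N) => /= E le1 le2.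
  nia.
by lia.
Qed.
End SquareCount.

Definition column (T : seq (seq nat)) k := [seq nth 0%N r k | r <- T & (k < size r)%N].

Lemma columnE T k : column T k =
  [seq entry T i k | i <- iota 0 (size T) & (k < size (nth [::] T i))%N].
Proof. by rewrite /column -{1}[T](mkseq_nth [::]) filter_map -map_comp. Qed.

Lemma sum_odd m : (\sum_(0 <= k < m) (2 * k + 1) = m ^ 2)%N.
Proof.
elim: m => [|m IH]; first by rewrite big_nil.
by rewrite big_nat_recr //= IH -!mulnn; lia.
Qed.

Lemma sum_nat_lt m N (F : nat -> nat) : (m <= N)%N ->
  (\sum_(0 <= k < N) (k < m) * F k = \sum_(0 <= k < m) F k)%N.
Proof.
move=> le; rewrite (big_nat_widen 0 m N) // [RHS]big_mkcond /=.
by apply: eq_bigr => k _; case: (k < m)%N; rewrite ?mul1n.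
Qed.

Lemma count_columns T x N : all (fun r => size r <= N)%N T ->
  (count_mem x (flatten T) = \sum_(0 <= k < N) count_mem x (column T k))%N.
Proof.
elim: T => [_|r T IH /= /andP[rN TN]]; first by rewrite big1.
rewrite count_cat IH // [RHS](eq_bigr (fun k => (k < size r) * (nth 0 r k == x) + count_mem x (column T k))%N); last first.
  by move=> k _; rewrite /column /=; case: (k < size r)%N; rewrite /= ?mul1n ?mul0n.
rewrite big_split /=; congr addn; rewrite sum_nat_lt //.
by rewrite -sum1_count (big_nth 0%N) big_mkcond.
Qed.

Lemma sum_columns T N : all (fun r => size r <= N)%N T ->
  (\sum_(0 <= k < N) (2 * k + 1) * size (column T k) = sumsq (map size T))%N.
Proof.
elim: T => [_|r T IH /= /andP[rN TN]]; first by rewrite big1 // => k _; rewrite muln0.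
rewrite sumsq_cons -IH // -sum_odd -(sum_nat_lt _ rN) -big_split /=; apply: eq_bigr => k _.
by rewrite /column /=; case: (k < size r)%N; rewrite /= ?mulnS ?mul1n.
Qed.

Section TableauColumns.
Variables (n : nat) (b : seq nat) (T : seq (seq nat)).
Hypothesis fT : T \in fillings n b.
Hypothesis cT : is_comp_tableau b T.

Let sizeT : map size T = b.
Proof. by move: fT; rewrite mem_fillings => /andP[/eqP]. Qed.

Let sT : size T = size b. Proof. by rewrite -sizeT size_map. Qed.

Lemma size_row i : size (nth [::] T i) = nth 0%N b i.
Proof.
have [iT|iT] := ltnP i (size T); first by rewrite -sizeT (nth_map [::]).
by rewrite !nth_default // -sT.
Qed.

Lemma row_size_pos i k : (k < nth 0%N b i)%N -> (i < size b)%N.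
Proof. by move=> kb; rewrite ltnNge; apply/negP => le; rewrite nth_default in kb. Qed.

Lemma entry_row i k : (k.+1 < nth 0%N b i)%N -> (entry T i k.+1 <= entry T i k)%N.
Proof.
move=> kb; have iT : (i < size T)%N by rewrite sT; apply: row_size_pos kb.
case/and3P: cT => /allP c1 _ _; have /(sortedP 0%N) H := c1 _ (mem_nth [::] iT).
by apply: H; rewrite size_row.
Qed.

Lemma entry_col0 i j : (i < j)%N -> (j < size b)%N -> (entry T i 0 < entry T j 0)%N.
Proof.
move=> ij jb; case/and3P: cT => _ c2 _.
have jT : (j < size T)%N by rewrite sT.
have iT : (i < size T)%N by apply: ltn_trans jT.
have := sorted_ltn_nth ltn_trans 0%N c2 i j; rewrite !inE size_map iT jT => /(_ isT isT ij).
by rewrite !(nth_map [::]) // !/(entry _ _ _) -!nth0.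
Qed.

Lemma triple_rule i j k : (i < j)%N -> (k < nth 0%N b i)%N -> (k < nth 0%N b j)%N ->
  if (nth 0%N b j <= nth 0%N b i)%N then
    (k == 0%N) || (entry T j k < entry T i k)%N || (entry T i k.-1 < entry T j k)%N
  else (entry T j k < entry T i k)%N || (entry T i k < entry T j k.+1)%N.
Proof.
move=> ij ki kj; case/and3P: cT => _ _ c3.
have ib : i \in iota 0 (size b) by rewrite mem_iota add0n (row_size_pos ki).
have jb : j \in iota i.+1 (size b - i.+1).
  by rewrite mem_iota ij subnKC ?(row_size_pos kj) // (row_size_pos ki).
have kb : k \in iota 0 (minn (nth 0%N b i) (nth 0%N b j)).
  by rewrite mem_iota add0n leq_min ki kj.
exact: allP (allP (allP c3 _ ib) _ jb) _ kb.
Qed.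

(** Since rows weakly decrease, each alternative of the triple rule forces a strict inequality
    between the two entries. *)
Lemma entry_col_neq i j k : (i < j)%N -> (k < nth 0%N b i)%N -> (k < nth 0%N b j)%N ->
  entry T i k != entry T j k.
Proof.
move=> ij ki kj; have := triple_rule ij ki kj; case: ifP => [_|/negbT].
  case/orP => [/orP[/eqP k0|lt]|lt].
  - by rewrite k0 neq_ltn entry_col0 // (row_size_pos kj).
  - by rewrite neq_ltn lt orbT.
  case: k ki kj lt => [|k] ki kj lt; first by rewrite neq_ltn lt.
  by rewrite neq_ltn (leq_ltn_trans (entry_row ki) lt).
rewrite -ltnNge => bij /orP[lt|lt]; first by rewrite neq_ltn lt orbT.
by rewrite neq_ltn (leq_trans lt) ?entry_row //; apply: leq_trans bij.
Qed.

Lemma uniq_column k : uniq (column T k).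
Proof.
rewrite columnE map_inj_in_uniq ?filter_uniq ?iota_uniq // => i j.
rewrite !mem_filter !size_row => /andP[ki _] /andP[kj _] E.
have [ij|ij|//] := ltngtP i j.
  by have := entry_col_neq ij ki kj; rewrite E eqxx.
by have := entry_col_neq ij kj ki; rewrite E eqxx.
Qed.

Let N := (sumn b).+1.

Let TN : all (fun r => size r <= N)%N T.
Proof.
apply/allP => r rT; apply: leqW; rewrite -sizeT sumnE big_map.
by rewrite (big_rem r) //= leq_addr.
Qed.

Lemma count_flatten_columns (x : nat) :
  (count_mem x (flatten T) = \sum_(0 <= k < N) (x \in column T k))%N.
Proof.
rewrite (count_columns _ TN); apply: eq_bigr => k _.
by rewrite count_uniq_mem ?uniq_column.
Qed.

Lemma entries_range (x : nat) : x \in flatten T -> x \in iota 1 n.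
Proof.
move: fT; rewrite mem_fillings => /andP[_ /allP aT] /flattenP[r rT xr].
by have := allP (aT _ rT) _ xr; rewrite mem_iota add1n ltnS.
Qed.

Lemma column_entry (x : nat) k : x \in column T k -> x \in flatten T.
Proof.
case/mapP => r; rewrite mem_filter => /andP[kr rT] ->.
by apply/flattenP; exists r => //; apply: mem_nth.
Qed.

(** A cell in column [k] gets weight [2k + 1], so a row of length [r] has weight [r ^ 2]; the left
    side collects the same cells by entry. *)
Lemma sum_columns_entries :
  (\sum_(x <- iota 1 n) \sum_(0 <= k < N) (x \in column T k) * (2 * k + 1) = sumsq b)%N.
Proof.
rewrite exchange_big /= -[in RHS]sizeT -(sum_columns TN); apply: eq_bigr => k _.
rewrite -big_distrl [LHS]mulnC /=; congr muln.
transitivity (count (mem (column T k)) (iota 1 n)).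
  by rewrite -sum1_count [RHS]big_mkcond; apply: eq_bigr => x _ /=; case: (x \in _).
rewrite -size_filter; apply/perm_size/uniq_perm.
- by rewrite filter_uniq ?iota_uniq.
- exact: uniq_column.
move=> x; rewrite mem_filter /=; case: (boolP (x \in column T k)) => //= xc.
exact: entries_range (column_entry xc).
Qed.

Lemma sumsq_count_le :
  (\sum_(x <- iota 1 n) count_mem x (flatten T) ^ 2 <= sumsq b)%N.
Proof.
rewrite -sum_columns_entries; apply: leq_sum => x _.
by rewrite count_flatten_columns sq_sum_bool_le.
Qed.

Hypothesis eqT : (\sum_(x <- iota 1 n) count_mem x (flatten T) ^ 2 = sumsq b)%N.

Lemma column_sub (x : nat) k : x \in column T k.+1 -> x \in column T k.
Proof.
move=> xk; have xn := entries_range (column_entry xk).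
have kN : (k.+1 < N)%N.
  case/mapP: xk => r; rewrite mem_filter => /andP[kr rT] _.
  by apply: leq_trans kr _; apply: (allP TN).
apply: (@sq_sum_bool_eq (fun k => x \in column T k) N) => //.
rewrite -count_flatten_columns; apply/eqP; move: eqT; rewrite -sum_columns_entries => /eqP.
rewrite (bigD1_seq x) ?iota_uniq //= [X in _ == X](bigD1_seq x) ?iota_uniq //=.
set A := (_ ^ 2)%N; set B := (\sum_(_ <- _ | _) _)%N; set C := (\sum_(0 <= _ < _) _)%N; set D := (\sum_(_ <- _ | _) _)%N => E.
have le1 : (A <= C)%N by rewrite /A count_flatten_columns sq_sum_bool_le.
have le2 : (B <= D)%N by apply: leq_sum => y _; rewrite count_flatten_columns sq_sum_bool_le.
by move: E; rewrite !eqn_leq le1 /=; lia.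
Qed.

(** By [column_sub] the entry in column [k + 1] of row [i] also occurs in column [k], in a row [j].
    If [j] is below [i], the increasing first column contradicts the weak decrease of row [i]; if
    [j] is above [i], the triple rule is violated. *)
Lemma row_const i k : (k < nth 0%N b i)%N -> entry T i k = entry T i 0.
Proof.
elim: k i => // k IH i ki; have ki' := ltnW ki.
have iT : (i < size T)%N by rewrite sT; apply: row_size_pos ki.
have : entry T i k.+1 \in column T k.+1.
  rewrite columnE; apply: (map_f (fun i => entry T i k.+1)).
  by rewrite mem_filter size_row ki mem_iota.
move/column_sub; rewrite columnE => /mapP[j]; rewrite mem_filter size_row mem_iota => /andP[kj jT] E.
have [ij|ji|ij] := ltngtP i j; last by rewrite E ij IH.
  have := entry_col0 ij (row_size_pos kj); rewrite -(IH j kj) -(IH i ki') -E ltnNge.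
  by rewrite entry_row.
have := entry_col0 ji (row_size_pos ki); rewrite -(IH j kj) -(IH i ki') => lt.
have [le|gt] := leqP (nth 0%N b i) (nth 0%N b j).
  have kj1 : (k.+1 < nth 0%N b j)%N by apply: leq_trans le.
  have := triple_rule ji kj1 ki; rewrite le /= E ltnn orbF => lt2.
  by have := leq_trans lt2 (entry_row kj1); rewrite ltnn.
have := triple_rule ji kj ki'; rewrite leqNgt gt /= E ltnn orbF.
by rewrite ltnNge (ltnW lt).
Qed.
End TableauColumns.

Lemma constant_rows_count T : uniq (map (head 0%N) T) ->
  all (fun r => r == nseq (size r) (head 0%N r)) T ->
  [seq count_mem y (flatten T) | y <- map (head 0%N) T] = map size T.
Proof.
elim: T => //= r T IH /andP[rT uT] /andP[/eqP rE cT].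
have inT x : x \in flatten T -> x \in map (head 0%N) T.
  case/flattenP => r' r'T; rewrite (eqP (allP cT _ r'T)) mem_nseq => /andP[_ /eqP ->].
  exact: map_f.
congr cons.
  rewrite count_cat {2}rE count_nseq /= eqxx mul1n (count_memPn _) ?addn0 //.
  by apply: contra rT => /inT.
rewrite -IH //; apply/eq_in_map => y yT; rewrite count_cat rE count_nseq /=.
by case: eqP => // yr; rewrite yr yT in rT.
Qed.

Definition std n (a : seq nat) : 'X_{1..n} := qmono n a (iota 0 (size a)).

Lemma stdE n a (j : 'I_n) : std n a j = nth 0%N a j.
Proof.
rewrite mnmE; have [ja|ja] := ltnP j (size a); last first.
  have := index_mem (nat_of_ord j) (iota 0 (size a)); rewrite mem_iota add0n size_iota /= => E.
  by rewrite !nth_default // leqNgt E -leqNgt.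
congr nth; have jE : nth 0%N (iota 0 (size a)) j = j by rewrite nth_iota.
by rewrite -{1}jE index_uniq ?size_iota ?iota_uniq.
Qed.

Lemma sum_iota1 n (F : nat -> nat) : (\sum_(x <- iota 1 n) F x = \sum_(j < n) F j.+1)%N.
Proof. by rewrite -(addn0 1%N) iotaDl big_map -(big_mkord xpredT (fun j => F j.+1)) /index_iota subn0. Qed.

Lemma sumsq_nth n a : (size a <= n)%N -> (\sum_(j < n) nth 0%N a j ^ 2)%N = sumsq a.
Proof.
elim: a n => [|v a IH] [|n] // sa.
- by rewrite big_ord0.
- by rewrite big1 // => j _; rewrite nth_nil.
by rewrite big_ord_recl /= sumsq_cons -(IH n).
Qed.

(** The multiplicities of the entries are the parts of [a]. Equal sums of squares make all rows
    constant, and then the first column must be 1, 2, ..., [size a]. *)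
Lemma tableaux_std n a b T : is_composition a -> is_composition b -> (size a <= n)%N ->
  T \in tableaux b (std n a) -> a = b \/ (sumsq a < sumsq b)%N.
Proof.
move=> ca cb an TT; have := TT; rewrite mem_tableaux => /and3P[cT wT fT].
have cnt (j : 'I_n) : count_mem j.+1 (flatten T) = nth 0%N a j.
  by rewrite (count_tableaux _ TT) stdE.
have sq : (\sum_(x <- iota 1 n) count_mem x (flatten T) ^ 2)%N = sumsq a.
  by rewrite sum_iota1 -(sumsq_nth an); apply: eq_bigr => j _; rewrite cnt.
have := sumsq_count_le fT cT; rewrite sq leq_eqVlt => /orP[/eqP eqab|]; [left|by right].
have eqT := etrans sq eqab.
have := fT; rewrite mem_fillings => /andP[/eqP sT aT].
have rowE r : r \in T -> r = nseq (size r) (head 0%N r).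
  move=> rT; have iT : (index r T < size T)%N by rewrite index_mem.
  have rI : nth [::] T (index r T) = r by apply: nth_index.
  apply: (@eq_from_nth _ 0%N); rewrite ?size_nseq // => k kr.
  rewrite nth_nseq kr -nth0 -rI -![nth 0%N _ _]/(entry _ _ _).
  by apply: (row_const fT cT eqT); rewrite -(size_row fT) rI.
have posr r : r \in T -> (0 < size r)%N.
  by move=> rT; apply: (allP cb); rewrite -sT map_f.
have ysE : map (head 0%N) T = iota 1 (size a).
  case/and3P: cT => _ c2 _.
  apply: (irr_sorted_eq ltn_trans ltnn c2 (iota_ltn_sorted _ _)) => x.
  apply/mapP/idP => [[r rT ->]|].
    have xr : head 0%N r \in r by case: (r) (posr r rT) => //= y s _; rewrite mem_head.
    have xT : head 0%N r \in flatten T by apply/flattenP; exists r.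
    have := tableaux_entry TT xT; move: xT; case: (head 0%N r) => [|y] xT //= yn.
    rewrite mem_iota add1n ltnS /= ltnNge; apply/negP => le.
    move: xT; rewrite -has_pred1 has_count (cnt (Ordinal yn)) /=.
    by rewrite nth_default.
  rewrite mem_iota add1n ltnS; case: x => // y /= ya.
  have yn := leq_trans ya an.
  have : y.+1 \in flatten T.
    by rewrite -has_pred1 has_count (cnt (Ordinal yn)); apply: (allP ca); apply: mem_nth.
  case/flattenP => r rT; rewrite (rowE r rT) mem_nseq => /andP[_ /eqP ->].
  by exists r.
rewrite -sT -constant_rows_count ?ysE ?iota_uniq //; last first.
  by apply/allP => r /rowE {1}->.
apply: (@eq_from_nth _ 0%N); rewrite ?size_map ?size_iota // => i ia.
rewrite (nth_map 0%N) ?size_iota // nth_iota // add1n.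
by rewrite (cnt (Ordinal (leq_trans ia an))).
Qed.

Definition std_tableau (b : seq nat) := [seq nseq (nth 0%N b i) i.+1 | i <- iota 0 (size b)].

Lemma entry_std_tableau b i k : (k < nth 0%N b i)%N -> entry (std_tableau b) i k = i.+1.
Proof.
move=> kb; have ib := row_size_pos kb.
by rewrite /entry (nth_map 0%N) ?size_iota // nth_iota // nth_nseq kb.
Qed.

Lemma std_tableau_mem n b : is_composition b -> (size b <= n)%N ->
  std_tableau b \in tableaux b (std n b).
Proof.
move=> cb bn; rewrite mem_tableaux mem_fillings; apply/and3P; split.
- apply/and3P; split.
  + by apply/allP => r /mapP[i _ ->]; case: (nth _ _ _) => //= l; elim: l => //= l ->; rewrite /geq /= leqnn.
  + rewrite -map_comp (_ : map _ _ = iota 1 (size b)); first exact: iota_ltn_sorted.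
    rewrite -[1%N]/(1 + 0)%N iotaDl; apply/eq_in_map => i; rewrite mem_iota /= add0n => ib.
    have : (0 < nth 0%N b i)%N by apply: (allP cb); apply: mem_nth.
    by case: (nth _ _ _).
  + apply/allP => i _; apply/allP => j; rewrite mem_iota => /andP[ij _].
    apply/allP => k; rewrite mem_iota add0n leq_min => /andP[_ /andP[ki kj]].
    rewrite !(entry_std_tableau ki) !(entry_std_tableau kj); case: (leqP (nth 0%N b j) (nth 0%N b i)) => bij.
      by case: k ki kj => // k ki kj; rewrite entry_std_tableau ?(ltnW ki) //= !ltnS ij orbT.
    by rewrite (entry_std_tableau (leq_ltn_trans ki bij)) !ltnS ij orbT.
- apply/eqP/mnmP => j; rewrite stdE mnmE count_flatten sumnE big_map big_map.
  rewrite (eq_bigr (fun i : nat => ((i == j :> nat) * nth 0 b i))%N); last by move=> i _; rewrite count_nseq.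
  have [jb|jb] := ltnP j (size b).
    rewrite (bigD1_seq (nat_of_ord j)) ?iota_uniq ?mem_iota //= eqxx mul1n big1 ?addn0 //.
    by move=> i /negbTE ->.
  rewrite nth_default // big_seq big1 // => i; rewrite mem_iota add0n /= => ib.
  by rewrite (_ : (i == j :> nat) = false) //; lia.
- apply/andP; split.
    rewrite -map_comp -{3}[b](mkseq_nth 0%N); apply/eqP/eq_map => i /=; exact: size_nseq.
  apply/allP => r /mapP[i]; rewrite mem_iota add0n /= => ib ->; apply/allP => x.
  by rewrite mem_nseq => /andP[_ /eqP ->] /=; apply: leq_trans bn.
Qed.

Lemma qschur_std_neq0 n b : is_composition b -> (size b <= n)%N -> (qschur n b)@_(std n b) != 0.
Proof.
move=> cb bn; rewrite mcoeff_qschur; have := std_tableau_mem cb bn.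
case: (tableaux b _) => // T s _; by rewrite Num.Theory.pnatr_eq0.
Qed.

(** * Generation over the symmetric polynomials *)

Section Strip.
Variable n : nat.
Implicit Types (m : 'X_{1..n}) (a w : seq nat).

Definition strip m := [seq x <- [seq m i | i <- enum 'I_n] | x != 0%N].

Lemma sumn_strip m : sumn (strip m) = mdeg m.
Proof.
rewrite mdegE sumnE -big_enum /= -(big_map (fun i => m i) xpredT id) big_filter big_mkcond /=.
by apply: eq_bigr => x _; case: eqP.
Qed.

Lemma size_strip m : (size (strip m) <= n)%N.
Proof.
rewrite size_filter; apply: leq_trans (count_size _ _) _.
by rewrite size_map size_enum_ord.
Qed.

Lemma strip_composition m : is_composition (strip m).
Proof. by apply/allP => x; rewrite mem_filter lt0n => /andP[]. Qed.

Lemma composition_notin0 a : is_composition a = (0%N \notin a).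
Proof.
apply/idP/idP => [ca|a0]; first by apply/negP => /(allP ca).
by apply/allP => -[|x] // xa; case/negP: a0.
Qed.

Lemma strip_qmono a i : is_composition a -> sorted ltn i -> all (fun t => t < n)%N i ->
  size i = size a -> strip (qmono n a i) = a.
Proof.
move=> ca so ni si; have ui : uniq i by move: so; rewrite ltn_sorted_uniq_leq => /andP[].
rewrite /strip (eq_map (g := fun j : 'I_n => nth 0%N a (index (val j) i))); last by move=> j; rewrite mnmE.
rewrite (map_comp (fun t => nth 0%N a (index t i)) val) val_enum_ord filter_map.
rewrite (eq_filter (a2 := mem i)); last first.
  move=> t /=; have [ti|ti] := boolP (t \in i).
    by rewrite -lt0n; apply: (allP ca); rewrite mem_nth // -si index_mem.
  by rewrite nth_default ?eqxx // -si memNindex.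
rewrite (_ : filter _ _ = i).
  apply: (@eq_from_nth _ 0%N); rewrite ?size_map // => l li.
  by rewrite (nth_map 0%N) // index_uniq.
apply: (irr_sorted_eq ltn_trans ltnn _ so); first exact/sorted_filter/iota_ltn_sorted/ltn_trans.
move=> t; rewrite mem_filter mem_iota add0n /=; case: (boolP (t \in i)) => //= ti.
exact: (allP ni).
Qed.

Lemma strip_std a : is_composition a -> (size a <= n)%N -> strip (std n a) = a.
Proof.
move=> ca an; apply: strip_qmono => //; [exact: iota_ltn_sorted| |exact: size_iota].
by apply/allP => t; rewrite mem_iota add0n => /andP[_ ta]; apply: leq_trans an.
Qed.

Lemma strip_qsym (p : {mpoly rat[n]}) :
  (forall m m', strip m = strip m' -> p@_m = p@_m') -> qsym p.
Proof.
move=> H a i ca an so ni si; apply: H; rewrite strip_qmono //.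
by rewrite -/(std n a) strip_std.
Qed.

Lemma qsym_strip (p : {mpoly rat[n]}) m : qsym p -> p@_m = p@_(std n (strip m)).
Proof.
move=> qp; pose r := [seq j <- enum 'I_n | m j != 0%N].
have sE : strip m = map m r by rewrite /strip filter_map.
have mE : qmono n (strip m) (map val r) = m.
  apply/mnmP => j; rewrite mnmE sE index_map; last exact: val_inj.
  have [jr|jr] := boolP (j \in r).
    by rewrite (nth_map j) ?index_mem // nth_index.
  rewrite nth_default ?size_map ?memNindex //.
  by apply/esym/eqP; move: jr; rewrite mem_filter mem_enum andbT negbK.
rewrite -{1}mE; apply: qp.
- exact: strip_composition.
- exact: size_strip.
- rewrite sorted_map; apply: sorted_filter; first by move=> x y z; apply: ltn_trans.
  by rewrite -sorted_map val_enum_ord iota_ltn_sorted.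
- by apply/allP => _ /mapP[j _ ->] /=.
- by rewrite sE !size_map.
Qed.

Definition monq w : {mpoly rat[n]} :=
  \sum_(m : 'X_{1..n < (sumn w).+1} | strip m == w) 'X_[m].

Lemma mcoeff_monq w m : (monq w)@_m = (strip m == w)%:R.
Proof.
rewrite raddf_sum /=; have [mw|mw] := boolP (strip m == w); last first.
  rewrite big1 // => k /eqP kw; rewrite mcoeffX; case: eqP => // km.
  by rewrite -kw km eqxx in mw.
have dm : (mdeg m < (sumn w).+1)%N by rewrite -sumn_strip (eqP mw).
rewrite (bigD1 (BMultinom dm)) //= mcoeffX eqxx big1 ?addr0 // => k /andP[_ km].
rewrite mcoeffX; case: eqP => // E; case/negP: km; apply/eqP/val_inj; exact: E.
Qed.

Lemma expand_monq (p : {mpoly rat[n]}) (L : seq (seq nat)) : uniq L -> qsym p ->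
  (forall m, p@_m != 0 -> strip m \in L) -> p = \sum_(a <- L) p@_(std n a) *: monq a.
Proof.
move=> uL qp pL; apply/mpolyP => m; rewrite raddf_sum /=.
rewrite (eq_bigr (fun a => if a == strip m then p@_m else 0)); last first.
  move=> a _; rewrite mcoeffZ mcoeff_monq eq_sym; case: eqP => [->|_]; last by rewrite mulr0.
  by rewrite mulr1 -qsym_strip.
have [mL|mL] := boolP (strip m \in L).
  by rewrite (bigD1_seq (strip m)) //= eqxx big1 ?addr0 // => a /negbTE ->.
rewrite big_seq big1; first by apply/eqP/negPn; apply: contra mL; apply: pL.
by move=> a aL; case: eqP => // E; rewrite -E aL in mL.
Qed.

Definition comps d := [seq a <- undup [seq strip m | m : 'X_{1..n < d.+1}] | sumn a == d].

Lemma uniq_comps d : uniq (comps d).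
Proof. by rewrite filter_uniq ?undup_uniq. Qed.

Lemma mem_comps d a : (a \in comps d) = [&& is_composition a, (size a <= n)%N & sumn a == d].
Proof.
rewrite mem_filter andbC mem_undup; apply/andP/and3P => [[/mapP[m _ ->] sd]|[ca an sd]].
  by split=> //; [exact: strip_composition|exact: size_strip].
split=> //; have dm : (mdeg (std n a) < d.+1)%N by rewrite -sumn_strip strip_std // (eqP sd).
apply/mapP; exists (BMultinom dm); first by rewrite mem_enum.
by rewrite /= strip_std.
Qed.

Lemma strip_comps m : strip m \in comps (mdeg m).
Proof. by rewrite mem_comps strip_composition size_strip sumn_strip eqxx. Qed.
End Strip.

(** * The product of an elementary symmetric polynomial and a monomial quasisymmetric polynomial *)

Section Pieri.

Lemma mcoeffXMn n (u m : 'X_{1..n}) (p : {mpoly rat[n]}) :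
  ('X_[u] * p)@_m = if (u <= m)%MM then p@_(m - u) else 0.
Proof.
case: ifP => um; first by rewrite mulrC -{1}(submK um) addmC mcoeffMX.
rewrite mcoeffM big1 // => -[k1 k2] /= /eqP E; rewrite mcoeffX; case: eqP => [ku|_]; last by rewrite mul0r.
have : (u <= m)%MM by rewrite ku [X in (_ <= X)%MM]E lem_addr.
by rewrite um.
Qed.

(* [hit S m w] says that removing the pattern [S] from the exponents [m] leaves [w], up to zeros. *)
Fixpoint hit (S : bitseq) (m w : seq nat) : bool :=
  match S, m with
  | y :: S', x :: m' =>
    [&& (y <= x)%N & if (x - y == 0)%N then hit S' m' w else
       if w is v :: w' then (v == x - y)%N && hit S' m' w' else false]
  | _, _ => w == [::]
  end.

Lemma hitE (I : Type) (r : seq I) (f : I -> bool) (g : I -> nat) w :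
  hit (map f r) (map g r) w =
  all (fun i => f i <= g i)%N r && (filter (fun x => x != 0%N) [seq (g i - f i)%N | i <- r] == w).
Proof.
elim: r w => [|i r IH] w /=; first by rewrite eq_sym.
rewrite -andbA; congr (_ && _); case: (g i - f i)%N => [|d] /=; first exact: IH.
case: w => [|v w]; first by rewrite andbF.
by rewrite IH eqseq_cons eq_sym andbCA.
Qed.

Definition bits n (h : {set 'I_n}) : bitseq := [seq i \in h | i <- enum 'I_n].

Lemma mcoeff_mesym1_monq n (h : {set 'I_n}) m w :
  ('X_[mesym1 h] * monq n w)@_m = (hit (bits h) [seq m i | i <- enum 'I_n] w)%:R.
Proof.
rewrite mcoeffXMn hitE; have -> : (mesym1 h <= m)%MM = all (fun i => (i \in h) <= m i)%N (enum 'I_n).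
  apply/mnm_lepP/allP => H i; first by rewrite -(mnmE (fun i => (i \in h) : nat)).
  by rewrite mnmE; apply: H; rewrite mem_enum.
case: all => //=; rewrite mcoeff_monq /strip; congr ((_ == _)%:R).
by congr filter; apply: eq_map => i; rewrite mnmBE mnmE.
Qed.

Lemma sumb_tuple (V : zmodType) N i (F : bitseq -> V) :
  sumb N i F = \sum_(t : N.-tuple bool | count id t == i) F t.
Proof.
elim: N i F => [|N IH] i F.
  rewrite big_mkcond (big_pred1 [tuple]); last by move=> t; apply/esym/eqP; apply: tuple0.
  by case: i.
pose h (p : bool * N.-tuple bool) := [tuple of p.1 :: p.2].
have hb : bijective h.
  exists (fun t : N.+1.-tuple bool => (thead t, [tuple of behead t])) => [[y t]|t].
    by congr pair; apply: val_inj.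
  by rewrite [RHS]tuple_eta.
rewrite (reindex h) /=; last exact: onW_bij.
rewrite big_mkcond -(pair_bigA _ (fun (y : bool) (t : N.-tuple bool) =>
  if (y + count id t == i)%N then F (y :: t) else 0)) /=.
rewrite big_bool /= -!big_mkcond /=; congr (_ + _); last by rewrite IH.
by case: i => [|i]; [rewrite big_pred0|rewrite IH].
Qed.

Lemma sum_bits (V : zmodType) n k (F : bitseq -> V) :
  \sum_(h : {set 'I_n} | #|h| == k) F (bits h) = sumb n k F.
Proof.
rewrite sumb_tuple.
pose h (t : n.-tuple bool) : {set 'I_n} := [set i | tnth t i].
have hb : bijective h.
  exists (fun s : {set 'I_n} => [tuple i \in s | i < n]) => [t|s].
    by apply: eq_from_tnth => i; rewrite tnth_mktuple inE.
  by apply/setP => i; rewrite inE tnth_mktuple.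
have bitsE t : bits (h t) = t.
  rewrite /bits (eq_map (g := tnth t)); last by move=> i; rewrite inE.
  by rewrite -[RHS]map_tnth_enum.
rewrite (reindex h) /=; last exact: onW_bij.
apply: eq_big => [t|t _]; last by rewrite bitsE.
by rewrite -[in RHS]bitsE count_map enumT cardE /enum_mem size_filter.
Qed.

Lemma count_nil_incs k w : 0%N \notin w -> count_mem [::] (incs k w) = ((k == 0%N) && (w == [::])).
Proof.
case: w => [|v w]; first by case: k.
elim: k => [|k IH] w0; rewrite /= ?count_cat !count_map (eq_count (a2 := pred0)) ?count_pred0 //.
Qed.

Lemma count_cons_mem (u v : nat) a (s : seq (seq nat)) :
  count_mem (u :: a) (map (cons v) s) = ((u == v) * count_mem a s)%N.
Proof.
rewrite count_map; have [->|uv] := eqVneq u v.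
  by rewrite mul1n; apply: eq_count => b /=; rewrite eqseq_cons eqxx.
by rewrite (@eq_count _ _ pred0) ?count_pred0 // => b /=; rewrite eqseq_cons eq_sym (negbTE uv).
Qed.

(** A zero exponent is passed over. A nonzero one is a new entry 1, a raised entry of [w] or an
    unchanged one: the three lists in [incsS]. *)
Lemma sumb_hit k (m w : seq nat) : 0%N \notin w ->
  sumb (size m) k (fun S => (hit S m w)%:R) =
  (count_mem (filter (fun x => x != 0%N) m) (incs k w))%:R :> rat.
Proof.
have scale (c : bool) N i (f : bitseq -> bool) :
    sumb N i (fun S => (c && f S)%:R) = c%:R * sumb N i (fun S => (f S)%:R) :> rat.
  case: c => /=; first by rewrite mul1r.
  by rewrite mul0r sumb_eq0.
elim: m k w => [|x m IH] k w w0.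
  by rewrite /= count_nil_incs //; case: k.
have [x0|x0] := eqVneq x 0%N.
  rewrite [filter _ _]/= x0 /= -IH //; case: k => [|k]; first by rewrite add0r.
  by rewrite [X in X + _]sumb_eq0 ?add0r.
have x1 : (0 < x)%N by rewrite lt0n.
rewrite [filter _ _]/= x0.
case: w w0 => [|v w].
  move=> _; rewrite /= [X in _ + X](_ : _ = 0) ?addr0; last first.
    by apply: sumb_eq0 => S _ _; rewrite subn0 (negbTE x0).
  case: k => [|k]; first by [].
  rewrite x1 /= addn0 eqseq_cons; have [x11|x11] := eqVneq 1%N x.
    rewrite -x11 /=; have := IH k [::] isT; rewrite /= addn0 => <-.
    by apply: eq_sumb.
  rewrite sumb_eq0 // => S _ _; rewrite ifF //; lia.
rewrite inE negb_or => /andP[v0 w0].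
have vw0 : 0%N \notin v :: w by rewrite inE negb_or v0.
have F k' : sumb (size m) k' (fun S => (hit (false :: S) (x :: m) (v :: w))%:R) =
    ((x == v) * count_mem (filter (fun x => x != 0%N) m) (incs k' w))%:R :> rat.
  rewrite natrM -IH // -scale; apply: eq_sumb => S _ _.
  by rewrite /= subn0 (negbTE x0) eq_sym.
case: k => [|k].
  rewrite [sumb _ _ _]/= add0r F /=; congr (_%:R); rewrite -count_cons_mem //.
rewrite incsS !count_cat !count_cons_mem [sumb _ _ _]/= addnA natrD -F; congr (_ + _).
rewrite natrD !natrM -!IH // -!scale -sumbD; apply: eq_sumb => S _ _ /=.
rewrite x1 /=; have [xE|x11] := eqVneq x 1%N.
  rewrite xE subnn eqxx /= (_ : (1 == v.+1)%N = false) ?addr0 //.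
  by rewrite eqSS; move: v0; rewrite eq_sym => /negbTE; rewrite eq_sym.
rewrite add0r ifF; last by lia.
by congr ((_ && _)%:R); lia.
Qed.

Lemma mcoeff_mesym_monq n k w m : 0%N \notin w ->
  (mesym n rat k * monq n w)@_m = (count_mem (strip m) (incs k w))%:R.
Proof.
move=> w0; rewrite mesymE mulr_suml raddf_sum /=.
rewrite (eq_bigr (fun h => (hit (bits h) [seq m i | i <- enum 'I_n] w)%:R)); last first.
  by move=> h _; rewrite mcoeff_mesym1_monq.
rewrite (@sum_bits rat n k (fun S => (hit S [seq m i | i <- enum 'I_n] w)%:R)).
by rewrite /strip -sumb_hit // size_map size_enum_ord.
Qed.
End Pieri.

(** Duality with one vector-valued functional: the rows of the cokernel of the coefficient matrix
    define a [phi] that kills all the combinations. As it vanishes, the cokernel is 0 and the rows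
    of the matrix span. *)
Lemma span_dual (U : lmodType rat) (X : eqType) (L : seq X) (M : X -> U) r (A : 'I_r -> X -> rat) :
  uniq L ->
  (forall phi : X -> 'rV[rat]_(size L), (forall a, a \notin L -> phi a = 0) ->
     (forall i, \sum_(a <- L) A i a *: phi a = 0) -> forall a, a \in L -> phi a = 0) ->
  forall a, a \in L -> exists D : 'I_r -> rat, M a = \sum_i D i *: \sum_(b <- L) A i b *: M b.
Proof.
move=> uL H a aL; have x0 : X := a.
pose K := size L.
pose B := \matrix_(i < r, j < K) A i (nth x0 L j).
pose C := cokermx B.
pose phi x := if insub (index x L) is Some j then row j C else 0 : 'rV[rat]_K.
have phiE (j : 'I_K) : phi (nth x0 L j) = row j C.
  by rewrite /phi index_uniq // valK.
have phi0 : forall a, a \in L -> phi a = 0.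
  apply: H => [x xL|i]; first by rewrite /phi insubF // memNindex // ltnn.
  rewrite (big_nth x0) big_mkord.
  rewrite (eq_bigr (fun j => B i j *: row j C)); last by move=> j _; rewrite phiE mxE.
  transitivity (row i (B *m C)); last by rewrite mulmx_coker row0.
  by rewrite row_mul mulmx_sum_row; apply: eq_bigr => j _; rewrite [row i B _ _]mxE.
have C0 : C = 0.
  apply/row_matrixP => j; rewrite row0 -phiE phi0 //; exact: mem_nth.
have /submxP[D DB] : (1%:M <= B)%MS by rewrite submxE mul1mx -/C C0.
have aK : (index a L < K)%N by rewrite index_mem.
exists (D (Ordinal aK)).
rewrite (eq_bigr (fun i => \sum_(j < K) (D (Ordinal aK) i * B i j) *: M (nth x0 L j))); last first.
  move=> i _; rewrite (big_nth x0) big_mkord scaler_sumr; apply: eq_bigr => j _.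
  by rewrite scalerA mxE.
rewrite exchange_big /= (eq_bigr (fun j => (1%:M (Ordinal aK) j) *: M (nth x0 L j))); last first.
  by move=> j _; rewrite DB mxE scaler_suml.
rewrite (bigD1 (Ordinal aK)) //= mxE eqxx scale1r nth_index // big1 ?addr0 // => j ne.
by rewrite mxE eq_sym (negbTE ne) scale0r.
Qed.

Lemma sum_count_mem (V : zmodType) (X : eqType) (L s : seq X) (F : X -> V) : uniq L ->
  (forall a, a \notin L -> F a = 0) ->
  \sum_(a <- s) F a = \sum_(a <- L) F a *+ count_mem a s.
Proof.
move=> uL F0; elim: s => [|x s IH]; first by rewrite big_nil big1.
rewrite big_cons IH /=; under [RHS]eq_bigr do rewrite mulrnDr.
rewrite big_split /=; congr (_ + _); have [xL|xL] := boolP (x \in L).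
  rewrite (bigD1_seq x) //= eqxx mulr1n big1 ?addr0 // => a ax.
  by rewrite eq_sym (negbTE ax).
rewrite F0 // big_seq big1 // => a aL; case: eqP => // E.
by rewrite E aL in xL.
Qed.

Section Generation.
Variable n : nat.
Implicit Types (p q u : {mpoly rat[n]}).

Definition generated p := exists l : seq ({mpoly rat[n]} * seq nat),
  (forall x, x \in l -> x.1 \is symmetric /\ inB n x.2) /\
  p = \sum_(x <- l) x.1 * qschur n x.2.

Lemma generated0 : generated 0.
Proof. by exists [::]; rewrite big_nil. Qed.

Lemma generatedD p q : generated p -> generated q -> generated (p + q).
Proof.
move=> [l [Hl ->]] [l' [Hl' ->]]; exists (l ++ l'); rewrite big_cat; split=> // x.
by rewrite mem_cat => /orP[/Hl|/Hl'].
Qed.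

Lemma generatedM u p : u \is symmetric -> generated p -> generated (u * p).
Proof.
move=> su [l [Hl ->]]; exists [seq (u * x.1, x.2) | x <- l]; split.
  by move=> _ /mapP[x /Hl[sx bx] ->]; split=> //=; apply: rpredM.
by rewrite big_map mulr_sumr; apply: eq_bigr => x _; rewrite mulrA.
Qed.

Lemma generatedZ (c : rat) p : generated p -> generated (c *: p).
Proof.
move=> gp; rewrite -mul_mpolyC; apply: generatedM gp.
by rewrite -[_%:MP]mulr1 mul_mpolyC rpredZ // rpred1.
Qed.

Lemma generated_sum (I : Type) (r : seq I) (F : I -> {mpoly rat[n]}) :
  (forall i, generated (F i)) -> generated (\sum_(i <- r) F i).
Proof. by move=> H; apply: big_ind => //; [exact: generated0|exact: generatedD]. Qed.

Lemma generated_qschur b : inB n b -> generated (qschur n b).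
Proof.
move=> Bb; exists [:: (1, b)]; rewrite big_seq1 mul1r; split=> // x.
by rewrite inE => /eqP ->; rewrite rpred1.
Qed.

Lemma mcoeff_qschur_mdeg b m : (qschur n b)@_m != 0 -> mdeg m = sumn b.
Proof. by case/mcoeff_qschur_neq0 => T; apply: mdeg_tableaux. Qed.

Lemma size_incs k w (a : seq nat) : a \in incs k w -> (size w <= size a)%N.
Proof.
elim: w k a => [|v w IH] // k; elim: k => [|k IHk] a.
  by case/mapP => u /IH le ->.
rewrite incsS !mem_cat => /or3P[] /mapP[u Hu ->] /=.
- exact: leqW (IHk _ Hu).
- exact: IH Hu.
- exact: IH Hu.
Qed.

Lemma expand_mesym_monq k w d : 0%N \notin w -> (k + sumn w)%N = d ->
  mesym n rat k * monq n w =
  \sum_(a <- comps n d) (count_mem a (incs k w))%:R *: monq n a.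
Proof.
move=> w0 kw; rewrite [LHS](expand_monq (uniq_comps n d)).
- rewrite big_seq [RHS]big_seq; apply: eq_bigr => a; rewrite mem_comps => /and3P[ca an _].
  by rewrite mcoeff_mesym_monq // strip_std.
- apply: strip_qsym => m m' E; by rewrite !mcoeff_mesym_monq // E.
- move=> m; rewrite mcoeff_mesym_monq // => nz; rewrite -kw.
  have h : strip m \in incs k w.
    by rewrite -has_pred1 has_count lt0n; apply: contra nz => /eqP ->.
  by rewrite -(sumn_incs h) sumn_strip strip_comps.
Qed.

Lemma mcoeff_expand d (c : seq nat -> rat) a : a \in comps n d ->
  (\sum_(b <- comps n d) c b *: monq n b)@_(std n a) = c a.
Proof.
move=> ad; have := ad; rewrite mem_comps => /and3P[ca an _].
rewrite raddf_sum (bigD1_seq a) ?uniq_comps //= mcoeffZ mcoeff_monq strip_std // eqxx mulr1.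
rewrite big1 ?addr0 // => b ba; rewrite mcoeffZ mcoeff_monq strip_std //.
by rewrite eq_sym (negbTE ba) mulr0.
Qed.

Lemma expand_qschur b :
  qschur n b = \sum_(a <- comps n (sumn b)) (qschur n b)@_(std n a) *: monq n a.
Proof.
apply: (expand_monq (L := comps n (sumn b)) (uniq_comps n _) (@qsym_qschur n b)) => m /mcoeff_qschur_mdeg <-.
exact: strip_comps.
Qed.

Lemma monq_long a : (n < size a)%N -> monq n a = 0.
Proof.
move=> an; apply/mpolyP => m; rewrite mcoeff_monq mcoeff0; case: eqP => // E.
by have := size_strip m; rewrite E leqNgt an.
Qed.

Section Degree.
Variable d : nat.
Hypothesis IH : forall a, is_composition a -> (sumn a < d)%N -> generated (monq n a).

(** Membership in [inB] is a proposition, so listing the basis elements of a degree uses a classical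
    decision. *)
Definition in_basis b : bool := if excluded_middle_informative (inB n b) then true else false.

Lemma in_basisP b : reflect (inB n b) (in_basis b).
Proof. by rewrite /in_basis; case: excluded_middle_informative => h; constructor. Qed.

Let G := [seq mesym n rat k * monq n w | k <- iota 1 d, w <- comps n (d - k)%N] ++
         [seq qschur n b | b <- comps n d & in_basis b].

Lemma generator_generated g : g \in G -> generated g.
Proof.
rewrite mem_cat => /orP[/allpairsPdep[k [w]]|/mapP[b]].
  rewrite mem_iota mem_comps => -[/andP[k1 kd] /and3P[cw wn /eqP sw] ->].
  by apply: generatedM; [exact: mesym_sym|apply: IH; rewrite // sw; lia].
by rewrite mem_filter => /andP[/in_basisP Bb _] ->; apply: generated_qschur.
Qed.

Lemma generator_expand g : g \in G -> g = \sum_(a <- comps n d) g@_(std n a) *: monq n a.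
Proof.
rewrite mem_cat => /orP[/allpairsPdep[k [w]]|/mapP[b]].
  rewrite mem_iota mem_comps => -[/andP[k1 kd] /and3P[cw wn /eqP sw] ->].
  have w0 : 0%N \notin w by rewrite -composition_notin0.
  have kw : (k + sumn w)%N = d by rewrite sw; lia.
  rewrite {1}(expand_mesym_monq w0 kw) big_seq [RHS]big_seq; apply: eq_bigr => a ad.
  by rewrite (expand_mesym_monq w0 kw) (mcoeff_expand _ ad).
rewrite mem_filter mem_comps => /andP[_ /and3P[_ _ /eqP <-]] ->.
exact: expand_qschur.
Qed.

Lemma generators_separate (V : lmodType rat) (phi : seq nat -> V) :
  (forall a, a \notin comps n d -> phi a = 0) ->
  (forall g, g \in G -> \sum_(a <- comps n d) g@_(std n a) *: phi a = 0) ->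
  forall a, a \in comps n d -> phi a = 0.
Proof.
move=> phi0 H a; rewrite mem_comps composition_notin0 => /and3P[a0 _ /eqP sa].
apply: (@compositions_vanish V n d phi) => // {a a0 sa}.
- move=> k w k0 w0 kw; have [wn|nw] := leqP (size w) n; last first.
    rewrite big_seq big1 // => a /size_incs wa; apply: phi0.
    by rewrite mem_comps leqNgt (leq_trans nw wa) andbF.
  have gG : mesym n rat k * monq n w \in G.
    rewrite mem_cat; apply/orP; left; apply/allpairsPdep; exists k, w.
    rewrite mem_iota mem_comps composition_notin0 w0 wn /=; split=> //; lia.
  rewrite -[RHS](H _ gG) (expand_mesym_monq w0 kw) big_seq [RHS]big_seq.
  rewrite [RHS](eq_bigr (fun a => phi a *+ count_mem a (incs k w))); last first.
    by move=> a ad; rewrite (mcoeff_expand _ ad) scaler_nat.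
  rewrite -!big_seq; exact: sum_count_mem (uniq_comps n d) phi0.
- move=> b Bb sb Hb; have [cb bn _ _] := Bb.
  have bd : b \in comps n d by rewrite mem_comps cb bn sb eqxx.
  have gG : qschur n b \in G.
    rewrite mem_cat; apply/orP; right; apply/mapP; exists b => //.
    by rewrite mem_filter bd andbT; apply/in_basisP.
  have := H _ gG; rewrite (bigD1_seq b) ?uniq_comps //= big_seq_cond big1 ?addr0.
    by move/eqP; rewrite scaler_eq0 (negbTE (qschur_std_neq0 cb bn)) => /eqP.
  move=> a /andP[ad ab]; have := ad; rewrite mem_comps => /and3P[ca an /eqP sa].
  have [->|nz] := eqVneq ((qschur n b)@_(std n a)) 0; first by rewrite scale0r.
  case: (mcoeff_qschur_neq0 nz) => T /(tableaux_std ca cb an) [E|lt].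
    by rewrite E eqxx in ab.
  by rewrite Hb ?scaler0 // -composition_notin0.
- by move=> a an; apply: phi0; rewrite mem_comps leqNgt an andbF.
Qed.

Lemma generated_monq_degree a : a \in comps n d -> generated (monq n a).
Proof.
move=> ad.
pose A (i : 'I_(size G)) a := (nth 0 G i)@_(std n a).
have [D ->] := @span_dual _ _ (comps n d) (monq n) _ A (uniq_comps n d) ltac:(move=> phi phi0 H;
  apply: generators_separate => // g /(nthP 0)[i iG <-]; exact: (H (Ordinal iG))) a ad.
apply: generated_sum => i; apply: generatedZ.
by rewrite -generator_expand ?mem_nth //; apply: generator_generated; apply: mem_nth.
Qed.
End Degree.

Lemma generated_monq a : is_composition a -> generated (monq n a).
Proof.
have [d] := ubnP (sumn a); elim: d a => // d IH a lt ca.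
have [an|an] := leqP (size a) n; last by rewrite monq_long //; exact: generated0.
apply: (@generated_monq_degree (sumn a)); last by rewrite mem_comps ca an eqxx.
by move=> b cb lt'; apply: IH => //; apply: leq_trans lt' lt.
Qed.

Lemma generated_qsym p : qsym p -> generated p.
Proof.
move=> qp; pose L := undup [seq strip m | m <- msupp p].
rewrite (expand_monq (L := L) _ qp) ?undup_uniq //; last first.
  by move=> m nz; rewrite mem_undup map_f // mcoeff_msupp.
rewrite big_seq; apply: (big_ind generated) => [||a]; [exact: generated0|exact: generatedD|].
rewrite mem_undup => /mapP[m _ ->]; apply/generatedZ/generated_monq/strip_composition.
Qed.
End Generation.

(** * Counting *)

Section Ranks.
Implicit Types (a b e : seq nat) (p q r : nat).

(* Positions are ordered by decreasing value, equal values from right to left. *)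
Definition before a q p := (nth 0%N a p < nth 0%N a q)%N || (nth 0%N a q == nth 0%N a p) && (p < q)%N.

Definition rank a p := count (fun q => before a q p) (iota 0 (size a)).

Lemma before_irr a p : before a p p = false.
Proof. by rewrite /before !ltnn andbF. Qed.

Lemma before_trans a q p r : before a p q -> before a q r -> before a p r.
Proof. by rewrite /before => /orP[|/andP[]] H1; [|move: H1 => /eqP H1 H1']; move=> /orP[|/andP[/eqP]]; lia. Qed.

Lemma before_total a p q : p != q -> before a p q || before a q p.
Proof. rewrite /before; lia. Qed.

Lemma count_ltn (T : eqType) (P Q : pred T) (s : seq T) x : subpred P Q -> x \in s -> Q x -> ~~ P x ->
  (count P s < count Q s)%N.
Proof.
move=> PQ; elim: s => //= y s IH; rewrite inE => /orP[/eqP <-|xs] Qx Px.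
  by rewrite Qx (negbTE Px) add1n add0n ltnS sub_count.
by rewrite -addnS leq_add ?IH //; case: (P y) (PQ y) => // ->.
Qed.

Lemma rank_ltn a p q : (q < size a)%N -> before a q p -> (rank a q < rank a p)%N.
Proof.
move=> qa qp; apply: (@count_ltn _ _ _ _ q) => //; last by rewrite before_irr.
- by move=> r /= rq; apply: before_trans rq qp.
- by rewrite mem_iota.
Qed.

Lemma rank_size a p : (p < size a)%N -> (rank a p < size a)%N.
Proof.
move=> pa; rewrite -[X in (_ < X)%N](size_iota 0) -count_predT.
by apply: (@count_ltn _ _ _ _ p) => //; [rewrite mem_iota|rewrite before_irr].
Qed.

Lemma rank_perm a : perm_eq [seq rank a p | p <- iota 0 (size a)] (iota 0 (size a)).
Proof.
have U : uniq [seq rank a p | p <- iota 0 (size a)].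
  rewrite map_inj_in_uniq ?iota_uniq // => p q; rewrite !mem_iota !add0n /= => pa qa E.
  apply/eqP/negPn/negP => /(before_total a) /orP[] /rank_ltn; rewrite ?pa ?qa E ltnn => H;
    by have := H isT.
have S : {subset [seq rank a p | p <- iota 0 (size a)] <= iota 0 (size a)}.
  by move=> r /mapP[p]; rewrite !mem_iota !add0n /= => pa ->; apply: rank_size.
apply: uniq_perm => //; first exact: iota_uniq.
by have [|] := uniq_min_size U S; rewrite ?size_map.
Qed.

(* The list [e] holds the multiplicities of the parts [size e], ..., 2, 1 of a partition;
   [part e r] is its part number [r], counted from 0. *)
Definition part e r := sumn (take (size e - r) e).

Definition weight e := (\sum_(0 <= r < size e) part e r)%N.

(** The parts are added along the order [before], the largest first. This keeps the order unchanged,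
    and an inverting [b] can be recovered from its order. *)
Definition add_partition e b := [seq (nth 0 b p + part e (rank b p))%N | p <- iota 0 (size b)].

Lemma part_leq e r q : (r <= q)%N -> (part e q <= part e r)%N.
Proof.
move=> rq; rewrite /part -(cat_take_drop (size e - q) (take (size e - r) e)) sumn_cat.
by rewrite take_takel ?leq_addr // leq_sub2l.
Qed.

Lemma part_cons k e r : (r <= size e)%N -> part (k :: e) r = (k + part e r)%N.
Proof. by move=> re; rewrite /part /= subSn. Qed.

Lemma part_size e : part e (size e) = 0%N.
Proof. by rewrite /part subnn take0. Qed.

Lemma weight_cons k e : weight (k :: e) = (k * (size e).+1 + weight e)%N.
Proof.
rewrite /weight /= big_nat (eq_bigr (fun r => k + part e r)%N); last first.
  by move=> r; rewrite ltnS => /andP[_ /part_cons ->].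
rewrite -big_nat big_split /= sum_nat_const_nat subn0 mulnC; congr addn.
by rewrite big_nat_recr //= part_size addn0.
Qed.

Lemma part_inj e e' : size e = size e' -> (forall r, (r < size e)%N -> part e r = part e' r) ->
  e = e'.
Proof.
elim: e e' => [|k e IH] [|k' e'] //= [se] H.
have kk : k = k'.
  by have := H (size e) (leqnn _); rewrite !part_cons ?se // -se part_size se part_size !addn0.
rewrite -kk (IH e') // => r re; apply: (@addnI k).
by have := H r (leqW re); rewrite !part_cons -?se ?(ltnW re) // kk.
Qed.

Lemma size_add_partition e b : size (add_partition e b) = size b.
Proof. by rewrite size_map size_iota. Qed.

Lemma nth_add_partition e b p : (p < size b)%N ->
  nth 0%N (add_partition e b) p = (nth 0 b p + part e (rank b p))%N.
Proof. by move=> pb; rewrite (nth_map 0%N) ?size_iota // nth_iota. Qed.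

Lemma before_add_partition e b p q : (p < size b)%N -> (q < size b)%N ->
  before (add_partition e b) q p = before b q p.
Proof.
have D i j : (i < size b)%N -> (j < size b)%N -> before b i j -> before (add_partition e b) i j.
  move=> ib jb ij; have := part_leq e (ltnW (rank_ltn ib ij)).
  by move: ij; rewrite /before !nth_add_partition //; lia.
move=> pb qb; apply/idP/idP => [H|]; last exact: D.
have [E|ne] := eqVneq q p; first by move: H; rewrite E before_irr.
case/orP: (before_total b ne) => // /(D _ _ pb qb) H'.
by have := before_trans H H'; rewrite before_irr.
Qed.

Lemma sumn_add_partition e b : size e = size b ->
  sumn (add_partition e b) = (weight e + sumn b)%N.
Proof.
move=> eb; rewrite sumnE big_map big_split /= addnC; congr addn.
  rewrite -(big_map (rank b) xpredT (part e)) (perm_big _ (rank_perm b)) -eb.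
  by rewrite /weight /index_iota subn0.
by rewrite sumnE [RHS](big_nth 0%N) /index_iota subn0.
Qed.

Lemma inverting_step b v p : inverting b -> (p < size b)%N -> nth 0%N b p = v.+2 ->
  exists s t, [/\ (s < t)%N, (t < size b)%N, nth 0%N b s = v.+2 & nth 0%N b t = v.+1].
Proof.
move=> ib pb pv; apply: (ib v.+2) => //; rewrite -pv.
exact: (leq_bigmax_seq (F := id) _ (mem_nth 0%N pb) isT).
Qed.

Lemma inverting_before_leq b b' : inverting b -> 0%N \notin b' -> size b = size b' ->
  (forall p q, (p < size b)%N -> (q < size b)%N -> before b q p = before b' q p) ->
  forall p, (p < size b)%N -> (nth 0 b p <= nth 0 b' p)%N.
Proof.
move=> ib b0 sb H p; have [v] := ubnP (nth 0%N b p); elim: v p => // v IH p lt pb.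
case Ep : (nth 0%N b p) lt => [|[|w]] // lt.
  by rewrite lt0n; apply: contra b0 => /eqP <-; rewrite mem_nth -?sb.
have [s [t [st tb Es Et]]] := inverting_step ib pb Ep.
have sb' : (s < size b)%N by apply: ltn_trans tb.
have tle : (w.+1 <= nth 0 b' t)%N by rewrite -Et; apply: IH => //; rewrite Et.
rewrite ltnNge; apply/negP => ple.
have Hpt : before b' p t by rewrite -H // /before Ep Et ltnSn.
have Hst : before b' s t by rewrite -H // /before Es Et ltnSn.
have tp : (t < p)%N by move: Hpt; rewrite /before; lia.
have Hps : before b' p s by rewrite -H // /before Ep Es eqxx (ltn_trans st tp) orbT.
by move: Hst Hps; rewrite /before; lia.
Qed.

Lemma inverting_before_inj b b' : inverting b -> inverting b' -> 0%N \notin b -> 0%N \notin b' ->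
  size b = size b' ->
  (forall p q, (p < size b)%N -> (q < size b)%N -> before b q p = before b' q p) -> b = b'.
Proof.
move=> ib ib' b0 b0' sb H; apply: (@eq_from_nth _ 0%N) => // p pb.
apply/eqP; rewrite eqn_leq (inverting_before_leq ib) //=.
by apply: (inverting_before_leq ib') => //; rewrite -?sb // => p' q' pb' qb'; rewrite H.
Qed.

Lemma add_partition_inj e e' b b' : inverting b -> inverting b' -> 0%N \notin b -> 0%N \notin b' ->
  size e = size b -> size e' = size b' -> add_partition e b = add_partition e' b' ->
  e = e' /\ b = b'.
Proof.
move=> ib ib' b0 b0' se se' E.
have sb : size b = size b' by rewrite -(size_add_partition e) E size_add_partition.
have bb : b = b'.
  apply: inverting_before_inj => // p q pb qb.
  by rewrite -(before_add_partition e) // E before_add_partition -?sb.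
split=> //; rewrite -bb in E se'; apply: part_inj => [|r]; first by rewrite se.
rewrite se => rb; have : r \in [seq rank b p | p <- iota 0 (size b)].
  by rewrite (perm_mem (rank_perm b)) mem_iota.
case/mapP => p; rewrite mem_iota add0n /= => pb ->; apply: (@addnI (nth 0%N b p)).
by rewrite -!nth_add_partition // E.
Qed.
End Ranks.

(** * The injection of pairs of a partition and a basis element into compositions *)

Section Embedding.
Implicit Types (a b e : seq nat).

Lemma mem1_inverting b y : inverting b -> 0%N \notin b -> y \in b -> 1%N \in b.
Proof.
move=> ib b0 yb; have yM : (y <= \max_(x <- b) x)%N by exact: (leq_bigmax_seq (F := id) _ yb isT).
have [M1|M1] := ltnP 1 (\max_(x <- b) x).
  have [s [t [_ tb _ E]]] := ib 2%N isT M1.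
  by have := mem_nth 0%N tb; rewrite E.
have := leq_trans yM M1; case: y yb {yM} => [|[|y]] // yb.
by case/negP: b0.
Qed.

(** The old pairs move up by one value, and a raised letter 1 of [b] followed by one of the new
    letters 1 is a pair for the value 2. *)
Lemma inverting_shift b j : inverting b -> 0%N \notin b -> (0 < j)%N ->
  inverting (map S b ++ nseq j 1%N).
Proof.
move=> ib b0 j0 i i1 iM.
have : has (leq i) (map S b ++ nseq j 1%N).
  apply: contraLR iM => /hasPn H; rewrite -ltnNge -(ltn_predK i1) ltnS.
  by apply/bigmax_leqP_seq => x /H xi _; rewrite -ltnS (ltn_predK i1) ltnNge.
case/hasP => x; rewrite mem_cat => /orP[/mapP[y yb ->]|]; last first.
  by rewrite mem_nseq => /andP[_ /eqP ->] /=; rewrite leqNgt i1.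
rewrite /=; case: i i1 {iM} => [|[|[|i]]] // _ iy.
  have b1 := mem1_inverting ib b0 yb.
  exists (index 1%N b), (size b); rewrite index_mem b1 size_cat size_map size_nseq; split=> //.
  - by rewrite -[X in (X < _)%N]addn0 ltn_add2l.
  - by rewrite nth_cat size_map index_mem b1 (nth_map 0%N) ?index_mem // nth_index.
  - by rewrite nth_cat size_map ltnn subnn nth_nseq j0.
have iM : (i.+2 <= \max_(x <- b) x)%N.
  by apply: leq_trans (leq_bigmax_seq (F := id) _ yb isT).
have [s [t [st tb Es Et]]] := ib i.+2 isT iM.
have sb := ltn_trans st tb.
exists s, t; rewrite size_cat size_map !nth_cat size_map sb tb !(nth_map 0%N) // Es Et; split=> //.
exact: ltn_addr.
Qed.

(** The new final block raises the maximal number of blocks by one and so changes its parity. *)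
Lemma pure_shift b j : pure b -> 0%N \notin b -> (0 < j)%N -> ~ pure (map S b ++ nseq j 1%N).
Proof.
move=> [k [Fk Mk ek]] b0 j0 [k' [Fk' Mk' ek']].
have kk' := Mk' _ (factors_with_shift j0 b0 Fk).
case: k' kk' Fk' {Mk'} ek' => // k' kk' Fk' ek'.
have n0 : 0%N \notin map S b ++ nseq j 1%N.
  rewrite mem_cat mem_nseq andbF orbF; by apply/negP => /mapP[].
have [w [m [m0 w0 E Fw]]] := factors_withS n0 Fk'.
have bw := shift_inj b0 w0 E.
have := Mk k'; rewrite bw => /(_ Fw) k'k.
have kE : k = k' by apply/eqP; rewrite eqn_leq k'k andbT -ltnS.
by move: ek'; rewrite -kE /= ek.
Qed.

(* If [b] is shorter than [n] and the largest part [n] occurs, one copy of it is spent on turning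
   [b] into an inverting composition of length [n]; that one is not pure, so no pair is hit
   twice. *)
Fixpoint embed e b : seq nat :=
  if size b == size e then add_partition e b
  else if e is k :: e' then
    if k is k'.+1 then add_partition (k' :: e') (map S b ++ nseq (size e - size b) 1%N)
    else embed e' b
  else [::].

Lemma size_shift b j : (size b <= j)%N -> size (map S b ++ nseq (j - size b) 1%N) = j.
Proof. by move=> bj; rewrite size_cat size_map size_nseq subnKC. Qed.

Lemma size_embed e b : (size b <= size e)%N -> (size (embed e b) <= size e)%N.
Proof.
elim: e => [|k e IH] be; rewrite [embed _ _]/=; case: eqP => [E|ne]; rewrite ?size_add_partition ?E //.
have be' : (size b <= size e)%N by move: be ne => /=; lia.
case: k be {ne} => [|k] be; first by apply: leq_trans (IH be') _.
by rewrite size_add_partition size_shift.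
Qed.

(** Giving up one part equal to [size e] pays for raising the [size b] entries and appending
    [size e - size b] ones. *)
Lemma sumn_embed e b : (size b <= size e)%N -> sumn (embed e b) = (weight e + sumn b)%N.
Proof.
elim: e => [|k e IH] be; rewrite [embed _ _]/=; case: eqP => [E|ne]; rewrite ?sumn_add_partition ?E //.
  by case: (b) be ne.
have be' : (size b <= size e)%N by move: be ne => /=; lia.
case: k be {ne} => [|k] be; first by rewrite IH // weight_cons mul0n.
rewrite sumn_add_partition ?size_shift // sumn_cat sumn_nseq !weight_cons.
have -> : sumn (map S b) = (sumn b + size b)%N by elim: (b) => //= x s ->; lia.
by move: be => /=; lia.
Qed.

Lemma add_partition_composition e b : is_composition b -> is_composition (add_partition e b).
Proof.
move=> cb; apply/allP => x /mapP[p]; rewrite mem_iota add0n /= => pb ->.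
by rewrite ltn_addr //; apply: (allP cb); apply: mem_nth.
Qed.

Lemma shift_composition b j : is_composition (map S b ++ nseq j 1%N).
Proof. by rewrite /is_composition all_cat all_map all_nseq orbT andbT; apply/allP. Qed.

Lemma embed_composition e b : is_composition b -> is_composition (embed e b).
Proof.
move=> cb; elim: e => [|k e IH]; rewrite [embed _ _]/=; case: eqP => _ //;
  try exact: add_partition_composition.
by case: k => // k; apply/add_partition_composition/shift_composition.
Qed.

Lemma embed_inj e e' b b' : size e = size e' -> inB (size e) b -> inB (size e') b' ->
  embed e b = embed e' b' -> e = e' /\ b = b'.
Proof.
elim: e e' => [|k e IH] [|k' e'] //.
  by move=> _ [_ sb _ _] [_ sb' _ _] _; split=> //; case: b sb => //; case: b' sb'.
move=> /= [se] [cb sb ib pb] [cb' sb' ib' pb'].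
have b0 : 0%N \notin b by rewrite -composition_notin0.
have b0' : 0%N \notin b' by rewrite -composition_notin0.
have shift0 w j : 0%N \notin map S w ++ nseq j 1%N.
  by rewrite -composition_notin0 shift_composition.
rewrite -se; case: eqP => [E|ne]; case: eqP => [E'|ne'].
- by move=> H; apply: (add_partition_inj ib ib' b0 b0' _ _ H); rewrite /= ?E ?E' ?se.
- have j0 : (0 < (size e).+1 - size b')%N by move: sb' ne'; rewrite -se; lia.
  case: k' => [|k'].
    move/(congr1 size); rewrite size_add_partition E => H.
    have : (size (embed e' b') <= size e')%N by apply: size_embed; move: sb' ne'; lia.
    by rewrite -H se ltnn.
  move=> H; have [||||||_ bE] := add_partition_inj _ _ _ _ _ _ H => //.
  + exact: inverting_shift.
  + by rewrite size_shift //; rewrite /= -?se // se.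
  + by case: (pure_shift pb' b0' j0); rewrite -bE.
- have j0 : (0 < (size e).+1 - size b)%N by move: sb ne; lia.
  case: k => [|k].
    move/(congr1 size); rewrite size_add_partition E' => H.
    have : (size (embed e b) <= size e)%N by apply: size_embed; move: sb ne; lia.
    by rewrite H ltnn.
  move=> H; have [||||||_ bE] := add_partition_inj _ _ _ _ _ _ H => //.
  + exact: inverting_shift.
  + by rewrite size_shift.
  + by rewrite E' /= se.
  + by case: (pure_shift pb b0 j0); rewrite bE.
- have j0 : (0 < (size e).+1 - size b)%N by move: sb ne; lia.
  have j0' : (0 < (size e).+1 - size b')%N by move: sb' ne'; lia.
  have be : (size b <= size e)%N by move: sb ne; lia.
  have be' : (size b' <= size e')%N by move: sb' ne'; lia.
  have le := size_embed be; have le' := size_embed be'.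
  case: k k' => [|k] [|k'].
  + have Bb : inB (size e) b by split.
    have Bb' : inB (size e') b' by split.
    by move=> H; have [-> ->] := IH e' se Bb Bb' H.
  + move/(congr1 size); rewrite size_add_partition size_shift ?(leqW be') ?se ?(leqW be') //.
    by move=> H; move: le; rewrite H se ltnn.
  + move/(congr1 size); rewrite size_add_partition size_shift ?(leqW be) // => H.
    by move: le'; rewrite -H se ltnn.
  move=> H; have [||||||[-> ->] bE] := add_partition_inj _ _ _ _ _ _ H => //.
  + exact: inverting_shift.
  + exact: inverting_shift.
  + by rewrite size_shift // leqW.
  + by rewrite size_shift //= ?se // leqW.
  + by split=> //; apply: shift_inj bE.
Qed.
End Embedding.

(** * Linear independence and the coefficient functionals *)

Section Functional.
Variable n : nat.
Implicit Types (m : 'X_{1..n}) (b : seq nat) (p t u : {mpoly rat[n]}).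

Let S := [tuple mesym n rat i.+1 | i < n].

(** Reversed because [part] reads the multiplicity of the largest part first. *)
Definition exponents m : seq nat := rev [seq m i | i <- enum 'I_n].

Lemma size_exponents m : size (exponents m) = n.
Proof. by rewrite size_rev size_map size_enum_ord. Qed.

Lemma exponents_inj : injective exponents.
Proof.
move=> m m' /(can_inj revK) E; apply/mnmP => i.
by move/eq_in_map: E; apply; rewrite mem_enum.
Qed.

Lemma weight_rev (s : seq nat) : weight (rev s) = (\sum_(0 <= i < size s) nth 0 s i * i.+1)%N.
Proof.
elim/last_ind: s => [|s x IH]; first by rewrite /weight !big_nil.
rewrite rev_rcons weight_cons size_rev IH size_rcons big_nat_recr //= nth_rcons ltnn eqxx addnC.
by congr addn; apply: eq_big_nat => i /andP[_ il]; rewrite nth_rcons il.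
Qed.

Lemma weight_exponents m : weight (exponents m) = mnmwgt m.
Proof.
rewrite weight_rev size_map size_enum_ord big_mkord /mnmwgt; apply: eq_bigr => i _.
by rewrite (nth_map i) ?size_enum_ord // nth_ord_enum.
Qed.

(* The pair [(m, b)] stands for the product of [qschur n b] and the elementary symmetric polynomials
   with multiplicities [m]; its degree is [mnmwgt m + sumn b]. *)
Definition pairs d := undup [seq x <- [seq (bmnm k, b) | k <- enum {: 'X_{1..n < d.+1}},
    b <- flatten [seq comps n j | j <- iota 0 d.+1]] |
  in_basis n x.2 && (mnmwgt x.1 + sumn x.2 == d)%N].

Lemma mem_pairs d m b : reflect (inB n b /\ (mnmwgt m + sumn b)%N = d) ((m, b) \in pairs d).
Proof.
rewrite mem_undup mem_filter; apply: (iffP andP) => [[/andP[/in_basisP Bb /eqP E] _]|[Bb E]].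
  by [].
split; first by rewrite /= E eqxx andbT; apply/in_basisP.
have dm : (mdeg m < d.+1)%N.
  by rewrite ltnS -E (leq_trans (leq_mdeg_mnmwgt m)) // leq_addr.
have [cb bn _ _] := Bb.
apply/allpairsP; exists (BMultinom dm, b); split=> //; first by rewrite mem_enum.
apply/flattenP; exists (comps n (sumn b)); last by rewrite mem_comps cb bn eqxx.
by apply: map_f; rewrite mem_iota add0n ltnS -E leq_addl.
Qed.

Lemma size_pairs d : (size (pairs d) <= size (comps n d))%N.
Proof.
rewrite -(size_map (fun x => embed (exponents x.1) x.2)); apply: uniq_leq_size.
  rewrite map_inj_in_uniq ?undup_uniq // => -[m b] [m' b'] /mem_pairs[Bb _] /mem_pairs[Bb' _] /= E.
  have := embed_inj _ _ _ E; rewrite !size_exponents => /(_ erefl Bb Bb')[/exponents_inj -> ->].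
  by [].
move=> a /mapP[[m b] /mem_pairs[Bb wd] ->] /=; have [cb bn _ _] := Bb.
rewrite mem_comps embed_composition //= sumn_embed ?size_exponents //.
rewrite weight_exponents wd eqxx andbT -[X in (_ <= X)%N](size_exponents m).
by apply: size_embed; rewrite size_exponents.
Qed.

Lemma qschur_homog b : qschur n b \is (sumn b).-homog.
Proof.
by apply/dhomogP => m; rewrite mcoeff_msupp; apply: mcoeff_qschur_mdeg.
Qed.

Section Degree.
Variable d : nat.
Let K := size (comps n d).
Let P := size (pairs d).

Definition coords p : 'rV[rat]_K := \row_j p@_(std n (nth [::] (comps n d) j)).

Lemma coords_linear : linear coords.
Proof. by move=> c p q; apply/rowP => j; rewrite !mxE mcoeffD mcoeffZ. Qed.

HB.instance Definition _ := GRing.isLinear.Build rat {mpoly rat[n]} 'rV[rat]_K _ coords coords_linear.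

Definition basis_mx : 'M[rat]_(P, K) := \matrix_i
  coords (('X_[(nth (0%MM, [::]) (pairs d) i).1] \mPo S) * qschur n (nth (0%MM, [::]) (pairs d) i).2).

Lemma coords_degree m b : (mnmwgt m + sumn b)%N != d ->
  coords (('X_[m] \mPo S) * qschur n b) = 0.
Proof.
move=> ne; apply/rowP => j; rewrite !mxE; apply: (dhomog_nemf_coeff (d := (mnmwgt m + sumn b)%N) (mf := mdeg)).
  exact: dhomogM (dhomog_XS _ _) (qschur_homog b).
have := mem_nth [::] (ltn_ord j); rewrite mem_comps => /and3P[ca an /eqP sa].
by rewrite /= -sumn_strip strip_std // sa eq_sym.
Qed.

Lemma coords_row m b (mb : (m, b) \in pairs d) :
  exists2 i : 'I_P, nth (0%MM, [::]) (pairs d) i = (m, b) & coords (('X_[m] \mPo S) * qschur n b) = row i basis_mx.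
Proof.
have iP : (index (m, b) (pairs d) < P)%N by rewrite index_mem.
exists (Ordinal iP); first by rewrite nth_index.
by rewrite rowK /= nth_index.
Qed.

Lemma coords_generated p : generated p -> (coords p <= basis_mx)%MS.
Proof.
case=> l [Hl ->]; rewrite linear_sum big_seq; apply: summx_sub => -[u b] /Hl[/= su Bb].
have [t [<- _]] := sym_fundamental su.
rewrite comp_mpolyEX mulr_suml linear_sum; apply: summx_sub => m _.
rewrite -scalerAl linearZ /=; apply: scalemx_sub.
have [E|ne] := eqVneq (mnmwgt m + sumn b)%N d; last by rewrite coords_degree // sub0mx.
have mb : (m, b) \in pairs d by apply/mem_pairs.
by have [i _ ->] := coords_row mb; apply: row_sub.
Qed.

Lemma basis_mx_free : row_free basis_mx.
Proof.
have full : row_full basis_mx.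
  rewrite -sub1mx; apply/row_subP => j.
  have := mem_nth [::] (ltn_ord j); set a := nth _ _ _ => ad.
  have := ad; rewrite mem_comps => /and3P[ca an _].
  have := coords_generated (generated_monq n ca); congr (_ <= _)%MS.
  apply/rowP => j'; rewrite !mxE mcoeff_monq.
  have := mem_nth [::] (ltn_ord j'); rewrite mem_comps => /and3P[ca' an' _].
  by rewrite strip_std // nth_uniq ?uniq_comps // eq_sym.
rewrite /row_free eqn_leq rank_leq_row /=; move/eqP: full => ->; exact: size_pairs.
Qed.
End Degree.

Lemma mcoeff_sym0 t : (t \mPo S)@_0%MM = t@_0%MM.
Proof.
rewrite comp_mpolyEX raddf_sum /=.
have E m : m != 0%MM -> ('X_[rat, m] \mPo S)@_0%MM = 0.
  move=> m0; apply: (dhomog_nemf_coeff (dhomog_XS _ _)); rewrite /= mdeg0 eq_sym -lt0n.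
  by apply: leq_trans (leq_mdeg_mnmwgt m); rewrite lt0n mdeg_eq0.
rewrite (eq_bigr (fun m => if m == 0%MM then t@_0%MM else 0)); last first.
  move=> m _; rewrite mcoeffZ; have [->|m0] := eqVneq m 0%MM; last by rewrite E ?mulr0.
  by rewrite mpolyX0 comp_mpoly1 mcoeff1 eqxx mulr1.
have [t0|t0] := boolP (0%MM \in msupp t).
  by rewrite (bigD1_seq 0%MM) ?msupp_uniq //= eqxx big1 ?addr0 // => m /negbTE ->.
rewrite big_seq big1; first by apply/esym/eqP; rewrite mcoeff_eq0.
by move=> m mt; case: eqP => // m0; rewrite -m0 mt in t0.
Qed.

Lemma coefficient_functional b0 : inB n b0 ->
  exists k (l : {linear {mpoly rat[n]} -> 'rV[rat]_k}) (i0 : 'I_k),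
    forall u b, u \is symmetric -> inB n b ->
      l (u * qschur n b) 0 i0 = if b == b0 then u@_0%MM else 0.
Proof.
move=> Bb0; pose d := sumn b0.
have [Y XY] := row_freeP (basis_mx_free d).
have mb0 : (0%MM, b0) \in pairs d by apply/mem_pairs; rewrite mnmwgt0.
have [i0 Ei0 _] := coords_row mb0.
exists _, (mulmxr Y \o coords d : {linear _ -> _}), i0 => u b su Bb.
have [t [<- _]] := sym_fundamental su; rewrite mcoeff_sym0.
have E m : ((mulmxr Y \o coords d) (('X_[m] \mPo S) * qschur n b)) 0 i0 =
    ((m == 0%MM) && (b == b0))%:R.
  rewrite /=; have [wd|ne] := eqVneq (mnmwgt m + sumn b)%N d; last first.
    rewrite coords_degree // mul0mx mxE; case: eqP => //= m0; case: eqP => // bb.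
    by rewrite m0 bb mnmwgt0 eqxx in ne.
  have mb : (m, b) \in pairs d by apply/mem_pairs.
  have [i Ei ->] := coords_row mb.
  rewrite -row_mul XY !mxE; congr (_%:R); congr nat_of_bool.
  rewrite -xpair_eqE -Ei -Ei0 nth_uniq ?undup_uniq //.
rewrite comp_mpolyEX mulr_suml linear_sum summxE.
rewrite (eq_bigr (fun m => if m == 0%MM then t@_m *+ (b == b0) else 0)); last first.
  move=> m _; rewrite -scalerAl linearZ [LHS]mxE E; case: eqP => _ /=; last by rewrite mulr0.
  by rewrite mulr_natr.
have -> : (if b == b0 then t@_0%MM else 0) = t@_0%MM *+ (b == b0) by case: eqP.
have [t0|t0] := boolP (0%MM \in msupp t).
  by rewrite (bigD1_seq 0%MM) ?msupp_uniq //= eqxx big1 ?addr0 // => m /negbTE ->.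
rewrite big_seq big1; first by apply/esym; rewrite (memN_msupp_eq0 t0) mul0rn.
by move=> m mt; case: eqP => // m0; rewrite -m0 mt in t0.
Qed.
End Functional.

Theorem theorem4p1 (n : nat) (hn : (1 <= n)%N) :
  [/\ (* the S_beta lie in QSym_n, so they have images in R_n *)
      (forall b, inB n b -> qsym (qschur n b)),
      (* linear independence of the images in R_n = QSym_n / E_n *)
      (forall (s : seq (seq nat)) (c : seq nat -> rat),
         uniq s -> (forall b, b \in s -> inB n b) ->
         in_En (\sum_(b <- s) c b *: qschur n b) ->
         forall b, b \in s -> c b = 0) &
      (* spanning: every element of QSym_n is congruent mod E_n to a combination *)
      (forall f : {mpoly rat[n]}, qsym f ->
         exists (s : seq (seq nat)) (c : seq nat -> rat),
           (forall b, b \in s -> inB n b) /\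
           in_En (f - \sum_(b <- s) c b *: qschur n b))].
Proof.
split=> [b Bb|s c us Bs [l [Hl E]] b0 b0s|f qf].
- exact: qsym_qschur.
- have [k [ell [i0 ellE]]] := coefficient_functional (Bs _ b0s).
  have lS b : b \in s -> ell (qschur n b) 0 i0 = (b == b0)%:R.
    move=> bs; have := ellE 1 b (rpred1 _) (Bs _ bs); rewrite mul1r mcoeff1 eqxx => ->.
    by case: eqP.
  have : ell (\sum_(b <- s) c b *: qschur n b) 0 i0 = c b0.
    rewrite linear_sum summxE (bigD1_seq b0) //= linearZ mxE lS // eqxx mulr1.
    rewrite big_seq_cond big1 ?addr0 // => b /andP[bs bb0].
    by rewrite linearZ mxE lS // (negbTE bb0) mulr0.
  (* Each term of an element of the ideal is [g * u] with [u] symmetric without constant term.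
     Expanding [g] over the generators gives products whose symmetric factor [v * u] has constant
     term 0. *)
  move=> <-; rewrite E linear_sum summxE big_seq big1 // => -[g u] /Hl[/= qg su u0].
  have [r [Hr ->]] := generated_qsym qg.
  rewrite mulr_suml linear_sum summxE big_seq big1 // => -[v b] /Hr[/= sv Bb].
  rewrite mulrAC ellE //; last exact: rpredM.
  by case: eqP => // _; rewrite rmorphM /= u0 mulr0.
have [l [Hl ->]] := generated_qsym qf.
(* Modulo the ideal, every symmetric coefficient may be replaced by its constant term. *)
pose c b := \sum_(x <- l | x.2 == b) x.1@_0%MM.
exists (undup (map snd l)), c; split=> [b|].
  by rewrite mem_undup => /mapP[x /Hl[_ Bx] ->].
have -> : \sum_(b <- undup (map snd l)) c b *: qschur n b = \sum_(x <- l) x.1@_0%MM *: qschur n x.2.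
  under eq_bigr do rewrite /c scaler_suml.
  rewrite (exchange_big_dep xpredT) //= big_seq [RHS]big_seq; apply: eq_bigr => x xl.
  rewrite big_mkcond (bigD1_seq x.2) ?undup_uniq ?mem_undup ?map_f //= eqxx big1 ?addr0 // => b.
  by rewrite eq_sym => /negbTE ->.
exists [seq (qschur n x.2, x.1 - (x.1@_0%MM)%:MP) | x <- l]; split.
  move=> _ /mapP[x /Hl[sx Bx] ->] /=; split; first exact: qsym_qschur.
    by rewrite rpredB // -[_%:MP]mulr1 mul_mpolyC rpredZ // rpred1.
  by rewrite mcoeffB mcoeffC eqxx mulr1 subrr.
rewrite big_map -sumrB; apply: eq_bigr => x _ /=.
by rewrite mulrBr [X in _ = X - _]mulrC [X in _ = _ - X]mulrC mul_mpolyC.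
Qed.
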